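(* Let $\varepsilon\in(0,1/4]$, $\rho=\varepsilon^{-1}$, and $(x^0,y^0)\in\mathcal X\times\mathcal Y$ with $\tilde f(x^0,y^0)\le\min_y\tilde f(x^0,y)+\varepsilon$. Define $$\widehat L=L_{\nabla f_1}+2\varepsilon^{-1}L_{\nabla\tilde f_1},\qquad \hat\alpha=\min\big\{1,\sqrt{4\varepsilon/(D_{\bf y}\widehat L)}\big\},$$ $$\hat\delta=(2+\hat\alpha^{-1})(D_{\bf x}^2+D_{\bf y}^2)\widehat L+\max\{\varepsilon/D_{\bf y},\hat\alpha\widehat L/4\}D_{\bf y}^2,$$ $$\widehat C=\frac{4\max\Big\{\frac1{2\widehat L},\min\big\{\frac{D_{\bf y}}{\varepsilon},\frac{4}{\hat\alpha\widehat L}\big\}\Big\}\Big[\hat\delta+2\hat\alpha^{-1}\big(f^*-f_{\rm low}+\varepsilon^{-1}(\tilde f_{\rm hi}-\tilde f_{\rm low})+\varepsilon D_{\bf y}/4+\widehat L(D_{\bf x}^2+D_{\bf y}^2)\big)\Big]}{\Big[(3\widehat L+\varepsilon/(2D_{\bf y}))^2/\min\{\widehat L,\varepsilon/(2D_{\bf y})\}+3\widehat L+\varepsilon/(2D_{\bf y})\Big]^{-2}\varepsilon^3},$$ $$\widehat K=\Big\lceil16(1+f(x^0,y^0)-f_{\rm low}+\varepsilon D_{\bf y}/4)\widehat L\varepsilon^{-2}+32(1+4D_{\bf y}^2\widehat L^2\varepsilon^{-2})\varepsilon-1\Big\rceil_+,$$ $$\widehat N=\Big(\big\lceil96\sqrt2\,(1+(24\widehat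 L+4\varepsilon/D_{\bf y})\widehat L^{-1})\big\rceil+2\Big)\max\Big\{2,\sqrt{D_{\bf y}\widehat L\varepsilon^{-1}}\Big\}\Big((\widehat K+1)(\log\widehat C)_++\widehat K+1+2\widehat K\log(\widehat K+1)\Big).$$ Then the penalty method (Algorithm 2, described in the context) outputs an approximate solution $(x_\varepsilon,y_\varepsilon)$ of the bilevel problem $\min\{f(x,y):y\in\operatorname{argmin}_z\tilde f(x,z)\}$ which, together with the point $z_\varepsilon$ generated by the method, satisfies $$\operatorname{dist}\big(0,\partial f(x_\varepsilon,y_\varepsilon)+\rho\,\partial\tilde f(x_\varepsilon,y_\varepsilon)-(\rho\nabla_x\tilde f(x_\varepsilon,z_\varepsilon);0)\big)\le\varepsilon,\qquad \operatorname{dist}\big(0,\rho\,\partial_z\tilde f(x_\varepsilon,z_\varepsilon)\big)\le\varepsilon,$$ $$\tilde f(x_\varepsilon,y_\varepsilon)\le\min_z\tilde f(x_\varepsilon,z)+\varepsilon\Big(1+f(x^0,y^0)-f_{\rm low}+2\varepsilon^3(\widehat L^{-1}+4D_{\bf y}^2\widehat L\varepsilon^{-2})+D_{\bf y}\varepsilon/4\Big),$$ after at most $\widehat N$ evaluations of $\nabla f_1$, $\nabla\tilde f_1$ and proximal operator of $f_2$ and $\tilde f_2$, respectively.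
   Context: Setting. $f(x,y)=f_1(x,y)+f_2(x)$ and $\tilde f(x,y)=\tilde f_1(x,y)+\tilde f_2(y)$ for $x\in\mathbb R^n$, $y\in\mathbb R^m$, where $f_2:\mathbb R^n\to\mathbb R\cup\{\infty\}$ and $\tilde f_2:\mathbb R^m\to\mathbb R\cup\{\infty\}$ are proper closed convex functions. Put $\mathcal X=\operatorname{dom} f_2$, $\mathcal Y=\operatorname{dom}\tilde f_2$. Assumed: (i) $f$ and $\tilde f$ are continuous on $\mathcal X\times\mathcal Y$; $\tilde f_1(x,\cdot)$ is convex for every $x\in\mathcal X$; $f_1,\tilde f_1$ are respectively $L_{\nabla f_1}$- and $L_{\nabla\tilde f_1}$-smooth on $\mathcal X\times\mathcal Y$ (gradients Lipschitz there with these constants); (ii) the proximal operators of $f_2$ and $\tilde f_2$ can be exactly evaluated; (iii) $\mathcal X,\mathcal Y$ are compact. The bilevel problem $f^*=\min\{f(x,y):y\in\operatorname{argmin}_z\tilde f(x,z)\}$ is assumed to have an optimal solution, with optimal value $f^*$. Constants: $D_{\bf x}=\max\{\|u-v\|:u,v\in\mathcal X\}$, $D_{\bf y}=\max\{\|u-v\|:u,v\in\mathcal Y\}$, $\tilde f_{\rm hi}=\max_{\mathcal X\times\mathcal Y}\tilde f$, $\tilde f_{\rm low}=\min_{\mathcal X\times\mathcal Y}\tilde f$, $f_{\rm low}=\min_{\mathcal X\times\mathcal Y}f$. $t_+=\max\{t,0\}$ and $\lceil t\rceil_+=\max\{\lceil t\rceil,0\}$. $(u;v)$ stacks $v$ under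 $u$; $\|\cdot\|$ is the Euclidean norm. Subdifferential: for lower semicontinuous $\phi$ and $x\in\operatorname{dom}\phi$, $\partial\phi(x)=\{s: s^Td\le\phi'(x;d)\ \forall d\}$, where $\phi'(x;d)=\limsup_{x'\to x,\ \phi(x')\to\phi(x),\ t\downarrow0}\ \inf_{d'\to d}[\phi(x'+td')-\phi(x')]/t$; it is the convex subdifferential for convex $\phi$, and $\partial(\phi_1+\phi_2)(x)=\nabla\phi_1(x)+\partial\phi_2(x)$ when $\phi_1$ is continuously differentiable at $x$. $\partial_z$ is the subdifferential with respect to the indicated variable (the second argument of $\tilde f$); $\nabla_x\tilde f=\nabla_x\tilde f_1$. Proximal operator: $\operatorname{prox}_p(x)=\operatorname{argmin}_{x'}\{\frac12\|x'-x\|^2+p(x')\}$. Evaluating $\operatorname{prox}_{\gamma p}$ for any $\gamma>0$ counts as one evaluation of the proximal operator of $p$. Algorithm 2 (penalty method). With $\rho=\varepsilon^{-1}$, consider $\min_{x,y}\max_z P_\rho(x,y,z)$ with $P_\rho(x,y,z)=f(x,y)+\rho(\tilde f(x,y)-\tilde f(x,z))=h(u,v)+p(u)-q(v)$, where $u=(x,y)$, $v=z$, $h=f_1(x,y)+\rho\tilde f_1(x,y)-\rho\tilde f_1(x,z)$, $p=f_2(x)+\rho\tilde f_2(y)$, $q=\rho\tilde f_2(z)$. Call Method M below with $\epsilon=\varepsilon$, $\epsilon_0=\varepsilon^{3/2}$, $\hat u^0=(x^0,y^0)$, $\hat v^0=y^0$, $L_{\nabla h}=\widehat L$ (and $D_q=D_{\bf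 y}$), obtaining $((x_\varepsilon,y_\varepsilon),z_\varepsilon)$; output $(x_\varepsilon,y_\varepsilon)$. Method M, for $\min_u\max_v\{h(u,v)+p(u)-q(v)\}$ ($h$ being $L_{\nabla h}$-smooth and concave in $v$; $p,q$ convex with compact domains; $D_q$ the diameter of $\operatorname{dom}q$). Input $\epsilon>0$, $\epsilon_0\in(0,\epsilon/2]$, $(u^0,v^0)=(\hat u^0,\hat v^0)\in\operatorname{dom}p\times\operatorname{dom}q$, $\epsilon_k=\epsilon_0/(k+1)$. For $k=0,1,2,\dots$: let $h_k(u,v)=h(u,v)-\epsilon\|v-v^0\|^2/(4D_q)+L_{\nabla h}\|u-u^k\|^2$; call Method S below with $\bar h=h_k$, $\tau=\epsilon_k$, $\sigma_u=L_{\nabla h}$, $\sigma_v=\epsilon/(2D_q)$, $\bar L=3L_{\nabla h}+\epsilon/(2D_q)$, $\bar s^0=s_f^0=-\sigma_uu^k$, $\bar v^0=v_f^0=v^k$, and denote its output by $(u^{k+1},v^{k+1})$; terminate and output $(u^{k+1},v^{k+1})$ if $\|u^{k+1}-u^k\|\le\epsilon/(4L_{\nabla h})$. Method S, for $\min_u\max_v\{\bar h(u,v)+p(u)-q(v)\}$ with $\bar h$ $\sigma_u$-strongly convex in $u$, $\sigma_v$-strongly concave in $v$, and $\bar L$-smooth. Input $\tau>0$, $s^0=\bar s^0=s_f^0\in-\sigma_u\operatorname{dom}p$, $v^0=\bar v^0=v_f^0\in\operatorname{dom}q$. Set $\bar\alpha=\min\{1,\sqrt{8\sigma_v/\sigma_u}\}$,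 $\eta_s=\sigma_u/2$, $\eta_v=\min\{1/(2\sigma_v),4/(\bar\alpha\sigma_u)\}$, $\beta_t=2/(t+3)$, $\zeta=(2\sqrt5(1+8\bar L/\sigma_u))^{-1}$, $\gamma_u=\gamma_v=8\sigma_u^{-1}$, $\hat\zeta=\min\{\sigma_u,\sigma_v\}/\bar L^2$, $\hat h(u,v)=\bar h(u,v)-\sigma_u\|u\|^2/2+\sigma_v\|v\|^2/2$, $a_u^k(u,v)=\nabla_u\hat h(u,v)+\sigma_u(u-\sigma_u^{-1}s_g^k)/2$, $a_v^k(u,v)=-\nabla_v\hat h(u,v)+\sigma_vv+\sigma_u(v-v_g^k)/8$. For $k=0,1,2,\dots$: (1) $(s_g^k,v_g^k)=\bar\alpha(s^k,v^k)+(1-\bar\alpha)(s_f^k,v_f^k)$; $(u^{k,-1},v^{k,-1})=(-\sigma_u^{-1}s_g^k,v_g^k)$. (2) $u^{k,0}=\operatorname{prox}_{\zeta\gamma_up}(u^{k,-1}-\zeta\gamma_ua_u^k(u^{k,-1},v^{k,-1}))$, $v^{k,0}=\operatorname{prox}_{\zeta\gamma_vq}(v^{k,-1}-\zeta\gamma_va_v^k(u^{k,-1},v^{k,-1}))$, $b_u^{k,0}=\frac1{\zeta\gamma_u}(u^{k,-1}-\zeta\gamma_ua_u^k(u^{k,-1},v^{k,-1})-u^{k,0})$, $b_v^{k,0}=\frac1{\zeta\gamma_v}(v^{k,-1}-\zeta\gamma_va_v^k(u^{k,-1},v^{k,-1})-v^{k,0})$, $t=0$. (3) While $\gamma_u\|a_u^k(u^{k,t},v^{k,t})+b_u^{k,t}\|^2+\gamma_v\|a_v^k(u^{k,t},v^{k,t})+b_v^{k,t}\|^2>\gamma_u^{-1}\|u^{k,t}-u^{k,-1}\|^2+\gamma_v^{-1}\|v^{k,t}-v^{k,-1}\|^2$: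 set $u^{k,t+1/2}=u^{k,t}+\beta_t(u^{k,0}-u^{k,t})-\zeta\gamma_u(a_u^k(u^{k,t},v^{k,t})+b_u^{k,t})$, $v^{k,t+1/2}=v^{k,t}+\beta_t(v^{k,0}-v^{k,t})-\zeta\gamma_v(a_v^k(u^{k,t},v^{k,t})+b_v^{k,t})$; with $\xi_u=u^{k,t}+\beta_t(u^{k,0}-u^{k,t})-\zeta\gamma_ua_u^k(u^{k,t+1/2},v^{k,t+1/2})$ and $\xi_v=v^{k,t}+\beta_t(v^{k,0}-v^{k,t})-\zeta\gamma_va_v^k(u^{k,t+1/2},v^{k,t+1/2})$, set $u^{k,t+1}=\operatorname{prox}_{\zeta\gamma_up}(\xi_u)$, $v^{k,t+1}=\operatorname{prox}_{\zeta\gamma_vq}(\xi_v)$, $b_u^{k,t+1}=\frac1{\zeta\gamma_u}(\xi_u-u^{k,t+1})$, $b_v^{k,t+1}=\frac1{\zeta\gamma_v}(\xi_v-v^{k,t+1})$; $t\leftarrow t+1$. (4) $(u_f^{k+1},v_f^{k+1})=(u^{k,t},v^{k,t})$; $(s_f^{k+1},w_f^{k+1})=(\nabla_u\hat h(u_f^{k+1},v_f^{k+1})+b_u^{k,t},\,-\nabla_v\hat h(u_f^{k+1},v_f^{k+1})+b_v^{k,t})$; $s^{k+1}=s^k+\eta_s\sigma_u^{-1}(s_f^{k+1}-s^k)-\eta_s(u_f^{k+1}+\sigma_u^{-1}s_f^{k+1})$; $v^{k+1}=v^k+\eta_v\sigma_v(v_f^{k+1}-v^k)-\eta_v(w_f^{k+1}+\sigma_vv_f^{k+1})$;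 $u^{k+1}=-\sigma_u^{-1}s^{k+1}$. (5) $\hat u^{k+1}=\operatorname{prox}_{\hat\zeta p}(u^{k+1}-\hat\zeta\nabla_u\bar h(u^{k+1},v^{k+1}))$, $\hat v^{k+1}=\operatorname{prox}_{\hat\zeta q}(v^{k+1}+\hat\zeta\nabla_v\bar h(u^{k+1},v^{k+1}))$; terminate and output $(\hat u^{k+1},\hat v^{k+1})$ if $\|\hat\zeta^{-1}(u^{k+1}-\hat u^{k+1},\hat v^{k+1}-v^{k+1})-(\nabla\bar h(u^{k+1},v^{k+1})-\nabla\bar h(\hat u^{k+1},\hat v^{k+1}))\|\le\tau$.
   Formalization: The method also queries ∇f₁, ∇f̃₁ outside X×Y, where they may not exist; it uses instead any maps equal to these gradients on X×Y and Lipschitz with the same constants on the whole space. D_y>0 and L̂>0 are assumed, as the constants divide by them. *)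

(* Defs.v *)
From mathcomp Require Export all_boot all_order all_algebra.
From mathcomp Require Export all_classical all_reals all_analysis.
Export Order.TTheory GRing.Theory Num.Theory.
Export numFieldNormedType.Exports.

Set Implicit Arguments.
Unset Strict Implicit.
Unset Printing Implicit Defensive.

Global Open Scope classical_set_scope.
Global Open Scope ring_scope.

Section ConvexAnalysis.
Context (R : realType).

(* Euclidean norm; the library norm `|x| on row vectors is the sup norm. *)
Definition dot k (x y : 'rV[R]_k) : R := \sum_i x 0 i * y 0 i.
Definition enorm k (x : 'rV[R]_k) : R := Num.sqrt (dot x x).

Definition dom k (phi : 'rV[R]_k -> \bar R) : set 'rV[R]_k :=
  [set x | (phi x < +oo)%E].

Definition proper k (phi : 'rV[R]_k -> \bar R) : Prop :=
  (forall x, (-oo < phi x)%E) /\ (exists x, dom phi x).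

Definition econvex k (phi : 'rV[R]_k -> \bar R) : Prop :=
  forall (x y : 'rV[R]_k) (t : R), 0 <= t <= 1 ->
    (phi (t *: x + (1 - t) *: y)%R
       <= t%:E * phi x + (1 - t)%R%:E * phi y)%E.

Definition proper_closed_convex k (phi : 'rV[R]_k -> \bar R) : Prop :=
  [/\ proper phi, lower_semicontinuous phi & econvex phi].

Definition argmin k (phi : 'rV[R]_k -> \bar R) : set 'rV[R]_k :=
  [set x | forall y, (phi x <= phi y)%E].

(* The argmin is a singleton when p is proper, closed and convex. *)
Definition prox k (p : 'rV[R]_k -> \bar R) (x : 'rV[R]_k) : 'rV[R]_k :=
  xget 0 (argmin (fun x' => ((2^-1 * enorm (x' - x) ^+ 2)%R%:E + p x')%E)).

Definition diam k (A : set 'rV[R]_k) : R :=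
  sup [set enorm (w.1 - w.2) | w in A `*` A].

Definition dist k (x : 'rV[R]_k) (A : set 'rV[R]_k) : \bar R :=
  ereal_inf [set (enorm (x - s))%:E | s in A].

(* The filter of x' -> x with phi x' -> phi x. *)
Definition attentive_nbhs k (phi : 'rV[R]_k -> \bar R) (x : 'rV[R]_k) :
    set (set 'rV[R]_k) :=
  [set A | exists2 B : set ('rV[R]_k * \bar R),
             nbhs (x, phi x) B & forall x', B (x', phi x') -> A x'].

(* phi'(x; d), where "limsup inf_{d' -> d}" stands for
   sup_{delta > 0} limsup inf_{d' in ball d delta}. *)
Definition subderivative k (phi : 'rV[R]_k -> \bar R) (x d : 'rV[R]_k) :
    \bar R :=
  ereal_sup [set limf_esup
      (fun xt : 'rV[R]_k * R =>
         ereal_inf [set ((phi (xt.1 + xt.2 *: d')%R - phi xt.1)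
                           * (xt.2^-1)%R%:E)%E | d' in ball d delta])
      (filter_prod (attentive_nbhs phi x) (0 : R)^'+)
    | delta in [set delta : R | 0 < delta]].

Definition subdifferential k (phi : 'rV[R]_k -> \bar R) (x : 'rV[R]_k) :
    set 'rV[R]_k :=
  [set s | dom phi x /\ forall d, ((dot s d)%:E <= subderivative phi x d)%E].

Definition grad k (g : 'rV[R]_k -> R) (x : 'rV[R]_k) : 'rV[R]_k :=
  \row_i 'D_(delta_mx 0 i) g x.

Definition lipschitz_map k (L : R) (A : set 'rV[R]_k)
    (G : 'rV[R]_k -> 'rV[R]_k) : Prop :=
  forall x x', A x -> A x' -> enorm (G x - G x') <= L * enorm (x - x').

Definition smooth_on k (L : R) (A : set 'rV[R]_k) (g : 'rV[R]_k -> R) : Prop :=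
  (forall x, A x -> differentiable g x) /\ lipschitz_map L A (grad g).

(* The methods below also query gradients at points outside A (extrapolated
   points), where L-smoothness on A says nothing about g.  The gradient oracle
   used there is any map which equals the gradient on A and is L-Lipschitz on
   the whole space: the gradient itself when g is L-smooth everywhere;
   otherwise, for instance, the gradient at the projection onto A, when A is
   closed and convex. *)
Definition gradient_oracle k (L : R) (A : set 'rV[R]_k) (g : 'rV[R]_k -> R)
    (G : 'rV[R]_k -> 'rV[R]_k) : Prop :=
  (forall x, A x -> G x = grad g x) /\ lipschitz_map L setT G.

Definition pos_part (t : R) : R := Num.max t 0.
Definition ceil_pos (t : R) : R := (Num.max (Num.ceil t) 0)%:~R.

End ConvexAnalysis.

(* Numbers of evaluations of grad f1, grad ft1, prox of f2, prox of ft2. *)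
Record calls := Calls {
  n_grad_f1 : nat; n_grad_ft1 : nat; n_prox_f2 : nat; n_prox_ft2 : nat }.

Definition no_calls := Calls 0 0 0 0.

Definition add_calls (c d : calls) : calls :=
  Calls (n_grad_f1 c + n_grad_f1 d) (n_grad_ft1 c + n_grad_ft1 d)
        (n_prox_f2 c + n_prox_f2 d) (n_prox_ft2 c + n_prox_ft2 d).

(* A program is the relation "terminates with result a after calls c".  All the
   programs below are deterministic; one that diverges is related to nothing. *)
Definition prog (A : Type) : Type := A -> calls -> Prop.

Definition ret A (a : A) : prog A := fun b c => b = a /\ c = no_calls.

Definition bind A B (e : prog A) (k : A -> prog B) : prog B :=
  fun b c => exists a c1 c2, [/\ e a c1, k a b c2 & c = add_calls c1 c2].

Definition oracle A (a : A) (c : calls) : prog A := fun b d => b = a /\ d = c.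

Notation "x <-- e ;; k" := (bind e (fun x => k))
  (at level 100, e at next level, right associativity).

(* Repeat step from state s until it returns a result (inr). *)
Inductive loop S A (step : S -> prog (S + A)) : S -> prog A :=
| loop_stop s a c : step s (inr a) c -> loop step s a c
| loop_next s s' a c c' :
    step s (inl s') c -> loop step s' a c' -> loop step s a (add_calls c c').

Section MethodS.
Context (R : realType) (nu nv : nat).
Local Notation U := 'rV[R]_nu.
Local Notation V := 'rV[R]_nv.
(* gradh u v computes (nabla_u h, nabla_v h) at (u, v); proxp gamma and
   proxq gamma compute the proximal operators of gamma p and gamma q. *)
Context (gradh : U -> V -> prog (U * V)).
Context (proxp : R -> U -> prog U) (proxq : R -> V -> prog V).
Context (su sv Lbar tau : R).

Definition alpha_bar : R := Num.min 1 (Num.sqrt (8 * sv / su)).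
Definition eta_s : R := su / 2.
Definition eta_v : R := Num.min (1 / (2 * sv)) (4 / (alpha_bar * su)).
Definition beta (t : nat) : R := 2 / (t%:R + 3).
Definition zeta : R := (2 * Num.sqrt 5 * (1 + 8 * Lbar / su))^-1.
Definition gamma : R := 8 * su^-1.
Definition zeta_hat : R := Num.min su sv / Lbar ^+ 2.

(* In the following, g is the (already computed) gradient of h at (u, v). *)
Definition grad_hat (u : U) (v : V) (g : U * V) : U * V :=
  (g.1 - su *: u, g.2 + sv *: v).

Definition a_u (sg : U) (u : U) (v : V) (g : U * V) : U :=
  (grad_hat u v g).1 + (su / 2) *: (u - su^-1 *: sg).

Definition a_v (vg : V) (u : U) (v : V) (g : U * V) : V :=
  - (grad_hat u v g).2 + sv *: v + (su / 8) *: (v - vg).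

Record inner_state := Inner {
  in_t : nat; in_u : U; in_v : V; in_bu : U; in_bv : V;
  in_g : U * V (* gradient of h at (in_u, in_v) *) }.

Definition inner_init (sg : U) (vg : V) : prog inner_state :=
  let u := - (su^-1 *: sg) in
  let v := vg in
  g <-- gradh u v ;;
  let xi_u := u - (zeta * gamma) *: a_u sg u v g in
  let xi_v := v - (zeta * gamma) *: a_v vg u v g in
  u0 <-- proxp (zeta * gamma) xi_u ;;
  v0 <-- proxq (zeta * gamma) xi_v ;;
  g0 <-- gradh u0 v0 ;;
  ret (Inner 0 u0 v0 ((zeta * gamma)^-1 *: (xi_u - u0))
                     ((zeta * gamma)^-1 *: (xi_v - v0)) g0).

(* u0, v0 : the anchor point u^{k,0}, v^{k,0} *)
Definition inner_step (sg : U) (vg : V) (u0 : U) (v0 : V) (i : inner_state) :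
    prog (inner_state + inner_state) :=
  let: Inner t u v bu bv g := i in
  let wu := a_u sg u v g + bu in
  let wv := a_v vg u v g + bv in
  if gamma * enorm wu ^+ 2 + gamma * enorm wv ^+ 2
       > gamma^-1 * enorm (u + su^-1 *: sg) ^+ 2
         + gamma^-1 * enorm (v - vg) ^+ 2
  then
    let cu := u + beta t *: (u0 - u) in
    let cv := v + beta t *: (v0 - v) in
    let uh := cu - (zeta * gamma) *: wu in
    let vh := cv - (zeta * gamma) *: wv in
    gh <-- gradh uh vh ;;
    let xi_u := cu - (zeta * gamma) *: a_u sg uh vh gh in
    let xi_v := cv - (zeta * gamma) *: a_v vg uh vh gh in
    u' <-- proxp (zeta * gamma) xi_u ;;
    v' <-- proxq (zeta * gamma) xi_v ;;
    g' <-- gradh u' v' ;;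
    ret (inl (Inner t.+1 u' v' ((zeta * gamma)^-1 *: (xi_u - u'))
                               ((zeta * gamma)^-1 *: (xi_v - v')) g'))
  else ret (inr i).

Record outer_state := Outer { out_s : U; out_v : V; out_sf : U; out_vf : V }.

Definition outer_step (o : outer_state) : prog (outer_state + U * V) :=
  let: Outer s v sf vf := o in
  let sg := alpha_bar *: s + (1 - alpha_bar) *: sf in
  let vg := alpha_bar *: v + (1 - alpha_bar) *: vf in
  i0 <-- inner_init sg vg ;;
  i <-- loop (inner_step sg vg (in_u i0) (in_v i0)) i0 ;;
  let uf' := in_u i in
  let vf' := in_v i in
  let gf := grad_hat uf' vf' (in_g i) in
  let sf' := gf.1 + in_bu i in
  let wf' := - gf.2 + in_bv i in
  let s' := s + (eta_s * su^-1) *: (sf' - s)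
              - eta_s *: (uf' + su^-1 *: sf') in
  let v' := v + (eta_v * sv) *: (vf' - v) - eta_v *: (wf' + sv *: vf') in
  let u' := - (su^-1 *: s') in
  g' <-- gradh u' v' ;;
  uh <-- proxp zeta_hat (u' - zeta_hat *: g'.1) ;;
  vh <-- proxq zeta_hat (v' + zeta_hat *: g'.2) ;;
  gh <-- gradh uh vh ;;
  if enorm (zeta_hat^-1 *: row_mx (u' - uh) (vh - v')
            - (row_mx g'.1 g'.2 - row_mx gh.1 gh.2)) <= tau
  then ret (inr (uh, vh))
  else ret (inl (Outer s' v' sf' vf')).

Definition method_S (s0 : U) (v0 : V) : prog (U * V) :=
  loop outer_step (Outer s0 v0 s0 v0).

End MethodS.

Section MethodM.
Context (R : realType) (nu nv : nat).
Local Notation U := 'rV[R]_nu.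
Local Notation V := 'rV[R]_nv.
Context (gradh : U -> V -> prog (U * V)).
Context (proxp : R -> U -> prog U) (proxq : R -> V -> prog V).
Context (Lh Dq eps eps0 : R) (v0 : V).

Definition gradh_k (uk : U) (u : U) (v : V) : prog (U * V) :=
  g <-- gradh u v ;;
  ret (g.1 + (2 * Lh) *: (u - uk), g.2 - (eps / (2 * Dq)) *: (v - v0)).

Definition M_step (w : nat * U * V) : prog (nat * U * V + U * V) :=
  let: (k, uk, vk) := w in
  r <-- method_S (gradh_k uk) proxp proxq
          Lh (eps / (2 * Dq)) (3 * Lh + eps / (2 * Dq)) (eps0 / k.+1%:R)
          (- (Lh *: uk)) vk ;;
  if enorm (r.1 - uk) <= eps / (4 * Lh)
  then ret (inr r) else ret (inl (k.+1, r.1, r.2)).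

Definition method_M (u0 : U) : prog (U * V) := loop M_step (0%N, u0, v0).

End MethodM.

(* f(x,y) = f1(x,y) + f2(x),  ft(x,y) = ft1(x,y) + ft2(y) *)
Record bilevel (R : realType) (n m : nat) := Bilevel {
  f1 : 'rV[R]_n -> 'rV[R]_m -> R;
  f2 : 'rV[R]_n -> \bar R;
  ft1 : 'rV[R]_n -> 'rV[R]_m -> R;
  ft2 : 'rV[R]_m -> \bar R }.

Section Bilevel.
Context (R : realType) (n m : nat).

(* R^n x R^m is identified with R^(n+m). *)
Definition joint T (g : 'rV[R]_n -> 'rV[R]_m -> T) (w : 'rV[R]_(n + m)) : T :=
  g (lsubmx w) (rsubmx w).

Context (B : bilevel R n m).

Definition f (x : 'rV[R]_n) (y : 'rV[R]_m) : \bar R :=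
  ((f1 B x y)%:E + f2 B x)%E.
Definition ft (x : 'rV[R]_n) (y : 'rV[R]_m) : \bar R :=
  ((ft1 B x y)%:E + ft2 B y)%E.

Definition X : set 'rV[R]_n := dom (f2 B).
Definition Y : set 'rV[R]_m := dom (ft2 B).
Definition XY : set 'rV[R]_(n + m) :=
  [set w | X (lsubmx w) /\ Y (rsubmx w)].

Definition min_ft (x : 'rV[R]_n) : \bar R := ereal_inf (range (ft x)).

Definition optimal_value (v : R) : Prop :=
  (exists x y, argmin (ft x) y /\ f x y = v%:E) /\
  (forall x y, argmin (ft x) y -> (v%:E <= f x y)%E).

Definition D_x : R := diam X.
Definition D_y : R := diam Y.
Definition ft_hi : R := sup [set fine (joint ft w) | w in XY].
Definition ft_low : R := inf [set fine (joint ft w) | w in XY].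
Definition f_low : R := inf [set fine (joint f w) | w in XY].

(* nabla_x ft *)
Definition grad_x_ft (x : 'rV[R]_n) (y : 'rV[R]_m) : 'rV[R]_n :=
  lsubmx (grad (joint (ft1 B)) (row_mx x y)).

Section Constants.
Context (L1 L2 fstar eps : R) (x0 : 'rV[R]_n) (y0 : 'rV[R]_m).

Definition rho : R := eps^-1.
Definition L_hat : R := L1 + 2 * eps^-1 * L2.
Definition alpha_hat : R := Num.min 1 (Num.sqrt (4 * eps / (D_y * L_hat))).
Definition delta_hat : R :=
  (2 + alpha_hat^-1) * (D_x ^+ 2 + D_y ^+ 2) * L_hat
  + Num.max (eps / D_y) (alpha_hat * L_hat / 4) * D_y ^+ 2.
Definition C_hat : R :=
  4 * Num.max (1 / (2 * L_hat)) (Num.min (D_y / eps) (4 / (alpha_hat * L_hat)))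
    * (delta_hat
       + 2 * alpha_hat^-1
         * (fstar - f_low + eps^-1 * (ft_hi - ft_low) + eps * D_y / 4
            + L_hat * (D_x ^+ 2 + D_y ^+ 2)))
  / (((3 * L_hat + eps / (2 * D_y)) ^+ 2 / Num.min L_hat (eps / (2 * D_y))
      + 3 * L_hat + eps / (2 * D_y)) ^- 2 * eps ^+ 3).
Definition K_hat : R :=
  ceil_pos (16 * (1 + fine (f x0 y0) - f_low + eps * D_y / 4) * L_hat * eps ^- 2
            + 32 * (1 + 4 * D_y ^+ 2 * L_hat ^+ 2 * eps ^- 2) * eps - 1).
Definition N_hat : R :=
  ((Num.ceil (96 * Num.sqrt 2
              * (1 + (24 * L_hat + 4 * eps / D_y) * L_hat^-1)))%:~R + 2)
  * Num.max 2 (Num.sqrt (D_y * L_hat * eps^-1))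
  * ((K_hat + 1) * pos_part (ln C_hat) + K_hat + 1
     + 2 * K_hat * ln (K_hat + 1)).

(* G1, G2 : gradient oracles for f1, ft1 *)
Context (G1 G2 : 'rV[R]_(n + m) -> 'rV[R]_(n + m)).

Definition eval_grad_f1 (w : 'rV[R]_(n + m)) : prog 'rV[R]_(n + m) :=
  oracle (G1 w) (Calls 1 0 0 0).
Definition eval_grad_ft1 (w : 'rV[R]_(n + m)) : prog 'rV[R]_(n + m) :=
  oracle (G2 w) (Calls 0 1 0 0).

(* h(u,v) = f1(x,y) + rho ft1(x,y) - rho ft1(x,z), u = (x,y), v = z *)
Definition pen_gradh (u : 'rV[R]_(n + m)) (z : 'rV[R]_m) :
    prog ('rV[R]_(n + m) * 'rV[R]_m) :=
  a <-- eval_grad_f1 u ;;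
  b <-- eval_grad_ft1 u ;;
  c <-- eval_grad_ft1 (row_mx (lsubmx u) z) ;;
  ret (a + rho *: b - rho *: row_mx (lsubmx c) 0, - (rho *: rsubmx c)).

Definition pen_p (u : 'rV[R]_(n + m)) : \bar R :=
  (f2 B (lsubmx u) + rho%:E * ft2 B (rsubmx u))%E.
Definition pen_q (z : 'rV[R]_m) : \bar R := (rho%:E * ft2 B z)%E.

(* p is separable, so that prox_{gamma p}(x,y) is the pair of prox_{gamma f2}(x)
   and prox_{gamma rho ft2}(y). *)
Definition pen_proxp (gamma : R) (u : 'rV[R]_(n + m)) : prog 'rV[R]_(n + m) :=
  oracle (prox (fun u' => gamma%:E * pen_p u')%E u) (Calls 0 0 1 1).
Definition pen_proxq (gamma : R) (z : 'rV[R]_m) : prog 'rV[R]_m :=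
  oracle (prox (fun z' => gamma%:E * pen_q z')%E z) (Calls 0 0 0 1).

Definition penalty_method : prog ('rV[R]_(n + m) * 'rV[R]_m) :=
  method_M pen_gradh pen_proxp pen_proxq L_hat D_y eps (eps `^ (3 / 2)) y0
    (row_mx x0 y0).

End Constants.
End Bilevel.

(* Main.v *)
Require Import Defs.
From mathcomp Require Import ring lra.

Set Implicit Arguments.
Unset Strict Implicit.
Unset Printing Implicit Defensive.

(** The penalty method is an inexact proximal-point method, applied to the
    nonconvex-concave problem  min_u max_z P_rho(u,z); its subproblems are
    solved by an accelerated dual method, whose own subproblems are solved by
    an anchored extragradient method.  The theorem holds because each of the
    three loops has a potential that forces it to stop in time, and because
    the tests that stop the loops are themselves approximate stationarity
    conditions.

    Inner loop.  It solves an inclusion 0 in A w + b, with b a subgradient at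
    w and A strongly monotone and Lipschitz.  Anchoring at the first prox point
    makes  (t+1)(t+2)(t+3)/4 |g|^2 + (t+1)(t+2) <g, w - w0>  nonincreasing,
    where g is the scaled residual A w + b ([anchored_potential_step]); hence
    |g| decays like 1/t.  As long as the stopping test fails, the distance of
    the starting point to the solution is controlled by |g| through strong
    monotonicity, so that only boundedly many steps are possible
    ([anchored_stop]).  The bound 31 (1 + 8 Lb/su) has to be this small: one
    step costs four evaluations of the gradient of ft1, because each gradient of
    the penalty function needs two of them, and the total has to stay below
    96 sqrt 2 (1 + 8 Lb/su).

    Middle loop.  A saddle problem that is su-strongly convex in u becomes,
    after dualising su |u|^2 / 2, the minimisation of a strongly convex function
    of (s,v) whose subgradients are delivered by the inner loop.  The loop is an
    accelerated proximal-point method for it, and the test that ends the inner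
    loop is exactly what makes the error of inexactness nonpositive
    ([accelerated_contraction]).  The resulting Lyapunov function shrinks by
    1 - alpha/2 per step, hence the logarithm in the complexity bound
    ([method_S_converges]).  The saddle point with which the iterates are
    compared is obtained from a strict contraction of a compact set
    ([variational_solution]), without a minimax theorem.

    Outer loop.  An approximate solution of a subproblem decreases the maximum
    over z of P_rho(u,z), smoothed by a small quadratic in z, by L times the
    square of the displacement, up to a summable error ([subproblem_descent]).
    So long displacements cannot occur more than K_hat times, and a short one
    makes the output nearly stationary for P_rho ([method_M_run]).  The bound on
    that maximum at the output also bounds the lower-level gap there.

    The gradient oracles are Lipschitz everywhere but are gradients only on the
    domain, and the methods query them outside of it.  Monotonicity and
    convexity are therefore used only between points of the domain; at
    extrapolated points the Lipschitz bound alone has to do ([anchored_start],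
    [residual_le]).  This costs constant factors, which the final count
    absorbs ([step_cost_ok]). *)

(** * Euclidean geometry of row vectors *)

Section Euclid.
Context (R : realType).
Implicit Types k : nat.

Lemma dotC k (x y : 'rV[R]_k) : dot x y = dot y x.
Proof. by apply: eq_bigr => i _; rewrite mulrC. Qed.

Lemma dotDl k (x y z : 'rV[R]_k) : dot (x + y) z = dot x z + dot y z.
Proof.
by rewrite /dot -big_split /=; apply: eq_bigr => i _; rewrite mxE mulrDl.
Qed.

Lemma dotZl k a (x y : 'rV[R]_k) : dot (a *: x) y = a * dot x y.
Proof.
by rewrite /dot mulr_sumr; apply: eq_bigr => i _; rewrite mxE mulrA.
Qed.

Lemma dotNl k (x y : 'rV[R]_k) : dot (- x) y = - dot x y.
Proof. by rewrite -scaleN1r dotZl mulN1r. Qed.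

Lemma dotDr k (x y z : 'rV[R]_k) : dot z (x + y) = dot z x + dot z y.
Proof. by rewrite dotC dotDl !(dotC z). Qed.

Lemma dotZr k a (x y : 'rV[R]_k) : dot y (a *: x) = a * dot y x.
Proof. by rewrite dotC dotZl dotC. Qed.

Lemma dotNr k (x y : 'rV[R]_k) : dot y (- x) = - dot y x.
Proof. by rewrite dotC dotNl dotC. Qed.

Lemma dot0l k (x : 'rV[R]_k) : dot 0 x = 0.
Proof. by rewrite -(scale0r (0 : 'rV[R]_k)) dotZl mul0r. Qed.

Lemma dot0r k (x : 'rV[R]_k) : dot x 0 = 0.
Proof. by rewrite dotC dot0l. Qed.

Definition dotE := (dotDl, dotDr, dotNl, dotNr, dotZl, dotZr, dot0l, dot0r).

Lemma dot_row_mx k l (x x' : 'rV[R]_k) (y y' : 'rV[R]_l) :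
  dot (row_mx x y) (row_mx x' y') = dot x x' + dot y y'.
Proof.
rewrite /dot big_split_ord /=; congr (_ + _); apply: eq_bigr => i _.
  by rewrite !row_mxEl.
by rewrite !row_mxEr.
Qed.

Lemma lsubmxB k l (w w' : 'rV[R]_(k + l)) :
  lsubmx (w - w') = lsubmx w - lsubmx w'.
Proof. exact: linearB. Qed.

Lemma rsubmxB k l (w w' : 'rV[R]_(k + l)) :
  rsubmx (w - w') = rsubmx w - rsubmx w'.
Proof. exact: linearB. Qed.

Lemma dot_split k l (w w' : 'rV[R]_(k + l)) :
  dot w w' = dot (lsubmx w) (lsubmx w') + dot (rsubmx w) (rsubmx w').
Proof. by rewrite -{1}[w]hsubmxK -{1}[w']hsubmxK dot_row_mx. Qed.

Lemma sub_row_mx k l (u u' : 'rV[R]_k) (v v' : 'rV[R]_l) :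
  row_mx u v - row_mx u' v' = row_mx (u - u') (v - v').
Proof. by rewrite opp_row_mx add_row_mx. Qed.

Lemma dot_ge0 k (x : 'rV[R]_k) : 0 <= dot x x.
Proof. by apply: sumr_ge0 => i _; rewrite -expr2 sqr_ge0. Qed.

Lemma enorm_ge0 k (x : 'rV[R]_k) : 0 <= enorm x.
Proof. exact: sqrtr_ge0. Qed.

Lemma enorm_sqr k (x : 'rV[R]_k) : enorm x ^+ 2 = dot x x.
Proof. by rewrite sqr_sqrtr // dot_ge0. Qed.

Lemma enorm_le k (x : 'rV[R]_k) a : 0 <= a -> dot x x <= a ^+ 2 -> enorm x <= a.
Proof. by move=> a0 h; rewrite -(ler_pXn2r (n:=2)) ?nnegrE ?enorm_ge0 // enorm_sqr. Qed.

Lemma dot_le_sqr k (x : 'rV[R]_k) a : enorm x <= a -> dot x x <= a ^+ 2.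
Proof.
move=> h; rewrite -enorm_sqr; have := enorm_ge0 x => h0.
by rewrite lerXn2r ?nnegrE // (le_trans h0).
Qed.

Lemma enorm0 k : enorm (0 : 'rV[R]_k) = 0.
Proof. by rewrite /enorm dot0l sqrtr0. Qed.

Lemma enormN k (x : 'rV[R]_k) : enorm (- x) = enorm x.
Proof. by rewrite /enorm !dotE opprK. Qed.

Lemma enormB k (x y : 'rV[R]_k) : enorm (x - y) = enorm (y - x).
Proof. by rewrite -enormN opprB. Qed.

Lemma enormZ k a (x : 'rV[R]_k) : 0 <= a -> enorm (a *: x) = a * enorm x.
Proof.
move=> a0; rewrite /enorm !dotE mulrA -expr2 sqrtrM ?sqr_ge0 //.
by rewrite sqrtr_sqr ger0_norm.
Qed.

Lemma enorm_eq0 k (x : 'rV[R]_k) : enorm x = 0 -> x = 0.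
Proof.
move=> h; have : dot x x == 0 by rewrite -enorm_sqr h expr0n.
rewrite psumr_eq0; last by move=> i _; rewrite -expr2 sqr_ge0.
move/allP => h2; apply/rowP => i; rewrite mxE.
by have := h2 i (mem_index_enum i); rewrite -expr2 sqrf_eq0 => /eqP.
Qed.

Lemma cauchy_schwarz k (x y : 'rV[R]_k) : dot x y <= enorm x * enorm y.
Proof.
have [x0|x0] := eqVneq (enorm x) 0.
  by rewrite (enorm_eq0 x0) dot0l enorm0 mul0r.
have [y0|y0] := eqVneq (enorm y) 0.
  by rewrite (enorm_eq0 y0) dot0r enorm0 mulr0.
have px : 0 < enorm x by rewrite lt_neqAle eq_sym x0 enorm_ge0.
have py : 0 < enorm y by rewrite lt_neqAle eq_sym y0 enorm_ge0.
have := dot_ge0 (enorm y *: x - enorm x *: y).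
rewrite !dotE (dotC y x) -!enorm_sqr => h.
have pxy : 0 < enorm x * enorm y by rewrite mulr_gt0.
rewrite -(ler_pM2l pxy); nra.
Qed.

Lemma enormD k (x y : 'rV[R]_k) : enorm (x + y) <= enorm x + enorm y.
Proof.
apply: enorm_le; first by rewrite addr_ge0 ?enorm_ge0.
have := cauchy_schwarz x y.
by rewrite !dotE (dotC y x) -!enorm_sqr; nra.
Qed.

Lemma enorm_dist k (x y z : 'rV[R]_k) :
  enorm (x - z) <= enorm (x - y) + enorm (y - z).
Proof. by rewrite (_ : x - z = (x - y) + (y - z)) ?enormD // addrA subrK. Qed.

Lemma enorm_entry k (x : 'rV[R]_k) i : `|x 0 i| <= enorm x.
Proof.
rewrite -(sqrtr_sqr (x 0 i)) ler_sqrt ?dot_ge0 // /dot (bigD1 i) //= -expr2.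
by rewrite lerDl sumr_ge0 // => j _; rewrite -expr2 sqr_ge0.
Qed.

Lemma enorm_row_mx0 k l (x : 'rV[R]_k) :
  enorm (row_mx x (0 : 'rV_l)) = enorm x.
Proof. by rewrite /enorm dot_row_mx dot0l addr0. Qed.

Lemma enorm_row_0mx k l (x : 'rV[R]_k) :
  enorm (row_mx (0 : 'rV_l) x) = enorm x.
Proof. by rewrite /enorm dot_row_mx dot0l add0r. Qed.

Lemma enorm_lsub k l (w : 'rV[R]_(k + l)) : enorm (lsubmx w) <= enorm w.
Proof.
rewrite -[w in X in _ <= X]hsubmxK /enorm dot_row_mx ler_sqrt.
  by rewrite lerDl dot_ge0.
by rewrite addr_ge0 ?dot_ge0.
Qed.

Lemma enorm_rsub k l (w : 'rV[R]_(k + l)) : enorm (rsubmx w) <= enorm w.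
Proof.
rewrite -[w in X in _ <= X]hsubmxK /enorm dot_row_mx ler_sqrt.
  by rewrite lerDr dot_ge0.
by rewrite addr_ge0 ?dot_ge0.
Qed.

End Euclid.

(** Expanding inner products produces both dot x y and dot y x, which the
    arithmetic tactics treat as different atoms; this orients each such pair in
    one way. *)
Ltac dot_sym := repeat match goal with
  | |- context [dot ?x ?y] =>
    tryif constr_eq x y then fail else
    match goal with |- context [dot y x] => rewrite (dotC y x) end
  end.

Section Subgradient.
Context (R : realType) (k : nat).
Local Notation W := 'rV[R]_k.

(** Only test points of K matter: elsewhere the extended function that phi
    stands for is +oo. *)
Definition subgrad (K : set W) (phi : W -> R) (w b : W) : Prop :=
  K w /\ forall z, K z -> phi w + dot b (z - w) <= phi z.

Lemma subgrad_monotone K phi w b w' b' :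
  subgrad K phi w b -> subgrad K phi w' b' -> 0 <= dot (b - b') (w - w').
Proof.
move=> [Kw hw] [Kw' hw']; have := hw _ Kw'; have := hw' _ Kw.
by rewrite !dotE; lra.
Qed.

End Subgradient.

(** * Minima of semicontinuous functions on compact sets of rows *)

Definition lsc_on (R : realType) (T : topologicalType) (K : set T) (phi : T -> R) :=
  forall x a, K x -> a < phi x -> \forall y \near x, K y -> a < phi y.

Lemma seq_argmin (R : realType) (T : eqType) (f : T -> R) (s : seq T) :
  s != [::] -> exists2 x, x \in s & forall y, y \in s -> f x <= f y.
Proof.
elim: s => // x [|x' s] ih _.
  by exists x; rewrite ?mem_head // => y; rewrite inE => /eqP ->.
have [//|z zs hz] := ih.
have [xz|zx] := lerP (f x) (f z).
  exists x; rewrite ?mem_head // => y; rewrite inE => /orP[/eqP -> //|/hz].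
  exact: le_trans.
by exists z; [rewrite inE zs orbT|move=> y; rewrite inE => /orP[/eqP ->|/hz //]; exact: ltW].
Qed.

(** If no point of K were a minimum, the interiors of the sets where phi y <
    phi, for y in K, would cover K; the y with the lowest value in a finite
    subcover lies in none of its members. *)
Lemma lsc_compact_min (R : realType) (T : ptopologicalType) (K : set T) (phi : T -> R) :
  K !=set0 -> compact K -> lsc_on K phi ->
  exists2 x, K x & forall y, K y -> phi x <= phi y.
Proof.
move=> K0 cK lscK; apply: contrapT => nomin.
have below x : K x -> exists2 y, K y & phi y < phi x.
  move=> Kx; apply: contrapT => h; apply: nomin; exists x => // y Ky.
  by rewrite leNgt; apply/negP => yx; apply: h; exists y.
move: cK; rewrite compact_cover.
move=> /(_ _ K (fun y => interior [set x | K x -> phi y < phi x])) [].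
- by move=> i _; exact: open_interior.
- move=> x Kx; have [y Ky yx] := below x Kx.
  by exists y => //; exact: lscK.
move=> D' D'K cov.
have [x0 Kx0] := K0.
(* The subcover is not empty, because K is not. *)
have D'0 : (finmap.enum_fset D') != [::].
  have [y /= yD _] := cov _ Kx0.
  by apply/eqP => e; have : y \in finmap.enum_fset D' := yD; rewrite e.
have [y yD hy] := seq_argmin phi D'0.
have Ky : K y by have := D'K y yD; rewrite inE.
have [z /= zD] := cov _ Ky.
move=> /(@interior_subset _ _ _) /= /(_ Ky).
by rewrite ltNge hy.
Qed.

Section RowTopology.
Context (R : realType).

Lemma mx_norm_entry k (x : 'rV[R]_k) i : `|x 0 i| <= `|x|.
Proof.
rewrite [`|x|]mx_normrE.
by have := le_bigmax_cond (0 : R) (fun ij : 'I_1 * 'I_k => `|x ij.1 ij.2|) (isT : xpredT (0, i)).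
Qed.

Lemma mx_norm_le k (x : 'rV[R]_k) a :
  0 <= a -> (forall i, `|x 0 i| <= a) -> `|x| <= a.
Proof.
move=> a0 h; rewrite [`|x|]mx_normrE; apply: bigmax_le => // -[i j] _ /=.
by rewrite (ord1 i).
Qed.

Lemma enorm_le_mx_norm k (x : 'rV[R]_k) : enorm x <= Num.sqrt k%:R * `|x|.
Proof.
apply: enorm_le; first by rewrite mulr_ge0 // sqrtr_ge0.
rewrite exprMn sqr_sqrtr ?ler0n // mulr_natl.
apply: (@le_trans _ _ (\sum_(i < k) `|x| ^+ 2)); last by rewrite sumr_const card_ord.
apply: ler_sum => i _; rewrite -expr2 -real_normK ?num_real //.
by rewrite lerXn2r ?nnegrE // mx_norm_entry.
Qed.

(** The topology of row vectors comes from the sup norm; this and the next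
    lemma transfer it to the Euclidean norm. *)
Lemma near_enorm k (x : 'rV[R]_k) e : 0 < e -> \forall y \near x, enorm (y - x) < e.
Proof.
move=> e0; pose c : R := Num.sqrt k%:R + 1.
have c0 : 0 < c by rewrite /c ltr_wpDl // sqrtr_ge0.
apply/nbhs_normP; exists (e / c); first by rewrite /= divr_gt0.
move=> y /= xy; apply: le_lt_trans (enorm_le_mx_norm _) _.
rewrite distrC in xy.
have := normr_ge0 (y - x) => n0.
apply: (@le_lt_trans _ _ (c * `|y - x|)).
  by rewrite ler_wpM2r // /c lerDl.
by rewrite mulrC -ltr_pdivlMr.
Qed.

Lemma compact_enorm_bounded k (K : set 'rV[R]_k) :
  compact K -> exists c, forall x, K x -> enorm x <= c.
Proof.
move=> /compact_bounded [M [_ hM]]; exists (Num.sqrt k%:R * (M + 1)) => x Kx.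
apply: le_trans (enorm_le_mx_norm _) _; rewrite ler_wpM2l ?sqrtr_ge0 //.
by apply: hM => //; rewrite ltrDl.
Qed.

Definition row_prod k l (K1 : set 'rV[R]_k) (K2 : set 'rV[R]_l) :
    set 'rV[R]_(k + l) :=
  [set w | K1 (lsubmx w) /\ K2 (rsubmx w)].

Lemma row_prod_mx k l (K1 : set 'rV[R]_k) (K2 : set 'rV[R]_l) u v :
  row_prod K1 K2 (row_mx u v) = (K1 u /\ K2 v).
Proof. by rewrite /row_prod /= row_mxKl row_mxKr. Qed.

Lemma continuous_row_mx k l :
  continuous (fun w : 'rV[R]_k * 'rV[R]_l => row_mx w.1 w.2).
Proof.
move=> [u v]; apply/cvgrPdist_lt => e e0 /=.
exists (ball u e, ball v e); first by split=> /=; exact: nbhsx_ballx.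
move=> [u' v'] []; rewrite -!ball_normE /= => wu wv.
apply: (@le_lt_trans _ _ (Num.max `|u - u'| `|v - v'|)); last by rewrite gt_max wu.
apply: mx_norm_le => [|i]; first by rewrite le_max normr_ge0.
rewrite opp_row_mx add_row_mx -[i]splitK; case: (fintype.split i) => j /=.
  by rewrite row_mxEl le_max mx_norm_entry.
by rewrite row_mxEr le_max mx_norm_entry orbT.
Qed.

Lemma compact_row_prod k l (K1 : set 'rV[R]_k) (K2 : set 'rV[R]_l) :
  compact K1 -> compact K2 -> compact (row_prod K1 K2).
Proof.
move=> c1 c2.
have -> : row_prod K1 K2 = (fun w : 'rV[R]_k * 'rV[R]_l => row_mx w.1 w.2) @` (K1 `*` K2).
  apply/seteqP; split => w /=.
    by move=> [w1 w2]; exists (lsubmx w, rsubmx w); rewrite //= hsubmxK.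
  by move=> [[u v] [/= Ku Kv] <-]; rewrite row_prod_mx.
apply: continuous_compact; last exact: compact_setX.
by apply: continuous_subspaceT => x; exact: continuous_row_mx.
Qed.

Lemma near_lsub k l (w : 'rV[R]_(k + l)) (P : 'rV[R]_k -> Prop) :
  (\forall u \near lsubmx w, P u) -> \forall w' \near w, P (lsubmx w').
Proof.
move=> /nbhs_normP[e e0 h]; apply/nbhs_normP; exists e => // w' /= ww'.
apply: h => /=; apply: le_lt_trans ww'.
apply: mx_norm_le => // i.
by have := mx_norm_entry (w - w') (lshift l i); rewrite !mxE.
Qed.

Lemma near_rsub k l (w : 'rV[R]_(k + l)) (P : 'rV[R]_l -> Prop) :
  (\forall u \near rsubmx w, P u) -> \forall w' \near w, P (rsubmx w').
Proof.
move=> /nbhs_normP[e e0 h]; apply/nbhs_normP; exists e => // w' /= ww'.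
apply: h => /=; apply: le_lt_trans ww'.
apply: mx_norm_le => // i.
by have := mx_norm_entry (w - w') (rshift k i); rewrite !mxE.
Qed.

End RowTopology.

(** * Closed convex functions on a compact domain and their proximal maps *)

Section ClosedConvexOn.
Context (R : realType).

(** What remains of a proper closed convex function with compact domain K when
    it is replaced by its finite values: phi is meaningful on K only, and
    stands for a function that is +oo elsewhere. *)
Record closed_convex_on k (K : set 'rV[R]_k) (phi : 'rV[R]_k -> R) : Prop := {
  cco_neq0 : K !=set0;
  cco_compact : compact K;
  cco_lsc : lsc_on K phi;
  cco_convex : forall x y t, K x -> K y -> 0 <= t <= 1 ->
    K (t *: x + (1 - t) *: y) /\
    phi (t *: x + (1 - t) *: y) <= t * phi x + (1 - t) * phi y }.

Lemma closed_convex_fine k (p : 'rV[R]_k -> \bar R) :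
  proper_closed_convex p -> compact (dom p) ->
  closed_convex_on (dom p) (fine \o p).
Proof.
move=> [[pNy [x0 px0]] lsc cvx] cK.
have fin x : dom p x -> p x = (fine (p x))%:E.
  by move=> px; rewrite fineK // fin_numE; rewrite /dom /= in px; rewrite gt_eqF // lt_eqF.
split=> //.
- by exists x0.
- move=> x a Kx /= ax; have apx : (a%:E < p x)%E by rewrite fin // lte_fin.
  have [V Vx hV] := lsc _ _ apx.
  near=> y => Ky; have : (a%:E < p y)%E by apply: hV; near: y.
  by rewrite fin // lte_fin.
- move=> x y t Kx Ky t01.
  have h : (p (t *: x + (1 - t) *: y)%R <= (t * fine (p x) + (1 - t) * fine (p y))%R%:E)%E.
    apply: le_trans (cvx x y t t01) _.
    by rewrite (fin _ Kx) (fin _ Ky) -!EFinM -EFinD /= lexx.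
  have Kt : dom p (t *: x + (1 - t) *: y) by apply: le_lt_trans h _; exact: ltry.
  by split => //=; rewrite fin // lee_fin in h.
Unshelve. all: by end_near. Qed.

Lemma closed_convex_row_prod k l (K1 : set 'rV[R]_k) (K2 : set 'rV[R]_l) phi1 phi2 c :
  0 < c -> closed_convex_on K1 phi1 -> closed_convex_on K2 phi2 ->
  closed_convex_on (row_prod K1 K2) (fun w => phi1 (lsubmx w) + c * phi2 (rsubmx w)).
Proof.
move=> c0 [[x1 K1x] cK1 l1 v1] [[x2 K2x] cK2 l2 v2]; split.
- by exists (row_mx x1 x2); rewrite row_prod_mx.
- exact: compact_row_prod.
- move=> w a [Kw1 Kw2] aw.
  pose d := (phi1 (lsubmx w) + c * phi2 (rsubmx w) - a) / 2.
  have d0 : 0 < d by rewrite /d divr_gt0 // subr_gt0.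
  have a1 : phi1 (lsubmx w) - d < phi1 (lsubmx w) by rewrite ltrBlDr ltrDl.
  have a2 : phi2 (rsubmx w) - d / c < phi2 (rsubmx w) by rewrite ltrBlDr ltrDl divr_gt0.
  have n1 := near_lsub (l1 _ _ Kw1 a1).
  have n2 := near_rsub (l2 _ _ Kw2 a2).
  near=> y => -[Ky1 Ky2].
  have h1 : phi1 (lsubmx w) - d < phi1 (lsubmx y).
    have : K1 (lsubmx y) -> phi1 (lsubmx w) - d < phi1 (lsubmx y) by near: y.
    exact.
  have h2 : phi2 (rsubmx w) - d / c < phi2 (rsubmx y).
    have : K2 (rsubmx y) -> phi2 (rsubmx w) - d / c < phi2 (rsubmx y) by near: y.
    exact.
  move: h2; rewrite -(ltr_pM2l c0) mulrBr mulrCA divff ?gt_eqF // mulr1 => h2.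
  by move: h1 h2; rewrite /d; lra.
- move=> x y t [Kx1 Kx2] [Ky1 Ky2] t01.
  have [k1 h1] := v1 _ _ _ Kx1 Ky1 t01; have [k2 h2] := v2 _ _ _ Kx2 Ky2 t01.
  rewrite /row_prod /= !linearD !linearZ /=; split => //.
  by rewrite -(ler_pM2l c0) in h2; move: h1 h2; lra.
Unshelve. all: by end_near. Qed.

Lemma lsc_on_add_dist k (K : set 'rV[R]_k) phi (c : R) x :
  0 < c -> lsc_on K phi ->
  lsc_on K (fun u => 2^-1 * enorm (u - x) ^+ 2 + c * phi u).
Proof.
move=> c0 lphi u a Ku au.
pose d := (2^-1 * enorm (u - x) ^+ 2 + c * phi u - a) / 2.
have d0 : 0 < d by rewrite /d divr_gt0 // subr_gt0.
have a2 : phi u - d / c < phi u by rewrite ltrBlDr ltrDl divr_gt0.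
pose b := enorm (u - x) + 1.
have b0 : 0 < b by rewrite /b ltr_wpDl // enorm_ge0.
have n2 := lphi _ _ Ku a2.
have n1 : \forall y \near u, enorm (y - u) < d / b by apply: near_enorm; exact: divr_gt0.
near=> y => Ky.
have h2 : phi u - d / c < phi y.
  have : K y -> phi u - d / c < phi y by near: y.
  exact.
move: h2; rewrite -(ltr_pM2l c0) mulrBr mulrCA divff ?gt_eqF // mulr1 => h2.
have h1 : enorm (y - u) < d / b by near: y.
have h3 : enorm (u - x) <= enorm (y - u) + enorm (y - x).
  by rewrite (enormB y u); exact: enorm_dist.
have h4 : 2^-1 * enorm (u - x) ^+ 2 - d < 2^-1 * enorm (y - x) ^+ 2.
  move: h1; rewrite ltr_pdivlMr // => h1.
  have e1 := enorm_ge0 (y - u); have e2 := enorm_ge0 (y - x); have e3 := enorm_ge0 (u - x).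
  move: h1 h3; rewrite /b !expr2.
  move: (enorm (y - u)) (enorm (y - x)) (enorm (u - x)) e1 e2 e3 => A B C *.
  have [CA|AC] := lerP C A; first by nra.
  have : (C - A) * (C - A) <= B * B by apply: ler_pM; lra.
  nra.
by move: h2 h4; rewrite /d; lra.
Unshelve. all: by end_near. Qed.

(** First-order optimality along a segment. A negative c is refuted at t = - c
    / (d - c), which lies in the unit interval. *)
Lemma ge0_of_small_quadratic (c d : R) :
  0 <= d -> (forall t, 0 < t <= 1 -> 0 <= t * c + t ^+ 2 * d) -> 0 <= c.
Proof.
move=> d0 h; rewrite leNgt; apply/negP => c0.
have dc : 0 < d - c by lra.
have := h (- c / (d - c)); rewrite divr_gt0 ?oppr_gt0 // ler_pdivrMr // mul1r.
rewrite lerDr d0 => /(_ isT).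
have -> : - c / (d - c) * c + (- c / (d - c)) ^+ 2 * d = - (c ^+ 2 * (- c) / (d - c) ^+ 2).
  by field; rewrite gt_eqF.
rewrite oppr_ge0 leNgt divr_gt0 ?exprn_gt0 // mulr_gt0 ?oppr_gt0 //.
by rewrite lt_neqAle sqr_ge0 andbT eq_sym expf_neq0 // lt_eqF.
Qed.

(** The proximal objective attains its minimum because it is lower
    semicontinuous on K. The subgradient inequality at z is its first-order
    optimality condition along the segment from the minimiser to z. *)
Lemma prox_subgrad k (K : set 'rV[R]_k) phi (p : 'rV[R]_k -> \bar R) c x :
  closed_convex_on K phi -> 0 < c ->
  (forall u, K u -> p u = (phi u)%:E) -> (forall u, ~ K u -> p u = +oo%E) ->
  subgrad K phi (prox (fun u => c%:E * p u)%E x)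
    (c^-1 *: (x - prox (fun u => c%:E * p u)%E x)).
Proof.
move=> [K0 cK lphi vphi] c0 pK pN.
pose F u := ((2^-1 * enorm (u - x) ^+ 2)%:E + c%:E * p u)%E.
pose psi u := 2^-1 * enorm (u - x) ^+ 2 + c * phi u.
have FK u : K u -> F u = (psi u)%:E by move=> Ku; rewrite /F pK // /psi EFinD EFinM.
have FN u : ~ K u -> F u = +oo%E by move=> nK; rewrite /F pN // gt0_muley // addey.
have [u0 Ku0 hu0] := lsc_compact_min K0 cK (lsc_on_add_dist (x := x) c0 lphi).
have am0 : argmin F u0.
  move=> v; have [Kv|nKv] := pselect (K v); last by rewrite (FN v) // leey.
  by rewrite !FK // lee_fin; exact: hu0.
rewrite /prox; case: xgetP => [u _ am|/(_ u0)]; last by case.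
have Ku : K u.
  apply: contrapT => nK; have : (F u <= F u0)%E by exact: am.
  rewrite (FN u) // (FK u0) //.
split=> // z Kz.
suff : 0 <= dot (u - x) (z - u) + c * (phi z - phi u).
  rewrite dotZl => h; rewrite -(ler_pM2l c0) mulrDr mulrA divff ?gt_eqF // mul1r.
  by move: h; rewrite !dotE; lra.
apply: (ge0_of_small_quadratic (d := 2^-1 * dot (z - u) (z - u))).
  by rewrite mulr_ge0 ?dot_ge0.
move=> t /andP[t0 t1].
have [Kt ht] := vphi z u t Kz Ku (introT andP (conj (ltW t0) t1)).
have := am (t *: z + (1 - t) *: u).
rewrite -/(F u) -/(F _) !FK // lee_fin /psi.
have -> : t *: z + (1 - t) *: u - x = (u - x) + t *: (z - u).
  by apply/rowP => i; rewrite !mxE; ring.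
rewrite -(ler_pM2l c0) in ht.
move: ht; set w := u - x; set d := z - u; rewrite !enorm_sqr !dotE; dot_sym.
by nra.
Qed.

End ClosedConvexOn.

Section ProductSubgradient.
Context (R : realType) (k l : nat) (K1 : set 'rV[R]_k) (K2 : set 'rV[R]_l).
Context (phi1 : 'rV[R]_k -> R) (phi2 : 'rV[R]_l -> R).

Definition separable_sum (w : 'rV[R]_(k + l)) : R := phi1 (lsubmx w) + phi2 (rsubmx w).

Lemma subgrad_row_mx u v bu bv :
  subgrad K1 phi1 u bu -> subgrad K2 phi2 v bv ->
  subgrad (row_prod K1 K2) separable_sum (row_mx u v) (row_mx bu bv).
Proof.
move=> [K1u h1] [K2v h2]; split; first by rewrite row_prod_mx.
move=> z [Kz1 Kz2]; rewrite /separable_sum row_mxKl row_mxKr.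
rewrite -{1}[z]hsubmxK sub_row_mx dot_row_mx.
by have := h1 _ Kz1; have := h2 _ Kz2; lra.
Qed.

Lemma subgrad_lsubmx w b :
  subgrad (row_prod K1 K2) separable_sum w b -> subgrad K1 phi1 (lsubmx w) (lsubmx b).
Proof.
move=> [[Kw1 Kw2] h]; split=> // z Kz.
have := h (row_mx z (rsubmx w)); rewrite row_prod_mx /separable_sum row_mxKl row_mxKr.
move=> /(_ (conj Kz Kw2)).
have -> : dot b (row_mx z (rsubmx w) - w) = dot (lsubmx b) (z - lsubmx w).
  by rewrite -{1}[b]hsubmxK -{2}[w]hsubmxK sub_row_mx dot_row_mx subrr dot0r addr0.
lra.
Qed.

Lemma subgrad_rsubmx w b :
  subgrad (row_prod K1 K2) separable_sum w b -> subgrad K2 phi2 (rsubmx w) (rsubmx b).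
Proof.
move=> [[Kw1 Kw2] h]; split=> // z Kz.
have := h (row_mx (lsubmx w) z); rewrite row_prod_mx /separable_sum row_mxKl row_mxKr.
move=> /(_ (conj Kw1 Kz)).
have -> : dot b (row_mx (lsubmx w) z - w) = dot (rsubmx b) (z - rsubmx w).
  by rewrite -{1}[b]hsubmxK -{2}[w]hsubmxK sub_row_mx dot_row_mx subrr dot0r add0r.
lra.
Qed.

Lemma closed_convex_separable :
  closed_convex_on K1 phi1 -> closed_convex_on K2 phi2 ->
  closed_convex_on (row_prod K1 K2) separable_sum.
Proof.
move=> c1 c2; have := closed_convex_row_prod ltr01 c1 c2.
by under eq_fun do rewrite mul1r.
Qed.

End ProductSubgradient.

(** * Variational inequalities *)

Section VariationalInequality.
Context (R : realType) (k : nat).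
Local Notation W := 'rV[R]_k.

(** The displacement |w - T w| has a minimiser w on K; if T w were different
    from w, the displacement at T w would be smaller. *)
Lemma contraction_fixed_point (K : set W) (T : W -> W) (q : R) :
  K !=set0 -> compact K -> (forall w, K w -> K (T w)) -> q < 1 ->
  (forall w w', K w -> K w' -> enorm (T w - T w') <= q * enorm (w - w')) ->
  exists2 w, K w & T w = w.
Proof.
move=> K0 cK TK q1 Tq.
have T1 w w' : K w -> K w' -> enorm (T w - T w') <= enorm (w - w').
  move=> Kw Kw'; apply: le_trans (Tq _ _ Kw Kw') _.
  by rewrite ler_piMl ?enorm_ge0 // ltW.
have [|w Kw hw] := @lsc_compact_min R _ K (fun w => enorm (w - T w)) K0 cK.
  move=> w a Kw aw; near=> y => Ky.
  have e2 : enorm (y - w) < (enorm (w - T w) - a) / 2.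
    by near: y; apply: near_enorm; rewrite divr_gt0 // subr_gt0.
  have := enorm_dist w y (T w); have := enorm_dist y (T y) (T w).
  have := T1 _ _ Ky Kw; move: e2; rewrite (enormB w y); lra.
exists w => //; apply/eqP; rewrite eq_sym -subr_eq0; apply/eqP/enorm_eq0.
have := hw _ (TK _ Kw); have := Tq _ _ Kw (TK _ Kw); have := enorm_ge0 (w - T w).
by nra.
Unshelve. all: by end_near. Qed.

Lemma prox_nonexpansive (K : set W) phi (P : W -> W) (c : R) :
  0 < c -> (forall w, subgrad K phi (P w) (c^-1 *: (w - P w))) ->
  forall w w', enorm (P w - P w') <= enorm (w - w').
Proof.
move=> c0 hP w w'; have := subgrad_monotone (hP w) (hP w').
rewrite -scalerBr dotZl pmulr_rge0 ?invr_gt0 // => h.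
apply: enorm_le; first exact: enorm_ge0.
rewrite enorm_sqr; have := dot_ge0 ((w - w') - (P w - P w')).
by move: h; rewrite !dotE; dot_sym; lra.
Qed.

(** The solutions are the fixed points of the forward-backward map w |-> P c (w
    - c F w), a contraction of K for c = mu / L^2. Applied to the field (grad_u
    h, - grad_v h), this gives a saddle point. *)
Lemma variational_solution (K : set W) phi (F : W -> W) (P : R -> W -> W) (mu L : R) :
  closed_convex_on K phi -> 0 < mu -> mu <= L ->
  (forall c w, 0 < c -> subgrad K phi (P c w) (c^-1 *: (w - P c w))) ->
  (forall w w', K w -> K w' -> mu * dot (w - w') (w - w') <= dot (F w - F w') (w - w')) ->
  (forall w w', K w -> K w' -> enorm (F w - F w') <= L * enorm (w - w')) ->
  exists w, subgrad K phi w (- F w).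
Proof.
move=> cc mu0 muL hP Fmono Flip.
have L0 : 0 < L by apply: lt_le_trans muL.
pose c := mu / L ^+ 2; have c0 : 0 < c by rewrite divr_gt0 // exprn_gt0.
have cL : c * L ^+ 2 = mu by rewrite /c divfK // expf_neq0 // gt_eqF.
pose q := Num.sqrt (1 - c * mu).
have cmu0 : 0 < c * mu by exact: mulr_gt0.
have [||w Kw Tw] := @contraction_fixed_point K (fun w => P c (w - c *: F w)) q
    (cco_neq0 cc) (cco_compact cc) (fun w _ => (hP _ _ c0).1).
- by rewrite -sqrtr1 ltr_sqrt // ltrBlDr ltrDl.
- move=> w w' Kw Kw'; apply: le_trans (prox_nonexpansive c0 (fun w => hP c w c0) _ _) _.
  apply: le_trans (_ : enorm ((w - w') - c *: (F w - F w')) <= _).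
    by rewrite le_eqVlt; apply/orP; left; apply/eqP; congr enorm; apply/rowP => i; rewrite !mxE; ring.
  have m := Fmono _ _ Kw Kw'; have l := dot_le_sqr (Flip _ _ Kw Kw').
  rewrite exprMn enorm_sqr in l.
  have key : dot ((w - w') - c *: (F w - F w')) ((w - w') - c *: (F w - F w'))
     <= (1 - c * mu) * dot (w - w') (w - w').
    move: m l; set d := w - w'; set e := F w - F w'; move: d e => d e m l.
    rewrite !dotE; dot_sym.
    have : c * (2 * mu * dot d d) <= c * (2 * dot e d) by rewrite ler_pM2l //; lra.
    have : c * (c * dot e e) <= c * (mu * dot d d).
      rewrite ler_pM2l // -cL -mulrA ler_pM2l //.
    dot_sym; lra.
  have q0 : 0 <= 1 - c * mu.
    by rewrite subr_ge0 /c mulrAC ler_pdivrMr ?exprn_gt0 // mul1r -expr2 lerXn2r // nnegrE ltW.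
  rewrite /q /enorm -sqrtrM // ler_sqrt // ?mulr_ge0 ?dot_ge0 //.
exists w; have := hP c (w - c *: F w) c0; rewrite Tw.
have -> // : c^-1 *: (w - c *: F w - w) = - F w.
by rewrite addrAC subrr add0r scalerN scalerA mulVf ?scale1r // gt_eqF.
Qed.

End VariationalInequality.

(** * Smooth and convex functions, subdifferentials *)

Section Smooth.
Context (R : realType) (k : nat).
Local Notation W := 'rV[R]_k.
Implicit Types (g : W -> R) (A : set W).

Lemma derive_grad g (x d : W) : differentiable g x -> 'D_d g x = dot (grad g x) d.
Proof.
move=> dg; rewrite deriveE // {1}[d]row_sum_delta linear_sum /dot /=.
by apply: eq_bigr => i _; rewrite linearZ /= mxE deriveE // mulrC.
Qed.

Lemma is_derive_line g (x d : W) (t : R) : differentiable g (x + t *: d) ->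
  is_derive t 1 (fun s : R => g (x + s *: d)) (dot (grad g (x + t *: d)) d).
Proof.
move=> dg.
have E : (fun h : R => h^-1 *: (((fun s : R => g (x + s *: d)) \o shift t) (h *: 1)
             - g (x + t *: d)))
  = (fun h : R => h^-1 *: ((g \o shift (x + t *: d)) (h *: d) - g (x + t *: d))).
  apply/funext => h /=; congr (_ *: (g _ - _)).
  by rewrite [h *: 1]mulr1 scalerDl; apply/rowP => i; rewrite !mxE; ring.
have dd : derivable g (x + t *: d) d by exact: diff_derivable.
split; first by rewrite /derivable E.
by rewrite -(derive_grad _ dg) /derive E.
Qed.

(** With s = (-1)^b, the function t |-> L/2 |d|^2 t^2 - s (g(x + t d) - t <grad
    g(x), d>) has a nonnegative derivative, by Cauchy-Schwarz and the Lipschitz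
    property. The Boolean selects the bound of g from above (false) or from
    below (true). *)
Lemma smooth_quadratic_bound (b : bool) L A g (x y : W) :
  smooth_on L A g -> (forall t, 0 <= t <= 1 -> A (x + t *: (y - x))) ->
  (-1) ^+ b * (g y - g x - dot (grad g x) (y - x))
    <= L / 2 * dot (y - x) (y - x).
Proof.
move=> [dg lg] seg; set d := y - x; set s : R := (-1) ^+ b.
pose psi := fun t : R =>
  L / 2 * dot d d * t ^+ 2 - s * (g (x + t *: d) - t * dot (grad g x) d).
pose dpsi := fun t : R =>
  L * dot d d * t - s * (dot (grad g (x + t *: d)) d - dot (grad g x) d).
have dpsiP (t : R) : 0 <= t <= 1 -> is_derive t 1 psi (dpsi t).
  move=> t01; have i1 := is_derive_line (dg _ (seg _ t01)).
  apply: is_derive_eq.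
  by rewrite /dpsi /GRing.scale /=; field.
have [||c /andP[]] := @MVT R psi dpsi 0 1 ltr01.
- by move=> t; rewrite in_itv /= => /andP[/ltW t0 /ltW t1]; apply: dpsiP; rewrite t0.
- apply: derivable_within_continuous => t; rewrite in_itv /= => t01.
  by have [] := dpsiP t t01.
rewrite !bnd_simp => c0 c1.
have c01 : 0 <= c <= 1 by rewrite !ltW.
rewrite subr0 mulr1 => e.
have e0 : psi 0 = - (s * g x) by rewrite /psi scale0r addr0; ring.
have e1 : psi 1 = L / 2 * dot d d - s * (g y - dot (grad g x) d).
  by rewrite /psi scale1r (_ : x + d = y); [ring|rewrite /d addrC subrK].
have pos : 0 <= dpsi c.
  have A0 : A x by have := seg 0; rewrite scale0r addr0 lexx ler01; exact.
  have := lg _ _ (seg _ c01) A0; rewrite -/d => l.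
  have h1 : s * (dot (grad g (x + c *: d)) d - dot (grad g x) d)
      <= enorm (grad g (x + c *: d) - grad g x) * enorm d.
    rewrite -dotNl -dotDl /s; case: (b); rewrite ?expr0 ?expr1 ?mul1r ?mulN1r; last exact: cauchy_schwarz.
    by rewrite -dotNl -enormN; exact: cauchy_schwarz.
  have cd : enorm (x + c *: d - x) = c * enorm d by rewrite addrAC subrr add0r enormZ // ltW.
  rewrite cd in l.
  have : enorm (grad g (x + c *: d) - grad g x) * enorm d
      <= L * (c * enorm d) * enorm d by rewrite ler_wpM2r // enorm_ge0.
  by move: h1; rewrite /dpsi -enorm_sqr; lra.
by move: e pos; rewrite e0 e1 -/d => <-; lra.
Qed.

End Smooth.

Section ConvexGradient.
Context (R : realType).

Lemma right_derivative_le (phi : R -> R) (D c : R) :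
  is_derive (0 : R) 1 phi D ->
  (forall h, 0 < h <= 1 -> phi h - phi 0 <= h * c) -> D <= c.
Proof.
move=> [dphi <-] h.
have := cvg_dnbhs_at_right dphi; rewrite -/(derive phi 0 1) => cv.
apply: (@cvgr_to_le _ _ _ _ _ _ _ cv).
near=> t; have t0 : 0 < t by near: t; exact: nbhs_right_gt.
have t1 : t <= 1 by near: t; apply: nbhs_right_le.
rewrite /= [_ *: 1]mulr1 addr0 [_ *: _]mulrC ler_pdivrMr // mulrC.
by apply: h; rewrite t0.
Unshelve. all: by end_near. Qed.

Lemma convex_gradient_inequality n m (g : 'rV[R]_n -> 'rV[R]_m -> R) x y z :
  convex_function setT (g x) -> differentiable (joint g) (row_mx x y) ->
  g x y + dot (rsubmx (grad (joint g) (row_mx x y))) (z - y) <= g x z.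
Proof.
move=> cvx dg; pose d := row_mx (0 : 'rV[R]_n) (z - y).
have gE t : joint g (row_mx x y + t *: d) = g x (y + t *: (z - y)).
  by rewrite /joint /d scale_row_mx add_row_mx row_mxKl row_mxKr scaler0 addr0.
have -> : dot (rsubmx (grad (joint g) (row_mx x y))) (z - y) = dot (grad (joint g) (row_mx x y)) d.
  by rewrite -[grad _ _ in RHS]hsubmxK /d dot_row_mx dot0r add0r.
have dl : is_derive (0 : R) 1 (fun s : R => joint g (row_mx x y + s *: d))
    (dot (grad (joint g) (row_mx x y)) d).
  have := @is_derive_line _ _ (joint g) (row_mx x y) d 0.
  by rewrite scale0r addr0; exact.
rewrite -lerBrDl; apply: (right_derivative_le dl) => h /andP[h0 h1].
rewrite !gE scale0r addr0.
have := cvx (Itv01 (ltW h0) h1) z y; rewrite !inE => /(_ I I).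
rewrite convRE /=.
rewrite [X in g x X <= _](_ : _ = y + h *: (z - y)); last first.
  apply/rowP => i; rewrite /conv /= !mxE /= /unstable.onem; ring.
by rewrite /unstable.onem; lra.
Qed.

End ConvexGradient.

Section Subdifferential.
Context (R : realType) (k : nat).
Local Notation W := 'rV[R]_k.

(** A Frechet expansion in which the gradient is an arbitrary vector s: in this
    form it passes to partial functions without a chain rule. *)
Definition first_order (g : W -> R) (x s : W) : Prop := forall e, 0 < e ->
  \forall d \near (0 : W), `|g (x + d) - g x - dot s d| <= e * `|d|.

Lemma differentiable_first_order (g : W -> R) (x : W) :
  differentiable g x -> first_order g x (grad g x).
Proof.
move=> dg e e0.
have /eqaddoP/(_ e e0) := diff_locally dg.
apply: filterS => d /=.
have -> // : g (x + d) - g x - dot (grad g x) d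
  = (g \o shift x - (cst (g x) + 'd g x : W -> R)) d.
rewrite -[RHS]/(g (d + x) - (g x + 'd g x d)) -deriveE // derive_grad // (addrC x d).
by rewrite opprD addrA.
Qed.

(** In the upper limit that defines the subderivative it is enough to keep x' =
    x and let t tend to 0. The difference quotient in a direction d' near d is
    +oo, or at least <s0 + b, d'> up to a small error, by the expansion of g
    and the subgradient inequality for phi. *)
Lemma subdifferential_sum (g : W -> R) (r : W -> \bar R) (K : set W)
    (phi : W -> R) (x s0 b : W) :
  first_order g x s0 ->
  (forall w, K w -> r w = (phi w)%:E) -> (forall w, ~ K w -> r w = +oo%E) ->
  subgrad K phi x b ->
  subdifferential (fun w => (g w)%:E + r w)%E x (s0 + b).
Proof.
move=> dg rK rN [Kx hb].
set psi := (fun w => _).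
split; first by rewrite /dom /= /psi rK // -EFinD ltry.
move=> d; set s := s0 + b.
apply/lee_addgt0Pr => e e0.
pose c' := enorm s + 1; have c'0 : 0 < c' by rewrite /c' ltr_wpDl // enorm_ge0.
have k0 : 0 < Num.sqrt k%:R + 1 :> R by rewrite ltr_wpDl // sqrtr_ge0.
pose cd := (Num.sqrt k%:R + 1) * c' : R.
have cd0 : 0 < cd by rewrite mulr_gt0.
pose m := `|d| + 1 : R. have m0 : 0 < m by rewrite /m ltr_wpDl.
(* The constant cd converts the sup norm into the Euclidean one: within del of
   d, the product with s changes by at most e / 2. The other half of e goes to
   the expansion of g. *)
pose del := Num.min 1 (e / 2 / cd).
have del0 : 0 < del by rewrite /del lt_min ltr01 !divr_gt0.
have eta0 : 0 < e / 2 / m by rewrite !divr_gt0.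
have /nbhs_normP[rad /= rad0 hrad] := dg _ eta0.
have bound (t : R) d' : 0 < t -> t < rad / m -> ball d del d' ->
    ((dot s d - e)%:E <= (psi (x + t *: d')%R - psi x) * (t^-1)%:E)%E.
  move=> t0 tr; rewrite -ball_normE /= => dd'.
  have [Kt|nKt] := pselect (K (x + t *: d')); last first.
    rewrite /psi (rN _ nKt) (rK _ Kx) -EFinD addey // addye // gt0_mulye ?lte_fin ?invr_gt0 //.
    by rewrite leey.
  rewrite /psi (rK _ Kt) (rK _ Kx) -!EFinD. rewrite -EFinM lee_fin ler_pdivlMr //.
  have d'm : `|d'| <= m.
    rewrite -(subrK d d') /m; apply: le_trans (ler_normD _ _) _.
    by rewrite addrC lerD2l distrC; apply: le_trans (ltW dd') _; rewrite /del ge_min lexx.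
  have tdr : `|t *: d'| <= t * m by rewrite normrZ gtr0_norm // ler_pM2l.
  have := hrad (t *: d'); rewrite /= sub0r normrN => /(_ _) h1.
  have {}h1 : `|g (x + t *: d') - g x - dot s0 (t *: d')| <= e / 2 / m * `|t *: d'|.
    by apply: h1; apply: le_lt_trans tdr _; rewrite -ltr_pdivlMr.
  have h2 : e / 2 / m * `|t *: d'| <= t * (e / 2).
    apply: le_trans (_ : e / 2 / m * (t * m) <= _); first by rewrite ler_pM2l.
    by rewrite le_eqVlt; apply/orP; left; apply/eqP; field; rewrite gt_eqF.
  have h3 := hb _ Kt; rewrite addrAC subrr add0r dotZr in h3.
  have h4 : dot s (d - d') <= e / 2.
    apply: le_trans (cauchy_schwarz _ _) _.
    apply: le_trans (_ : c' * ((Num.sqrt k%:R + 1) * del) <= _).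
      apply: ler_pM; rewrite ?enorm_ge0 // ?/c' ?lerDl //.
      apply: le_trans (enorm_le_mx_norm _) _.
      by apply: ler_pM; rewrite ?sqrtr_ge0 ?lerDl // ltW.
    rewrite mulrA (mulrC c') -/cd mulrC -ler_pdivlMr //.
    by rewrite /del ge_min lexx orbT.
  have h5 : t * dot s (d - d') <= t * (e / 2) by rewrite ler_pM2l.
  move: h1 h2 h3 h5; rewrite ler_norml => /andP[h1 _].
  by move: h1; rewrite /s !dotE; lra.
rewrite -leeBlDr // -EFinB.
apply: le_trans (ereal_sup_ubound _); last by exists del.
rewrite limf_esupE; apply: le_ereal_inf_tmp => _ [V [[P Q] [/= attP nQ] PQ] <-].
have Px : P x by case: attP => B nB; apply; exact: nbhs_singleton.
have [t [Qt t0 tr]] : exists t, [/\ Q t, 0 < t & t < rad / m].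
  have : \forall t \near (0 : R)^'+, [/\ Q t, 0 < t & t < rad / m].
    near=> t; split; near: t => //.
      exact: nbhs_right_gt.
    by apply: nbhs_right_lt; rewrite divr_gt0.
  by move/filter_ex.
apply: le_trans (ereal_sup_ubound _); last first.
  by exists (x, t) => //; exact: PQ.
apply: le_ereal_inf_tmp => _ [d' dd' <-] /=; exact: bound.
Unshelve. all: by end_near. Qed.

End Subdifferential.

(** * The anchored extragradient method *)

Section AnchoredExtragradient.
Context (R : realType) (k : nat).
Local Notation W := 'rV[R]_k.

(** Here g, gp and gh are the scaled residuals lam (A w + b) at the current
    point, at the next point, and the mixed one made of A at the half-step and
    the next subgradient. The decrease of the potential is a nonnegative
    combination of the monotonicity inequality, the Lipschitz inequality and
    two squares; this is where the step size bound (lam Lip)^2 <= 1/20 is used.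
    *)
Lemma anchored_potential_step (T : R) (w w0 g gp gh : W) :
  let bt := 2 / (T + 3) in
  let wp := w + bt *: (w0 - w) - gh in
  0 <= T ->
  0 <= dot (gp - g) (wp - w) ->
  dot (gp - gh) (gp - gh) <= 20^-1 * dot (g - gh) (g - gh) ->
  (T + 2) * (T + 3) * (T + 4) / 4 * dot gp gp
     + (T + 2) * (T + 3) * dot gp (wp - w0)
  <= (T + 1) * (T + 2) * (T + 3) / 4 * dot g g
     + (T + 1) * (T + 2) * dot g (w - w0).
Proof.
move=> bt wp T0 mono lip.
pose q := (T + 2) * (T + 3) / 4.
have q0 : 0 <= q by rewrite /q divr_ge0 // mulr_ge0 // addr_ge0.
have T3 : T + 3 != 0 by rewrite gt_eqF // ltr_wpDl.
pose S1 := dot (gp - 2 *: gh) (gp - 2 *: gh).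
pose S2 := dot (g - gh) (g - gh).
pose m := dot (gp - g) (wp - w).
pose l := 20^-1 * S2 - dot (gp - gh) (gp - gh).
suff -> : (T + 2) * (T + 3) * (T + 4) / 4 * dot gp gp
     + (T + 2) * (T + 3) * dot gp (wp - w0)
  = (T + 1) * (T + 2) * (T + 3) / 4 * dot g g
     + (T + 1) * (T + 2) * dot g (w - w0)
     - ((T + 1) * (T + 2) * (T + 3) / 2 * m + q * (T + 5) * l
        + q * S1 + q * ((19 * T + 15) / 20) * S2).
  rewrite gerBl; do !apply: addr_ge0; rewrite ?mulr_ge0 ?dot_ge0 //;
    rewrite ?subr_ge0 //; lra.
rewrite /m /l /S1 /S2 /q /wp /bt !dotE.
dot_sym.
by field.
Qed.

End AnchoredExtragradient.

Section AnchoredExtragradientInclusion.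
Context (R : realType) (k : nat).
Local Notation W := 'rV[R]_k.
Context (K : set W) (phi : W -> R) (A : W -> W) (gam z M : R) (wm wst w0 b0 : W).
Local Notation lam := (z * gam).
Hypotheses (gam_gt0 : 0 < gam) (z_gt0 : 0 < z).
Hypothesis A_lip : forall x y,
  lam ^+ 2 * dot (A x - A y) (A x - A y) <= 20^-1 * dot (x - y) (x - y).
Hypothesis A_mono : forall x y, K x -> K y ->
  gam^-1 * dot (x - y) (x - y) <= dot (A x - A y) (x - y).
Hypothesis wst_sol : subgrad K phi wst (- A wst).
Hypothesis w0_sub : subgrad K phi w0 b0.
Hypothesis w0_def : lam *: b0 = wm - lam *: A wm - w0.

Local Notation resid w b := (lam *: (A w + b)).

Let lam_gt0 : 0 < lam. Proof. exact: mulr_gt0. Qed.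

(** The starting point wm may lie outside of K, where A is only Lipschitz. What
    helps is that x = w0 - wst and y = lam (b0 + A wst) satisfy <x, y> >= 0,
    while x + y is a small perturbation of wm - wst. *)
Lemma anchored_start :
  2 * dot (w0 - wst) (w0 - wst) <= 3 * dot (wm - wst) (wm - wst) /\
  dot (resid w0 b0) (resid w0 b0) <= 2 * dot (wm - wst) (wm - wst).
Proof.
pose x := w0 - wst; pose y := lam *: (b0 + A wst); pose r := wm - wst.
pose a := lam *: (A wm - A wst); pose c := lam *: (A w0 - A wst).
have xy : x + y = r - a.
  by rewrite /y scalerDr w0_def /x /r /a scalerBr; apply/rowP => i; rewrite !mxE; ring.
have ha : dot a a <= 20^-1 * dot r r by rewrite !(dotZl, dotZr) mulrA -expr2; exact: A_lip.
have hc : dot c c <= 20^-1 * dot x x by rewrite !(dotZl, dotZr) mulrA -expr2; exact: A_lip.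
have hxy : 0 <= dot x y.
  rewrite dotZr mulr_ge0 ?(ltW lam_gt0) // dotC.
  by have := subgrad_monotone w0_sub wst_sol; rewrite opprK.
(* The weights 1/2 and 2 balance |r|^2 against |a|^2 <= |r|^2 / 20 in the cross
   term; so do 1 and 20 below, for y and c. *)
have := dot_ge0 (2^-1 *: r + 2 *: a).
have : dot (x + y) (x + y) = dot (r - a) (r - a) by rewrite xy.
have -> : resid w0 b0 = y + c.
  by rewrite /y /c -scalerDr; congr (_ *: _); apply/rowP => i; rewrite !mxE; ring.
have := dot_ge0 (y - 20 *: c).
have := dot_ge0 y; have := dot_ge0 r.
move: ha hc hxy; rewrite -/x -/r; move: x y r a c {xy} => x y r a c.
by rewrite !dotE; dot_sym; split; lra.
Qed.

Lemma anchored_potential_decrease (T : R) w b w' b' :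
  let bt := 2 / (T + 3) in
  let wh := w + bt *: (w0 - w) - lam *: (A w + b) in
  0 <= T ->
  subgrad K phi w b -> subgrad K phi w' b' ->
  lam *: b' = w + bt *: (w0 - w) - lam *: A wh - w' ->
  (T + 2) * (T + 3) * (T + 4) / 4 * dot (resid w' b') (resid w' b')
     + (T + 2) * (T + 3) * dot (resid w' b') (w' - w0)
  <= (T + 1) * (T + 2) * (T + 3) / 4 * dot (resid w b) (resid w b)
     + (T + 1) * (T + 2) * dot (resid w b) (w - w0).
Proof.
move=> bt wh T0 sw sw' hb'.
pose gh := lam *: (A wh + b').
have w'E : w' = w + bt *: (w0 - w) - gh.
  by rewrite /gh (scalerDr lam) hb'; apply/rowP => i; rewrite !mxE; ring.
have Aw'w : 0 <= dot (A w' - A w) (w' - w).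
  apply: le_trans (A_mono sw'.1 sw.1).
  by rewrite mulr_ge0 ?dot_ge0 // invr_ge0 ltW.
have := @anchored_potential_step R k T w w0 (resid w b) (resid w' b') gh T0.
rewrite /= -/bt -w'E; apply.
  rewrite -scalerBr dotZl mulr_ge0 ?(ltW lam_gt0) //.
  have := subgrad_monotone sw' sw; move: Aw'w; rewrite !dotE; dot_sym; lra.
have -> : lam *: (A w + b) - gh = w' - wh.
  by rewrite w'E /wh; apply/rowP => i; rewrite !mxE; ring.
have -> : lam *: (A w' + b') - gh = lam *: (A w' - A wh).
  by rewrite /gh; apply/rowP => i; rewrite !mxE; ring.
by rewrite !(dotZl, dotZr) mulrA -expr2; exact: A_lip.
Qed.

(** Write G = |g| / z, Dn = |w - wst| and r = |wm - wst|. Failure of the test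
    says |w - wm| < G, so r <= G + Dn. In the potential inequality, - <g, w -
    w0> is at most |g| |w0 - wst| - z Dn^2; keeping the term - z Dn^2 of strong
    monotonicity, the right side is at most (105/64) z G^2, where the factor
    would be 5/2 instead of 105/64 without that term. With z^-1 <= 9/2 M this
    gives T + 3 <= 29.54 M plus a term that is less than 2 once T >= 31 M. *)
Lemma anchored_stop (T : R) w b :
  0 <= T -> 0 < M -> z^-1 <= 9 / 2 * M ->
  subgrad K phi w b ->
  (T + 1) * (T + 2) * (T + 3) / 4 * dot (resid w b) (resid w b)
     + (T + 1) * (T + 2) * dot (resid w b) (w - w0)
  <= 3 / 2 * dot (resid w0 b0) (resid w0 b0) ->
  gam^-1 * dot (w - wm) (w - wm) < gam * dot (A w + b) (A w + b) ->
  T < 31 * M.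
Proof.
move=> T0 M0 zM sw pot nstop.
rewrite ltNge; apply/negP => TM.
set g := resid w b in pot.
have [hE hN0] := anchored_start.
pose N := enorm g; pose Dn := enorm (w - wst); pose r := enorm (wm - wst).
pose E := enorm (w0 - wst).
have N0 : 0 <= N by exact: enorm_ge0.
have Dn0 : 0 <= Dn by exact: enorm_ge0.
have r0 : 0 <= r by exact: enorm_ge0.
have E0 : 0 <= E by exact: enorm_ge0.
pose G := N / z.
have NE : N = z * G by rewrite /G mulrCA divff ?mulr1 // gt_eqF.
have G0 : 0 <= G by rewrite /G divr_ge0 // ltW.
have dG : enorm (w - wm) < G.
  rewrite -(ltr_pXn2r (n:=2)) ?nnegrE ?enorm_ge0 //.
  rewrite enorm_sqr /G expr_div_n /N enorm_sqr /g !(dotZl, dotZr).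
  rewrite -(ltr_pM2l (x:=gam^-1)) ?invr_gt0 //; apply: lt_le_trans nstop _.
  rewrite le_eqVlt; apply/orP; left; apply/eqP; field.
  by rewrite !gt_eqF.
have Gp : 0 < G by apply: le_lt_trans dG; exact: enorm_ge0.
(* Strong monotonicity of A, plus monotonicity of the subgradients. *)
have mono : z * Dn ^+ 2 <= dot g (w - wst).
  have m1 := A_mono sw.1 wst_sol.1.
  have m2 := subgrad_monotone sw wst_sol.
  rewrite /g dotZl /Dn enorm_sqr -mulrA ler_pM2l //.
  rewrite -(ler_pM2l (x:=gam^-1)) ?invr_gt0 // [X in _ <= X]mulrA mulVf ?gt_eqF // mul1r.
  by move: m1 m2; rewrite opprK !dotE; dot_sym; lra.
have DG : Dn <= G.
  have [->//|Dz] := eqVneq Dn 0.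
  have Dp : 0 < Dn by rewrite lt_neqAle eq_sym Dz.
  have h : z * Dn ^+ 2 <= N * Dn by apply: le_trans mono _; exact: cauchy_schwarz.
  by move: h; rewrite NE expr2 mulrA ler_pM2r // ler_pM2l.
have rG : r <= G + Dn.
  apply: le_trans (enorm_dist wm w wst) _.
  by apply: lerD => //; rewrite enormB ltW.
have E54 : E <= 5 / 4 * r.
  rewrite -(ler_pXn2r (n:=2)) ?nnegrE ?enorm_ge0 ?mulr_ge0 //.
  rewrite exprMn !enorm_sqr; move: hE; have := dot_ge0 (wm - wst); lra.
have split_g : - dot g (w - w0) <= N * E - z * Dn ^+ 2.
  have := cauchy_schwarz g (w0 - wst); rewrite -/N -/E.
  by move: mono; rewrite !dotE; lra.
move: pot; rewrite -enorm_sqr -/N => pot.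
have hN0' : dot (resid w0 b0) (resid w0 b0) <= 2 * r ^+ 2 by rewrite enorm_sqr.
have r2 : r ^+ 2 <= 4 * G ^+ 2 by nra.
pose B := (T + 1) * (T + 2).
have B0 : 0 < B by rewrite /B mulr_gt0 // ltr_wpDl.
have h1 : B * ((T + 3) / 4 * N ^+ 2) <= B * (N * E - z * Dn ^+ 2) + 12 * G ^+ 2.
  have : B * (- dot g (w - w0)) <= B * (N * E - z * Dn ^+ 2) by rewrite ler_pM2l.
  move: pot; rewrite -/B => pot.
  have -> : B * ((T + 3) / 4 * N ^+ 2) = B * (T + 3) / 4 * N ^+ 2 by ring.
  lra.
have h2 : N * E - z * Dn ^+ 2 <= z * (105 / 64 * G ^+ 2).
  have hh : N * E <= N * (5 / 4 * (G + Dn)).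
    by rewrite ler_wpM2l //; lra.
  apply: le_trans (lerB hh (lexx _)) _.
  rewrite NE -mulrA -mulrBr ler_pM2l //.
  have := sqr_ge0 (5 / 8 * G - Dn); rewrite !expr2; nra.
have h3 : B * ((T + 3) / 4) * z ^+ 2 <= B * (105 / 64) * z + 12.
  rewrite -(ler_pM2r (x:=G ^+ 2)) ?exprn_gt0 //.
  have -> : B * ((T + 3) / 4) * z ^+ 2 * G ^+ 2 = B * ((T + 3) / 4 * N ^+ 2) by rewrite NE; ring.
  apply: le_trans h1 _.
  have -> : (B * (105 / 64) * z + 12) * G ^+ 2
            = B * (z * (105 / 64 * G ^+ 2)) + 12 * G ^+ 2 by ring.
  by apply: lerD => //; rewrite ler_pM2l.
pose y := z^-1.
have y0 : 0 < y by rewrite invr_gt0.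
have h4 : B * ((T + 3) / 4) <= B * (105 / 64) * y + 12 * y ^+ 2.
  have z2 : 0 < z ^+ 2 by rewrite exprn_gt0.
  rewrite -(ler_pM2r z2); apply: le_trans h3 _.
  rewrite le_eqVlt; apply/orP; left; apply/eqP; rewrite /y; field.
  by rewrite gt_eqF.
have yM : y <= 9 / 2 * M by [].
have h5 : B * ((T + 3) / 4) <= B * (105 / 64) * (9 / 2 * M) + 12 * (9 / 2 * M) ^+ 2.
  apply: le_trans h4 _; apply: lerD; first by rewrite ler_pM2l // mulr_gt0.
  by rewrite ler_pM2l // lerXn2r ?nnegrE ?(ltW y0) // mulr_ge0 // ltW.
have BM : (31 * M) ^+ 2 <= B.
  rewrite /B expr2; apply: ler_pM; rewrite ?mulr_ge0 ?(ltW M0) //; lra.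
nra.
Qed.

End AnchoredExtragradientInclusion.

(** * Runs of programs and the calls they make *)

Section CallCounts.
Context (R : realType).

Definition within (x : R) (c : calls) : Prop :=
  [/\ (n_grad_f1 c)%:R <= x, (n_grad_ft1 c)%:R <= x,
      (n_prox_f2 c)%:R <= x & (n_prox_ft2 c)%:R <= x].

Lemma within0 : within 0 no_calls.
Proof. by []. Qed.

Lemma within_add x y c d : within x c -> within y d -> within (x + y) (add_calls c d).
Proof.
by move=> [a1 a2 a3 a4] [b1 b2 b3 b4]; split; rewrite /= natrD; exact: lerD.
Qed.

Lemma within_le x y c : within x c -> x <= y -> within y c.
Proof. by move=> [a1 a2 a3 a4] xy; split; apply: le_trans xy. Qed.

Lemma within_ge0 x c : within x c -> 0 <= x.
Proof. by move=> [a1 _ _ _]; apply: le_trans a1. Qed.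

Lemma bind_intro A B (e : prog A) (k : A -> prog B) a b c1 c2 :
  e a c1 -> k a b c2 -> bind e k b (add_calls c1 c2).
Proof. by move=> h1 h2; exists a, c1, c2. Qed.

Lemma add_calls0 c : add_calls c no_calls = c.
Proof. by case: c => a b c d; rewrite /add_calls /= !addn0. Qed.

(** A run of the loop is constructed along an invariant that carries the number
    of steps done; that the invariant forces t < N is what makes the
    construction stop. *)
Lemma loop_within S A (step : S -> prog (S + A)) (Inv : nat -> S -> Prop)
    (Post : A -> Prop) (cost : nat -> R) (N : nat) (s : S) :
  (forall t, 0 <= cost t) ->
  (forall t s, Inv t s -> (t < N)%N /\
     exists r c, [/\ step s r c, within (cost t) c &
       match r with inl s' => Inv t.+1 s' | inr a => Post a end]) ->
  Inv 0%N s ->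
  exists a c, [/\ loop step s a c, Post a & within (\sum_(i < N) cost i) c].
Proof.
move=> cost0 hstep inv0.
suff H d t s' : (N = t + d)%N -> Inv t s' ->
    exists a c, [/\ loop step s' a c, Post a & within (\sum_(t <= i < N) cost i) c].
  have [a [c [h1 h2 h3]]] := H N 0%N s (add0n N) inv0.
  by exists a, c; rewrite -(big_mkord xpredT cost).
elim: d t s' => [|d ih] t s' Nt inv.
  by have [] := hstep _ _ inv; rewrite Nt addn0 ltnn.
have [tN [r [c [st wc]]]] := hstep _ _ inv.
rewrite big_ltn //; case: r st => [s2|a] st hr.
  have [a [c' [h1 h2 h3]]] := ih t.+1 s2 (etrans Nt (addnS _ _)) hr.
  by exists a, (add_calls c c'); split=> //; [exact: loop_next st h1|exact: within_add].
exists a, c; split=> //; first exact: loop_stop.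
by apply: within_le wc _; rewrite lerDl sumr_ge0.
Qed.

End CallCounts.

(** * One step of the accelerated proximal-point method *)

Section AcceleratedStep.
Context (R : realType).

(** The right side exceeds the left one by eta |kap (xf' - x) + g|^2 + kap (1 -
    2 eta kap) |xf' - x|^2. The point x is then expressed through the
    extrapolated point xg, as xf' - x = al^-1 (xf' - xg) + (al^-1 - 1) (xf -
    xf'). *)
Lemma accelerated_update k (eta kap al : R) (x xf xg xf' g xs : 'rV[R]_k) :
  let x' := x + (eta * kap) *: (xf' - x) - eta *: g in
  0 < eta -> 0 < kap -> 2 * (eta * kap) <= 1 -> 0 < al ->
  xg = al *: x + (1 - al) *: xf ->
  eta^-1 * dot (x' - xs) (x' - xs)
  <= (eta^-1 - kap) * dot (x - xs) (x - xs) + kap * dot (xf' - xs) (xf' - xs)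
     + 2 * eta * dot g g - 2 * dot g (xf' - xs)
     + 2 / al * dot g (xf' - xg) + (2 / al - 2) * dot g (xf - xf').
Proof.
move=> x' eta0 kap0 ek al0 ->.
pose y := eta *: (kap *: (xf' - x) - g).
have -> : x' - xs = (x - xs) + y.
  by rewrite /x' /y; apply/rowP => i; rewrite !mxE; ring.
have sq := dot_ge0 (kap *: (xf' - x) + g).
have sq2 : 0 <= kap * (1 - 2 * (eta * kap)) * dot (xf' - x) (xf' - x).
  by rewrite mulr_ge0 ?dot_ge0 // mulr_ge0 ?subr_ge0 // ltW.
have {}sq : 0 <= eta * dot (kap *: (xf' - x) + g) (kap *: (xf' - x) + g).
  by rewrite mulr_ge0 // ltW.
rewrite -subr_ge0.
suff -> : (eta^-1 - kap) * dot (x - xs) (x - xs) + kap * dot (xf' - xs) (xf' - xs)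
     + 2 * eta * dot g g - 2 * dot g (xf' - xs)
     + 2 / al * dot g (xf' - (al *: x + (1 - al) *: xf)) + (2 / al - 2) * dot g (xf - xf')
     - eta^-1 * dot (x - xs + y) (x - xs + y)
  = eta * dot (kap *: (xf' - x) + g) (kap *: (xf' - x) + g)
    + kap * (1 - 2 * (eta * kap)) * dot (xf' - x) (xf' - x) by apply: addr_ge0.
rewrite /y !dotE; dot_sym; field.
by rewrite !gt_eqF.
Qed.

(** Summing [accelerated_update] over both blocks leaves the bracket <gs, sf' -
    sg> + su/2 |gs|^2 + <gv, vf' - vg> + 4/su |gv|^2. Completing squares turns
    it into a difference of squared residuals and squared displacements, which
    the stopping test of the inner loop makes nonpositive. The remaining terms
    contract: by 1/2 for s, by 1 - ev sv for v and by 1 - al for the function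
    values, all at most 1 - al/2. *)
Lemma accelerated_contraction nu nv (su sv al ev : R)
    (s sf sg sf' uf gs ss : 'rV[R]_nu) (v vf vg vf' gv vs : 'rV[R]_nv)
    (Pold Pnew Pstar : R) :
  let s' := s + (su / 2 * su^-1) *: (sf' - s) - (su / 2) *: gs in
  let v' := v + (ev * sv) *: (vf' - v) - ev *: gv in
  0 < su -> 0 < sv -> 0 < al <= 1 -> 0 < ev ->
  ev * sv <= 1 / 2 -> al / 2 <= ev * sv -> al * ev <= 4 / su ->
  sg = al *: s + (1 - al) *: sf -> vg = al *: v + (1 - al) *: vf ->
  gs = uf + su^-1 *: sf' ->
  Pnew + dot gs (sf - sf') + dot gv (vf - vf') <= Pold ->
  Pnew + dot gs (ss - sf') + dot gv (vs - vf')
    + su^-1 / 2 * dot (sf' - ss) (sf' - ss) + sv / 2 * dot (vf' - vs) (vf' - vs) <= Pstar ->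
  8 / su * (dot ((su / 2) *: (gs + su^-1 *: (sf' - sg))) ((su / 2) *: (gs + su^-1 *: (sf' - sg)))
           + dot (gv + (su / 8) *: (vf' - vg)) (gv + (su / 8) *: (vf' - vg)))
    <= su / 8 * (dot (uf + su^-1 *: sg) (uf + su^-1 *: sg) + dot (vf' - vg) (vf' - vg)) ->
  Pstar <= Pold ->
  (su / 2)^-1 * dot (s' - ss) (s' - ss) + ev^-1 * dot (v' - vs) (v' - vs)
    + 2 / al * (Pnew - Pstar)
  <= (1 - al / 2) * ((su / 2)^-1 * dot (s - ss) (s - ss)
       + ev^-1 * dot (v - vs) (v - vs) + 2 / al * (Pold - Pstar)).
Proof.
move=> s' v' su0 sv0 /andP[al0 al1] ev0 es1 es2 ea sgE vgE gsE hold hstar crit Pos.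
have su20 : 0 < su / 2 by rewrite divr_gt0.
have siu : 0 < su^-1 by rewrite invr_gt0.
have U : 2 * (su / 2 * su^-1) <= 1.
  by rewrite mulrA (mulrC 2) divfK // mulfV // gt_eqF.
have V : 2 * (ev * sv) <= 1 by lra.
have hU := accelerated_update sf' gs ss su20 siu U al0 sgE.
have hV := accelerated_update vf' gv vs ev0 sv0 V al0 vgE.
rewrite -/s' in hU; rewrite -/v' in hV.
(* The errors of inexactness of both blocks, which the inner test controls. *)
have br : dot gs (sf' - sg) + su / 2 * dot gs gs
          + (dot gv (vf' - vg) + 4 / su * dot gv gv) <= 0.
  pose au := (su / 2) *: (gs + su^-1 *: (sf' - sg)).
  have sq := dot_ge0 (au + (sf' - sg)).
  have e1 : uf + su^-1 *: sg = (2 / su) *: (au - (sf' - sg)).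
    rewrite /au gsE; apply/rowP => i; rewrite !mxE; field.
    by rewrite gt_eqF.
  have e2 : su / 2 * dot gs gs + dot gs (sf' - sg)
     = 2 / su * dot au au - su^-1 / 2 * dot (sf' - sg) (sf' - sg).
    rewrite /au; move: (sf' - sg) => d; rewrite !dotE; dot_sym; field.
    by rewrite gt_eqF.
  have e3 : dot gv (vf' - vg) + 4 / su * dot gv gv
     = 4 / su * dot (gv + (su / 8) *: (vf' - vg)) (gv + (su / 8) *: (vf' - vg))
       - su / 16 * dot (vf' - vg) (vf' - vg).
    move: (vf' - vg) => d; rewrite !dotE; dot_sym; field.
    by rewrite gt_eqF.
  move: crit; rewrite -/au e1.
  have sq' : 0 <= su^-1 * dot (au + (sf' - sg)) (au + (sf' - sg)) by rewrite mulr_ge0 // ltW.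
  have -> : dot gs (sf' - sg) + su / 2 * dot gs gs
    = 2 / su * dot au au - su^-1 / 2 * dot (sf' - sg) (sf' - sg) by rewrite -e2; ring.
  rewrite e3.
  move: (dot (gv + _) _) => Av; move: (dot (vf' - vg) _) => Dv.
  have -> : su / 8 * (dot (2 / su *: (au - (sf' - sg))) (2 / su *: (au - (sf' - sg))) + Dv)
     = su^-1 / 2 * dot (au - (sf' - sg)) (au - (sf' - sg)) + su / 8 * Dv.
    rewrite [dot (_ *: _) _]dotZl dotZr; field.
    by rewrite gt_eqF.
  have aa0 : 0 <= su^-1 * dot au au by rewrite mulr_ge0 ?dot_ge0 // ltW.
  move: sq' aa0; move: (sf' - sg) => d; rewrite !dotE; dot_sym.
  lra.
have c0 : 0 <= 2 / al by rewrite divr_ge0 // ltW.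
have br2 : 2 / al * (dot gs (sf' - sg) + dot gv (vf' - vg)) + su * dot gs gs + 2 * ev * dot gv gv <= 0.
  have g1 : su * dot gs gs <= 2 / al * (su / 2 * dot gs gs).
    rewrite mulrA ler_wpM2r ?dot_ge0 //.
    have -> : 2 / al * (su / 2) = su / al by field; rewrite gt_eqF.
    by rewrite ler_pdivlMr // ler_piMr // ltW.
  have g2 : 2 * ev * dot gv gv <= 2 / al * (4 / su * dot gv gv).
    rewrite mulrA ler_wpM2r ?dot_ge0 //.
    rewrite mulrAC ler_pdivlMr //; lra.
  have := ler_wpM2l c0 br; rewrite mulr0; lra.
have c1 : 0 <= 2 / al - 2.
  by rewrite subr_ge0 ler_pdivlMr // ler_piMr.
have hold' := ler_wpM2l c1 hold.
have dv0 := dot_ge0 (v - vs); have du0 := dot_ge0 (s - ss).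
have t1 : ((su / 2)^-1 - su^-1) * dot (s - ss) (s - ss)
   <= (1 - al / 2) * ((su / 2)^-1 * dot (s - ss) (s - ss)).
  rewrite [X in _ <= X]mulrA ler_wpM2r //.
  have -> : (su / 2)^-1 = 2 * su^-1 by rewrite invfM invrK mulrC.
  have : 0 <= (1 - al) * su^-1 by rewrite mulr_ge0 ?subr_ge0 // ltW.
  lra.
have t2 : (ev^-1 - sv) * dot (v - vs) (v - vs)
   <= (1 - al / 2) * (ev^-1 * dot (v - vs) (v - vs)).
  rewrite [X in _ <= X]mulrA ler_wpM2r //.
  rewrite -(ler_pM2l ev0) mulrBr mulfV ?gt_eqF //.
  have -> : ev * ((1 - al / 2) * ev^-1) = 1 - al / 2 by field; rewrite gt_eqF.
  lra.
have t3 : (2 / al - 2) * (Pold - Pstar) <= (1 - al / 2) * (2 / al * (Pold - Pstar)).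
  rewrite [X in _ <= X]mulrA ler_wpM2r ?subr_ge0 //.
  have -> : (1 - al / 2) * (2 / al) = 2 / al - 1 by field; rewrite gt_eqF.
  lra.
move: hU hV hold' hstar br2 t1 t2 t3.
rewrite !dotE; dot_sym. 
move: (2 / al) => a2.
rewrite ?mulrDr ?mulrDl ?mulrN ?mulNr; lra.
Qed.
End AcceleratedStep.

(** * Strongly-convex--strongly-concave saddle problems *)

Section SaddleMethod.
Context (R : realType) (nu nv : nat).
Local Notation U := 'rV[R]_nu.
Local Notation V := 'rV[R]_nv.
Context (Ku : set U) (Kv : set V) (p : U -> R) (q : V -> R).
Context (gradh : U -> V -> prog (U * V)) (proxp : R -> U -> prog U) (proxq : R -> V -> prog V).
Context (Fg : U -> V -> U * V) (Pp : R -> U -> U) (Pq : R -> V -> V) (cg cp cq : calls).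
Context (h : U -> V -> R) (su sv Lb : R).

(** Every loop body makes the same calls in the same order: a gradient, both
    proximal maps, a gradient. *)
Definition round_calls : calls :=
  add_calls cg (add_calls cp (add_calls cq (add_calls cg no_calls))).

Hypothesis gradhP : forall u v, gradh u v (Fg u v) cg.
Hypothesis proxpP : forall c u, proxp c u (Pp c u) cp.
Hypothesis proxqP : forall c v, proxq c v (Pq c v) cq.
Hypothesis Pp_sub : forall c u, 0 < c -> subgrad Ku p (Pp c u) (c^-1 *: (u - Pp c u)).
Hypothesis Pq_sub : forall c v, 0 < c -> subgrad Kv q (Pq c v) (c^-1 *: (v - Pq c v)).
Hypothesis p_cc : closed_convex_on Ku p.
Hypothesis q_cc : closed_convex_on Kv q.
Hypothesis su_gt0 : 0 < su.
Hypothesis sv_gt0 : 0 < sv.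
Hypothesis Lb_ge : 3 * su <= Lb.
Hypothesis sv_le : sv <= Lb.
Hypothesis h_convex : forall u u' v, Ku u -> Ku u' -> Kv v ->
  h u v + dot (Fg u v).1 (u' - u) + su / 2 * dot (u' - u) (u' - u) <= h u' v.
Hypothesis h_concave : forall u v v', Ku u -> Kv v -> Kv v' ->
  h u v' <= h u v + dot (Fg u v).2 (v' - v) - sv / 2 * dot (v' - v) (v' - v).
Hypothesis Fg_lip : forall u v u' v',
  dot ((Fg u v).1 - (Fg u' v').1) ((Fg u v).1 - (Fg u' v').1)
  + dot ((Fg u v).2 - (Fg u' v').2) ((Fg u v).2 - (Fg u' v').2)
  <= Lb ^+ 2 * (dot (u - u') (u - u') + dot (v - v') (v - v')).
Hypothesis Fg_shift_lip : forall u v u' v',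
  dot ((Fg u v).1 - (Fg u' v').1 - (su / 2) *: (u - u'))
      ((Fg u v).1 - (Fg u' v').1 - (su / 2) *: (u - u'))
  + dot ((Fg u v).2 - (Fg u' v').2 - (su / 8) *: (v - v'))
        ((Fg u v).2 - (Fg u' v').2 - (su / 8) *: (v - v'))
  <= (Lb + su / 8) ^+ 2 * (dot (u - u') (u - u') + dot (v - v') (v - v')).

Let Lb_gt0 : 0 < Lb.
Proof. by apply: lt_le_trans Lb_ge; rewrite mulr_gt0. Qed.

Local Notation W := 'rV[R]_(nu + nv).
Local Notation KW := (row_prod Ku Kv).
Local Notation phi := (separable_sum p q).

Lemma saddle_strongly_monotone u v u' v' : Ku u -> Kv v -> Ku u' -> Kv v' ->
  su * dot (u - u') (u - u') + sv * dot (v - v') (v - v')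
  <= dot ((Fg u v).1 - (Fg u' v').1) (u - u') - dot ((Fg u v).2 - (Fg u' v').2) (v - v').
Proof.
move=> Kuu Kvv Kuu' Kvv'.
have := h_convex Kuu Kuu' Kvv; have := h_convex Kuu' Kuu Kvv'.
have := h_concave Kuu Kvv Kvv'; have := h_concave Kuu' Kvv' Kvv.
rewrite !dotE; dot_sym; lra.
Qed.

Definition joint_prox (c : R) (w : W) : W := row_mx (Pp c (lsubmx w)) (Pq c (rsubmx w)).

Lemma joint_prox_subgrad c w : 0 < c ->
  subgrad KW phi (joint_prox c w) (c^-1 *: (w - joint_prox c w)).
Proof.
move=> c0; rewrite -{2}[w]hsubmxK /joint_prox sub_row_mx scale_row_mx.
by apply: subgrad_row_mx; [exact: Pp_sub|exact: Pq_sub].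
Qed.

(** Monotone on the domain, with the saddle points as the solutions of its
    variational inequality. *)
Definition saddle_field (w : W) : W :=
  row_mx (Fg (lsubmx w) (rsubmx w)).1 (- (Fg (lsubmx w) (rsubmx w)).2).

Lemma saddle_field_lip w w' :
  enorm (saddle_field w - saddle_field w') <= Lb * enorm (w - w').
Proof.
apply: enorm_le; first by rewrite mulr_ge0 ?enorm_ge0 // ltW.
rewrite exprMn enorm_sqr /saddle_field sub_row_mx dot_row_mx -opprD.
rewrite dotNl dotNr opprK (dot_split (w - w')) lsubmxB rsubmxB.
exact: Fg_lip.
Qed.

Lemma saddle_solution : exists us vs,
  subgrad Ku p us (- (Fg us vs).1) /\ subgrad Kv q vs (Fg us vs).2.
Proof.
have mu0 : 0 < Num.min su sv by rewrite lt_min su_gt0.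
have muL : Num.min su sv <= Lb by rewrite ge_min sv_le orbT.
have [||w hw] := variational_solution (F := saddle_field)
   (closed_convex_separable p_cc q_cc) mu0 muL joint_prox_subgrad.
- move=> w w' [Ku1 Kv1] [Ku2 Kv2].
  have := saddle_strongly_monotone Ku1 Kv1 Ku2 Kv2.
  rewrite (dot_split (w - w')) /saddle_field sub_row_mx (dot_split _ (w - w')).
  rewrite row_mxKl row_mxKr lsubmxB rsubmxB.
  have m1 : Num.min su sv <= su by rewrite ge_min lexx.
  have m2 : Num.min su sv <= sv by rewrite ge_min lexx orbT.
  have := ler_wpM2r (dot_ge0 (lsubmx w - lsubmx w')) m1.
  have := ler_wpM2r (dot_ge0 (rsubmx w - rsubmx w')) m2.
  by rewrite mulrDr -opprD dotNl; lra.
- by move=> w w' _ _; exact: saddle_field_lip.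
exists (lsubmx w), (rsubmx w).
have := subgrad_lsubmx hw; have := subgrad_rsubmx hw.
by rewrite /saddle_field opp_row_mx row_mxKl row_mxKr opprK.
Qed.

Section InnerLoop.
Context (sg : U) (vg : V).

Local Notation z := (zeta su Lb).
Local Notation gam := (gamma su).
Local Notation M := (1 + 8 * Lb / su).

Definition inner_op (w : W) : W :=
  row_mx (a_u su sv sg (lsubmx w) (rsubmx w) (Fg (lsubmx w) (rsubmx w)))
         (a_v su sv vg (lsubmx w) (rsubmx w) (Fg (lsubmx w) (rsubmx w))).

Let M_gt0 : 0 < M.
Proof. by rewrite ltr_wpDr // divr_ge0 ?mulr_ge0 // ltW. Qed.

Let gam_gt0 : 0 < gam.
Proof. by rewrite /gamma mulr_gt0 ?invr_gt0. Qed.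

Let sqrt5_gt0 : 0 < Num.sqrt 5 :> R.
Proof. by rewrite sqrtr_gt0. Qed.

Let z_gt0 : 0 < z.
Proof. by rewrite /zeta invr_gt0 !mulr_gt0. Qed.

Lemma zetaV_le : z^-1 <= 9 / 2 * M.
Proof.
rewrite /zeta invrK ler_pM2r //.
suff : Num.sqrt 5 <= 9 / 4 :> R by lra.
rewrite -(ler_pXn2r (n:=2)) ?nnegrE ?sqrtr_ge0 ?divr_ge0 // sqr_sqrtr //; lra.
Qed.

Lemma inner_op_diff w w' :
  inner_op w - inner_op w' =
  row_mx ((Fg (lsubmx w) (rsubmx w)).1 - (Fg (lsubmx w') (rsubmx w')).1
            - (su / 2) *: (lsubmx w - lsubmx w'))
         (- ((Fg (lsubmx w) (rsubmx w)).2 - (Fg (lsubmx w') (rsubmx w')).2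
            - (su / 8) *: (rsubmx w - rsubmx w'))).
Proof.
rewrite /inner_op sub_row_mx /a_u /a_v /grad_hat /=.
by congr row_mx; apply/rowP => i; rewrite !mxE; field; rewrite ?gt_eqF.
Qed.

(** The constant zeta is the one for which the step size times the Lipschitz
    constant Lb + su/8 of the inner operator equals 1 / (2 sqrt 5). *)
Lemma inner_op_lip w w' :
  (z * gam) ^+ 2 * dot (inner_op w - inner_op w') (inner_op w - inner_op w')
  <= 20^-1 * dot (w - w') (w - w').
Proof.
rewrite inner_op_diff dot_row_mx [X in _ * (_ + X)]dotNl dotNr opprK.
rewrite (dot_split (w - w')) lsubmxB rsubmxB.
set D := (X in _ <= _ * X); set E := (X in _ * X <= _).
have hE : E <= (Lb + su / 8) ^+ 2 * D by exact: Fg_shift_lip.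
have D0 : 0 <= D by rewrite /D addr_ge0 ?dot_ge0.
apply: le_trans (ler_wpM2l (sqr_ge0 _) hE) _.
rewrite mulrA ler_wpM2r //.
rewrite le_eqVlt; apply/orP; left; apply/eqP.
have s5 : Num.sqrt 5 ^+ 2 = 5 :> R by rewrite sqr_sqrtr.
have E2 : z * gam * (Lb + su / 8) = (2 * Num.sqrt 5)^-1.
  rewrite /zeta /gamma invfM.
  have -> : (2 * Num.sqrt 5)^-1 * (1 + 8 * Lb / su)^-1 * (8 * su^-1) * (Lb + su / 8)
    = (2 * Num.sqrt 5)^-1 * ((1 + 8 * Lb / su)^-1 * (8 * su^-1 * (Lb + su / 8))) by ring.
  have -> : 8 * su^-1 * (Lb + su / 8) = 1 + 8 * Lb / su by field; rewrite gt_eqF.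
  by rewrite mulVf ?mulr1 // gt_eqF.
rewrite -exprMn E2 exprVn exprMn s5 -natrX -natrM //.
Qed.

Lemma inner_op_mono w w' : KW w -> KW w' ->
  gam^-1 * dot (w - w') (w - w') <= dot (inner_op w - inner_op w') (w - w').
Proof.
move=> [Ku1 Kv1] [Ku2 Kv2]; rewrite inner_op_diff.
have := saddle_strongly_monotone Ku1 Kv1 Ku2 Kv2.
rewrite (dot_split (w - w')) (dot_split _ (w - w')) row_mxKl row_mxKr lsubmxB rsubmxB.
move: (lsubmx w - lsubmx w') (rsubmx w - rsubmx w') => du dv.
have -> : gam^-1 = su / 8 by rewrite /gamma invfM invrK mulrC.
have d1 := dot_ge0 du; have d2 := dot_ge0 dv.
have := mulr_ge0 (ltW su_gt0) d1; have := mulr_ge0 (ltW sv_gt0) d2.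
by rewrite !dotE; lra.
Qed.

Lemma inner_solution : exists ws, subgrad KW phi ws (- inner_op ws).
Proof.
have gi : 0 < gam^-1 by rewrite invr_gt0.
have giE : gam^-1 = su / 8 by rewrite /gamma invfM invrK mulrC.
have gL : gam^-1 <= Lb + su / 8 by rewrite giE lerDr ltW.
apply: (variational_solution (closed_convex_separable p_cc q_cc) gi gL joint_prox_subgrad).
  exact: inner_op_mono.
move=> w w' _ _; apply: enorm_le; first by rewrite mulr_ge0 ?enorm_ge0 // (le_trans _ gL) // ltW.
rewrite exprMn enorm_sqr inner_op_diff dot_row_mx [X in (_ + X)]dotNl dotNr opprK.
rewrite (dot_split (w - w')) lsubmxB rsubmxB; exact: Fg_shift_lip.
Qed.

Definition inner_test_passed (i : inner_state R nu nv) : Prop :=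
  [/\ in_g i = Fg (in_u i) (in_v i), subgrad Ku p (in_u i) (in_bu i),
      subgrad Kv q (in_v i) (in_bv i) &
      gam * enorm (a_u su sv sg (in_u i) (in_v i) (in_g i) + in_bu i) ^+ 2
        + gam * enorm (a_v su sv vg (in_u i) (in_v i) (in_g i) + in_bv i) ^+ 2
      <= gam^-1 * enorm (in_u i + su^-1 *: sg) ^+ 2
         + gam^-1 * enorm (in_v i - vg) ^+ 2].

Context (a : R).
Hypothesis round_within : within a round_calls.

Definition prox_center : W := row_mx (- (su^-1 *: sg)) vg.

Definition potential (T : R) (w0 : W) (i : inner_state R nu nv) : R :=
  let g := (z * gam) *: (inner_op (row_mx (in_u i) (in_v i)) + row_mx (in_bu i) (in_bv i)) in
  (T + 1) * (T + 2) * (T + 3) / 4 * dot g g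
    + (T + 1) * (T + 2) * dot g (row_mx (in_u i) (in_v i) - w0).

Definition anchor_point (i0 : inner_state R nu nv) : W := row_mx (in_u i0) (in_v i0).

Definition first_prox_step (i0 : inner_state R nu nv) : Prop :=
  [/\ in_t i0 = 0%N, in_g i0 = Fg (in_u i0) (in_v i0), subgrad Ku p (in_u i0) (in_bu i0),
      subgrad Kv q (in_v i0) (in_bv i0) &
      (z * gam) *: row_mx (in_bu i0) (in_bv i0)
        = prox_center - (z * gam) *: inner_op prox_center - anchor_point i0].

Let lam_gt0 : 0 < z * gam. Proof. by rewrite mulr_gt0. Qed.

Lemma inner_init_run : exists i0,
  inner_init gradh proxp proxq su sv Lb sg vg i0 round_calls /\ first_prox_step i0.
Proof.
pose u := - (su^-1 *: sg); pose g := Fg u vg.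
pose xu := u - (z * gam) *: a_u su sv sg u vg g.
pose xv := vg - (z * gam) *: a_v su sv vg u vg g.
exists (Inner 0 (Pp (z * gam) xu) (Pq (z * gam) xv)
   ((z * gam)^-1 *: (xu - Pp (z * gam) xu)) ((z * gam)^-1 *: (xv - Pq (z * gam) xv))
   (Fg (Pp (z * gam) xu) (Pq (z * gam) xv))); split.
  rewrite /inner_init /round_calls.
  apply: bind_intro (gradhP _ _) _; apply: bind_intro (proxpP _ _) _.
  apply: bind_intro (proxqP _ _) _; apply: bind_intro (gradhP _ _) _.
  by [].
split=> //=; [exact: Pp_sub|exact: Pq_sub|].
rewrite scale_row_mx !scalerA mulfV ?gt_eqF // !scale1r.
rewrite /prox_center /inner_op /anchor_point /= scale_row_mx row_mxKl row_mxKr.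
by rewrite !sub_row_mx.
Qed.

Lemma inner_potential_step i0 i t u v bu bv g :
  let wu := a_u su sv sg u v g + bu in
  let wv := a_v su sv vg u v g + bv in
  let cu := u + beta R t *: (in_u i0 - u) in
  let cv := v + beta R t *: (in_v i0 - v) in
  let uh := cu - (z * gam) *: wu in
  let vh := cv - (z * gam) *: wv in
  let xi_u := cu - (z * gam) *: a_u su sv sg uh vh (Fg uh vh) in
  let xi_v := cv - (z * gam) *: a_v su sv vg uh vh (Fg uh vh) in
  let u' := Pp (z * gam) xi_u in
  let v' := Pq (z * gam) xi_v in
  let i' := Inner t.+1 u' v' ((z * gam)^-1 *: (xi_u - u')) ((z * gam)^-1 *: (xi_v - v')) (Fg u' v') in
  i = Inner t u v bu bv g -> g = Fg u v ->
  subgrad Ku p u bu -> subgrad Kv q v bv ->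
  [/\ subgrad Ku p u' (in_bu i'), subgrad Kv q v' (in_bv i') &
      potential t.+1%:R (anchor_point i0) i' <= potential t%:R (anchor_point i0) i].
Proof.
move=> wu wv cu cv uh vh xi_u xi_v u' v' i' -> gE su_ sv_.
have s1 : subgrad Ku p u' (in_bu i') by exact: Pp_sub.
have s2 : subgrad Kv q v' (in_bv i') by exact: Pq_sub.
split=> //.
have hE : (row_mx u v + 2 / (t%:R + 3) *: (anchor_point i0 - row_mx u v)
      - (z * gam) *: (inner_op (row_mx u v) + row_mx bu bv)) = row_mx uh vh.
  rewrite /anchor_point sub_row_mx scale_row_mx !add_row_mx /inner_op row_mxKl row_mxKr -gE.
  by rewrite ?add_row_mx scale_row_mx sub_row_mx.
have := @anchored_potential_decrease R _ KW phi inner_op gam z (anchor_point i0) gam_gt0 z_gt0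
   inner_op_lip inner_op_mono t%:R (row_mx u v) (row_mx bu bv) (row_mx u' v')
    (row_mx (in_bu i') (in_bv i')).
cbv zeta; rewrite hE => /(_ (ler0n _ _) (subgrad_row_mx su_ sv_) (subgrad_row_mx s1 s2)).
rewrite /potential /= -(@natr1 R t).
have -> : (t%:R + 1 + 1 : R) = t%:R + 2 by ring.
have -> : (t%:R + 1 + 2 : R) = t%:R + 3 by ring.
have -> : (t%:R + 1 + 3 : R) = t%:R + 4 by ring.
apply.
rewrite scale_row_mx !scalerA mulfV ?gt_eqF // !scale1r.
rewrite /anchor_point sub_row_mx scale_row_mx !add_row_mx /inner_op row_mxKl row_mxKr.
by rewrite scale_row_mx !sub_row_mx.
Qed.

(** By [anchored_stop] a step number t at which the test fails is less than 31
    M; so 31 M + 2 bounds the number of steps, including the last one, which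
    only tests. *)
Lemma inner_run : exists i0 i c,
  [/\ inner_init gradh proxp proxq su sv Lb sg vg i0 round_calls,
      loop (inner_step gradh proxp proxq su sv Lb sg vg (in_u i0) (in_v i0)) i0 i c,
      inner_test_passed i & within ((31 * M + 2) * a) c].
Proof.
have a0 : 0 <= a by exact: within_ge0 round_within.
have [i0 [hi0 [t0 g0 s01 s02 st0]]] := inner_init_run.
have M310 : 0 <= 31 * M by rewrite mulr_ge0 // ltW.
pose k := Num.truncn (31 * M); pose N := k.+2.
have NM : N%:R <= 31 * M + 2.
  have /andP[h1 _] := truncn_itv M310.
  by rewrite -/k in h1; rewrite /N -(@natr1 R k.+1) -(@natr1 R k); lra.
pose Inv (t : nat) (i : inner_state R nu nv) :=
  [/\ in_t i = t, in_g i = Fg (in_u i) (in_v i),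
      subgrad Ku p (in_u i) (in_bu i) /\ subgrad Kv q (in_v i) (in_bv i),
      potential t%:R (anchor_point i0) i <= potential 0 (anchor_point i0) i0 &
      t%:R < 31 * M + 1].
have [||i [c [h1 h2 h3]]] := @loop_within R _ _
   (inner_step gradh proxp proxq su sv Lb sg vg (in_u i0) (in_v i0))
    Inv inner_test_passed (fun=> a) N i0 (fun=> a0).
- move=> t [t' u v bu bv g] [/= tt gE [su_ sv_] pot tM]; subst t'; split.
    have /andP[_ h2] := truncn_itv M310.
    rewrite -/k in h2; rewrite -(ltr_nat R) /N -(@natr1 R k.+1); lra.
  rewrite /inner_step; case: ifPn => [nstop|]; last first.
    rewrite -leNgt => stop; exists (inr (Inner t u v bu bv g)), no_calls; split; [by []| |by split].
    exact: within_le (within0 R) a0.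
  have [s1 s2 pot'] := @inner_potential_step i0 _ t u v bu bv g erefl gE su_ sv_.
  eexists; exists round_calls; split=> //.
    apply: bind_intro (gradhP _ _) _; apply: bind_intro (proxpP _ _) _.
    apply: bind_intro (proxqP _ _) _; apply: bind_intro (gradhP _ _) _.
    by split.
  split=> //; first exact: le_trans pot' pot.
  rewrite -(@natr1 R t) ltrD2r.
  have [ws hws] := inner_solution.
  apply: (@anchored_stop R _ KW phi inner_op gam z M prox_center ws (anchor_point i0)
      (row_mx (in_bu i0) (in_bv i0)) gam_gt0 z_gt0 inner_op_lip inner_op_mono hws
      (subgrad_row_mx s01 s02) st0 t%:R (row_mx u v) (row_mx bu bv)) => //.
  + exact: zetaV_le.
  + exact: subgrad_row_mx.
  + apply: le_trans pot _; rewrite /potential /anchor_point subrr dot0r; lra.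
  + move: nstop; rewrite /inner_op /prox_center row_mxKl row_mxKr -gE add_row_mx sub_row_mx !dot_row_mx.
    by rewrite -!enorm_sqr opprK !mulrDr.
- split=> //; lra.
exists i0, i, c; split=> //.
apply: within_le h3 _; rewrite sumr_const card_ord -[a *+ N]mulr_natl.
by rewrite ler_wpM2r.
Qed.

End InnerLoop.
(** The saddle function without the quadratic terms su |u|^2 / 2 and - sv |v|^2
    / 2, which are dualised and kept apart, respectively. *)
Definition hat_h (u : U) (v : V) : R := h u v - su / 2 * dot u u + sv / 2 * dot v v.

(** The dual method minimises the sum of su^-1 |s|^2 / 2 + sv |v|^2 / 2 and the
    convex function of (s,v) that is the supremum of <u,s> - p u - hat_h u v +
    q v over u in Ku. An upper bound G of the supremum replaces its value,
    because at the starting point it is only estimated. *)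
Definition dual_bound (sf : U) (vf : V) (G : R) : Prop :=
  forall u, Ku u -> dot u sf - p u - hat_h u vf + q vf <= G.

Definition dual_value (sf : U) (vf : V) (G : R) : R :=
  G + su^-1 / 2 * dot sf sf + sv / 2 * dot vf vf.

Definition dual_at (u : U) (sf : U) (v : V) : R := dot u sf - p u - hat_h u v + q v.

(** By its definition sf is a subgradient of hat_h(.,v) + p at u, so u attains
    the supremum that defines the dual function at (sf,v). *)
Lemma dual_attained u v b : Kv v -> subgrad Ku p u b ->
  dual_bound ((Fg u v).1 - su *: u + b) v (dual_at u ((Fg u v).1 - su *: u + b) v).
Proof.
move=> Kvv [Kuu hb] u' Kuu'; rewrite /dual_at /hat_h.
have := hb _ Kuu'; have := h_convex Kuu Kuu' Kvv.
rewrite !dotE; dot_sym; lra.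
Qed.

(** Testing the supremum for (s',v') at the point u, together with the
    convexity of - hat_h(u,.) + q, makes (u,w) a subgradient of the dual
    function at (sf,v). *)
Lemma dual_subgradient u v b sf w s' v' G :
  Ku u -> subgrad Kv q v b -> w = - ((Fg u v).2 + sv *: v) + b ->
  Kv v' -> dual_bound s' v' G ->
  dual_at u sf v + dot u (s' - sf) + dot w (v' - v) <= G.
Proof.
move=> Kuu [Kvv hb] -> Kvv' /(_ _ Kuu); apply: le_trans; rewrite /dual_at /hat_h.
have := hb _ Kvv'; have := h_concave Kuu Kvv Kvv'.
rewrite !dotE; dot_sym; lra.
Qed.

Section OuterLoop.
Context (tau a : R) (us : U) (vs : V).
Hypothesis round_within : within a round_calls.
Hypothesis us_sol : subgrad Ku p us (- (Fg us vs).1).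
Hypothesis vs_sol : subgrad Kv q vs (Fg us vs).2.

Local Notation al := (alpha_bar su sv).
Local Notation ev := (eta_v su sv).
Local Notation zh := (zeta_hat su sv Lb).
Local Notation ss := (- (su *: us)).
Local Notation M := (1 + 8 * Lb / su).

Lemma alpha_bar_gt0 : 0 < al.
Proof. by rewrite /alpha_bar lt_min ltr01 sqrtr_gt0 divr_gt0 ?mulr_gt0. Qed.

Lemma alpha_bar_le1 : al <= 1.
Proof. by rewrite /alpha_bar ge_min lexx. Qed.

Lemma alpha_bar_sqr : al ^+ 2 <= 8 * sv / su.
Proof.
have h0 : 0 <= 8 * sv / su by rewrite divr_ge0 ?mulr_ge0 // ltW.
rewrite -[X in _ <= X]sqr_sqrtr // lerXn2r ?nnegrE ?sqrtr_ge0 ?(ltW alpha_bar_gt0) //.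
by rewrite /alpha_bar ge_min lexx orbT.
Qed.

Lemma eta_v_gt0 : 0 < ev.
Proof. by rewrite /eta_v lt_min !divr_gt0 ?mulr_gt0 ?alpha_bar_gt0. Qed.

Lemma eta_v_facts : [/\ ev * sv <= 1 / 2, al / 2 <= ev * sv & al * ev <= 4 / su].
Proof.
have a0 := alpha_bar_gt0; split.
- apply: le_trans (_ : 1 / (2 * sv) * sv <= _).
    by rewrite ler_wpM2r ?(ltW sv_gt0) // /eta_v ge_min lexx.
  by rewrite le_eqVlt; apply/orP; left; apply/eqP; field; rewrite gt_eqF.
- rewrite /eta_v; case: (lerP (1 / (2 * sv)) _) => _.
    have -> : 1 / (2 * sv) * sv = 1 / 2 by field; rewrite gt_eqF.
    by have := alpha_bar_le1; lra.
  have -> : 4 / (al * su) * sv = (8 * sv / su) / (2 * al).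
    by field; rewrite !gt_eqF.
  rewrite ler_pdivlMr ?mulr_gt0 //.
  have -> : al / 2 * (2 * al) = al ^+ 2 by field.
  exact: alpha_bar_sqr.
- apply: le_trans (_ : al * (4 / (al * su)) <= _).
    by rewrite ler_wpM2l ?(ltW a0) // /eta_v ge_min lexx orbT.
  by rewrite le_eqVlt; apply/orP; left; apply/eqP; field; rewrite !gt_eqF.
Qed.

Definition Gstar : R := dual_at us ss vs.
Definition Pstar : R := dual_value ss vs Gstar.

Lemma star_first : (Fg us vs).1 - su *: us + - (Fg us vs).1 = ss.
Proof. by rewrite addrAC subrr add0r. Qed.

Lemma star_second : - ((Fg us vs).2 + sv *: vs) + (Fg us vs).2 = - (sv *: vs).
Proof. by rewrite opprD addrAC addNr add0r. Qed.

Lemma dual_bound_star : dual_bound ss vs Gstar.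
Proof. by have := dual_attained vs_sol.1 us_sol; rewrite star_first. Qed.

(** The saddle point gives the minimiser of the dual objective: there the
    subgradient (us, - sv vs) cancels against the gradient of the quadratic
    terms. *)
Lemma Pstar_le sf vf G : Kv vf -> dual_bound sf vf G ->
  Pstar <= dual_value sf vf G.
Proof.
move=> Kf hG.
have := dual_subgradient ss us_sol.1 vs_sol (esym star_second) Kf hG.
rewrite /Pstar /dual_value -/Gstar.
have := dot_ge0 (su *: us + sf); have := dot_ge0 (vf - vs).
have i0 : 0 < su^-1 by rewrite invr_gt0.
move=> d1 d2.
have {}d1 : 0 <= sv * dot (vf - vs) (vf - vs) by rewrite mulr_ge0 // ltW.
have {}d2 : 0 <= su^-1 * dot (su *: us + sf) (su *: us + sf) by rewrite mulr_ge0 // ltW.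
have e : su^-1 * dot (su *: us + sf) (su *: us + sf)
   = su * dot us us + 2 * dot us sf + su^-1 * dot sf sf.
  by rewrite !dotE; dot_sym; field; rewrite gt_eqF.
have e2 : su^-1 / 2 * dot ss ss = su / 2 * dot us us.
  by rewrite !dotE; field; rewrite gt_eqF.
rewrite e in d2; rewrite e2; move: d1; rewrite !dotE; dot_sym; lra.
Qed.

Definition lyapunov (s : U) (v : V) (P : R) : R :=
  (su / 2)^-1 * dot (s - ss) (s - ss) + ev^-1 * dot (v - vs) (v - vs)
  + 2 / al * (P - Pstar).

Definition dist_coef : R := Num.max (1 / (2 * su)) ev.

Lemma dist_le_lyapunov s v P : Pstar <= P ->
  dot (- (su^-1 *: s) - us) (- (su^-1 *: s) - us) + dot (v - vs) (v - vs)
  <= dist_coef * lyapunov s v P.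
Proof.
move=> hP.
have m0 : 0 <= dist_coef by rewrite /dist_coef le_max (ltW eta_v_gt0) orbT.
have t0 : 0 <= 2 / al * (P - Pstar).
  by rewrite mulr_ge0 ?subr_ge0 // divr_ge0 // ltW // alpha_bar_gt0.
have e1 : dot (- (su^-1 *: s) - us) (- (su^-1 *: s) - us)
   = 1 / (2 * su) * ((su / 2)^-1 * dot (s - ss) (s - ss)).
  rewrite !dotE; dot_sym; field; by rewrite gt_eqF.
have e2 : dot (v - vs) (v - vs) = ev * (ev^-1 * dot (v - vs) (v - vs)).
  by rewrite mulrA mulfV ?mul1r // gt_eqF // eta_v_gt0.
have d1 : 0 <= (su / 2)^-1 * dot (s - ss) (s - ss).
  by rewrite mulr_ge0 ?dot_ge0 // invr_ge0 divr_ge0 // ltW.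
have d2 : 0 <= ev^-1 * dot (v - vs) (v - vs).
  by rewrite mulr_ge0 ?dot_ge0 // invr_ge0 ltW // eta_v_gt0.
rewrite e1 [X in _ + X <= _]e2 /lyapunov.
have m1 : 1 / (2 * su) <= dist_coef by rewrite /dist_coef le_max lexx.
have m2 : ev <= dist_coef by rewrite /dist_coef le_max lexx orbT.
have := ler_wpM2r d1 m1; have := ler_wpM2r d2 m2; have := mulr_ge0 m0 t0; lra.
Qed.

Lemma zeta_hat_gt0 : 0 < zh.
Proof. by rewrite /zeta_hat divr_gt0 ?exprn_gt0 // lt_min su_gt0. Qed.

(** Both (uh,vh) and (us,vs) lie in the domain, so the subgradients there are
    monotone and |(uh,vh) - (us,vs)| <= (1 + zh Lb) |(u,v) - (us,vs)|, where zh
    Lb <= 1/3. As (u,v) may lie outside of the domain, only the Lipschitz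
    property of the field is available there, and the resulting factor is 7/3 =
    1 + 4/3. *)
Lemma residual_le u v :
  let g := Fg u v in
  let uh := Pp zh (u - zh *: g.1) in
  let vh := Pq zh (v + zh *: g.2) in
  dot (zh^-1 *: row_mx (u - uh) (vh - v) - (row_mx g.1 g.2 - row_mx (Fg uh vh).1 (Fg uh vh).2))
      (zh^-1 *: row_mx (u - uh) (vh - v) - (row_mx g.1 g.2 - row_mx (Fg uh vh).1 (Fg uh vh).2))
  <= (zh^-1 + Lb) ^+ 2 * (49 / 9) * (dot (u - us) (u - us) + dot (v - vs) (v - vs)).
Proof.
cbv zeta; set g := Fg u v; set uh := Pp _ _; set vh := Pq _ _.
have z0 := zeta_hat_gt0.
pose w : W := row_mx u v; pose wh : W := row_mx uh vh; pose ws : W := row_mx us vs.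
have hs : subgrad KW phi ws (- saddle_field ws).
  rewrite /saddle_field /ws row_mxKl row_mxKr opp_row_mx opprK.
  exact: subgrad_row_mx.
have whs : subgrad KW phi wh (zh^-1 *: (w - zh *: saddle_field w - wh)).
  have := joint_prox_subgrad (w - zh *: saddle_field w) z0.
  have -> // : joint_prox zh (w - zh *: saddle_field w) = wh.
  rewrite /joint_prox /saddle_field /w row_mxKl row_mxKr scale_row_mx sub_row_mx row_mxKl row_mxKr.
  by rewrite scalerN opprK.
have mono := subgrad_monotone whs hs.
pose r := enorm (w - ws); pose e := enorm (wh - ws).
have r0 : 0 <= r by exact: enorm_ge0.
have e0 : 0 <= e by exact: enorm_ge0.
have lipF := saddle_field_lip w ws; rewrite -/r in lipF.
have zL : zh * Lb <= 1 / 3.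
  have -> : zh * Lb = Num.min su sv / Lb by rewrite /zeta_hat; field; rewrite gt_eqF.
  rewrite ler_pdivrMr //.
  have : Num.min su sv <= su by rewrite ge_min lexx.
  by have := Lb_ge; lra.
have er : e <= 4 / 3 * r.
  have [->|en] := eqVneq e 0; first by rewrite mulr_ge0.
  have ep : 0 < e by rewrite lt_neqAle eq_sym en.
  have h1 : dot (wh - ws) (wh - ws)
      <= dot (w - ws) (wh - ws) - zh * dot (saddle_field w - saddle_field ws) (wh - ws).
    have : 0 <= zh * dot (zh^-1 *: (w - zh *: saddle_field w - wh) - - saddle_field ws) (wh - ws).
      by rewrite mulr_ge0 // ltW.
    rewrite -dotZl.
    have -> : zh *: (zh^-1 *: (w - zh *: saddle_field w - wh) - - saddle_field ws)
       = (w - ws) - zh *: (saddle_field w - saddle_field ws) - (wh - ws).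
      by apply/rowP => i; rewrite !mxE; field; rewrite gt_eqF.
    by rewrite dotDl dotNl dotDl dotNl dotZl; lra.
  have c1 := cauchy_schwarz (w - ws) (wh - ws); rewrite -/r -/e in c1.
  have c2 := cauchy_schwarz (- (saddle_field w - saddle_field ws)) (wh - ws).
  rewrite enormN dotNl -/e in c2.
  have c3 : enorm (saddle_field w - saddle_field ws) * e <= Lb * r * e by rewrite ler_wpM2r.
  have c4 : zh * (- dot (saddle_field w - saddle_field ws) (wh - ws)) <= zh * (Lb * r * e).
    by rewrite ler_pM2l //; lra.
  have c5 : zh * Lb * (r * e) <= 1 / 3 * (r * e) by rewrite ler_wpM2r // mulr_ge0.
  rewrite -(ler_pM2r ep) -expr2 /e enorm_sqr -/e.
  move: h1 c1 c4 c5; rewrite !mulrA; lra.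
have dw : enorm (w - wh) <= 7 / 3 * r.
  by have := enorm_dist w ws wh; rewrite (enormB ws wh) -/r -/e; lra.
have i0 : 0 < zh^-1 by rewrite invr_gt0.
have bound : enorm (zh^-1 *: (w - wh) - (saddle_field w - saddle_field wh)) <= (zh^-1 + Lb) * (7 / 3 * r).
  apply: le_trans (enormD _ _) _; rewrite enormN enormZ ?(ltW i0) // mulrDl.
  apply: lerD; first by rewrite ler_pM2l.
  by apply: le_trans (saddle_field_lip _ _) _; rewrite ler_pM2l.
have := dot_le_sqr bound.
have -> : ((zh^-1 + Lb) * (7 / 3 * r)) ^+ 2 = (zh^-1 + Lb) ^+ 2 * (49 / 9) * r ^+ 2 by field; rewrite gt_eqF.
rewrite /r enorm_sqr /w /ws /wh !sub_row_mx dot_row_mx; apply: le_trans.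
rewrite /saddle_field ?row_mxKl ?row_mxKr ?sub_row_mx ?scale_row_mx ?sub_row_mx ?dot_row_mx.
rewrite -/g le_eqVlt; apply/orP; left; apply/eqP; congr (_ + _).
have neg k (x y : 'rV[R]_k) : x = - y -> dot x x = dot y y.
  by move=> ->; rewrite dotNl dotNr opprK.
by apply: neg; apply/rowP => i; rewrite !mxE; ring.
Qed.

Hypothesis tau_ge0 : 0 <= tau.

Definition stationary_within (w : U * V) : Prop :=
  exists bu bv, [/\ subgrad Ku p w.1 bu, subgrad Kv q w.2 bv &
    enorm (row_mx ((Fg w.1 w.2).1 + bu) ((Fg w.1 w.2).2 - bv)) <= tau].

Local Notation kap := ((zh^-1 + Lb) ^+ 2 * (49 / 9) * dist_coef).

Lemma outer_step_run s v sf vf G : Kv vf -> dual_bound sf vf G ->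
  exists r c, [/\ outer_step gradh proxp proxq su sv Lb tau (Outer s v sf vf) r c,
    within ((31 * M + 4) * a) c &
    match r with
    | inr w => stationary_within w
    | inl (Outer s' v' sf' vf') => exists G', [/\ Kv vf', dual_bound sf' vf' G',
        lyapunov s' v' (dual_value sf' vf' G') <= (1 - al / 2) * lyapunov s v (dual_value sf vf G) &
        tau ^+ 2 < kap * lyapunov s' v' (dual_value sf' vf' G')]
    end].
Proof.
move=> Kvf hG.
pose sg := al *: s + (1 - al) *: sf; pose vg := al *: v + (1 - al) *: vf.
have [i0 [i [c [hi0 hloop [gE su_ sv_ crit] wc]]]] := inner_run sg vg round_within.
pose uf' := in_u i; pose vf' := in_v i.
pose gf := grad_hat su sv uf' vf' (in_g i).
pose sf' := gf.1 + in_bu i; pose wf' := - gf.2 + in_bv i.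
pose s' := s + (eta_s su * su^-1) *: (sf' - s) - eta_s su *: (uf' + su^-1 *: sf').
pose v' := v + (ev * sv) *: (vf' - v) - ev *: (wf' + sv *: vf').
pose u' := - (su^-1 *: s').
pose g' := Fg u' v'.
pose uh := Pp zh (u' - zh *: g'.1); pose vh := Pq zh (v' + zh *: g'.2).
pose gh := Fg uh vh.
have z0 := zeta_hat_gt0.
have cost_ok : within ((31 * M + 4) * a) (add_calls round_calls (add_calls c round_calls)).
  have := within_add round_within (within_add wc round_within).
  by move/within_le; apply; lra.
have sf'E : sf' = (Fg uf' vf').1 - su *: uf' + in_bu i by rewrite /sf' /gf gE.
have wf'E : wf' = - ((Fg uf' vf').2 + sv *: vf') + in_bv i by rewrite /wf' /gf gE.
pose G' := dual_at uf' sf' vf'.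
have Kvf' : Kv vf' := sv_.1.
have hG' : dual_bound sf' vf' G'.
  by rewrite /G' sf'E; exact: dual_attained.
have i_gt0 : 0 < su^-1 by rewrite invr_gt0.
have contraction : lyapunov s' v' (dual_value sf' vf' G')
    <= (1 - al / 2) * lyapunov s v (dual_value sf vf G).
  have [e1 e2 e3] := eta_v_facts.
  have hold := dual_subgradient sf' su_.1 sv_ wf'E Kvf hG.
  have hstar := dual_subgradient sf' su_.1 sv_ wf'E vs_sol.1 dual_bound_star.
  apply: (@accelerated_contraction R nu nv su sv al ev s sf sg sf' uf' (uf' + su^-1 *: sf')
    ss v vf vg vf' (wf' + sv *: vf') vs) => //.
  - by rewrite alpha_bar_gt0 alpha_bar_le1.
  - exact: eta_v_gt0.
  - move: hold; rewrite /dual_value -/G'.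
    have := dot_ge0 (sf - sf') => d1; have := dot_ge0 (vf - vf') => d2.
    have {}d1 : 0 <= su^-1 * dot (sf - sf') (sf - sf') by rewrite mulr_ge0 // ltW.
    have {}d2 : 0 <= sv * dot (vf - vf') (vf - vf') by rewrite mulr_ge0 // ltW.
    by move: d1 d2; rewrite !dotE; dot_sym; lra.
  - move: hstar; rewrite /Pstar /dual_value -/G'.
    move: Gstar => Gs; move: ss => ss0; rewrite !dotE; dot_sym; lra.
  - have auE : (su / 2) *: (uf' + su^-1 *: sf' + su^-1 *: (sf' - sg))
       = a_u su sv sg (in_u i) (in_v i) (in_g i) + in_bu i.
      rewrite /a_u /sf' /gf -/uf' -/vf'; apply/rowP => j; rewrite !mxE; field.
      by rewrite gt_eqF.
    have avE : wf' + sv *: vf' + (su / 8) *: (vf' - vg)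
       = a_v su sv vg (in_u i) (in_v i) (in_g i) + in_bv i.
      by rewrite /a_v /wf' /gf -/uf' -/vf'; apply/rowP => j; rewrite !mxE; ring.
    rewrite auE avE -!enorm_sqr; move: crit; rewrite /gamma -/uf' -/vf'.
    have -> : (8 * su^-1)^-1 = su / 8 by rewrite invfM invrK mulrC.
    by rewrite !mulrDr.
  - exact: Pstar_le.
pose res := zh^-1 *: row_mx (u' - uh) (vh - v') - (row_mx g'.1 g'.2 - row_mx gh.1 gh.2).
have stepE (r : outer_state R nu nv + U * V) :
    (if enorm res <= tau then ret (inr (uh, vh)) else ret (inl (Outer s' v' sf' vf'))) r no_calls ->
    outer_step gradh proxp proxq su sv Lb tau (Outer s v sf vf) r
      (add_calls round_calls (add_calls c round_calls)).
  move=> hr; rewrite /outer_step.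
  apply: bind_intro hi0 _; apply: bind_intro hloop _.
  apply: bind_intro (gradhP _ _) _; apply: bind_intro (proxpP _ _) _.
  apply: bind_intro (proxqP _ _) _; apply: bind_intro (gradhP _ _) _.
  exact: hr.
have [stop|nstop] := boolP (enorm res <= tau); last first.
  exists (inl (Outer s' v' sf' vf')); eexists; split; [|exact: cost_ok|].
    by apply: stepE; rewrite (negbTE nstop).
  exists G'; split=> //.
  rewrite -ltNge in nstop.
  have h1 : tau ^+ 2 < dot res res.
    by rewrite -enorm_sqr ltr_pXn2r // nnegrE enorm_ge0.
  apply: lt_le_trans h1 _.
  apply: le_trans (residual_le u' v') _.
  rewrite -[X in _ <= X]mulrA ler_wpM2l //; last exact: dist_le_lyapunov (Pstar_le _ _).
  by rewrite mulr_ge0 ?sqr_ge0 // divr_ge0.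
exists (inr (uh, vh)); eexists; split; [|exact: cost_ok|].
  by apply: stepE; rewrite stop.
exists (zh^-1 *: (u' - zh *: g'.1 - uh)), (zh^-1 *: (v' + zh *: g'.2 - vh)).
split; [exact: Pp_sub|exact: Pq_sub|].
apply: le_trans stop; rewrite le_eqVlt; apply/orP; left; apply/eqP; congr enorm.
rewrite /res scale_row_mx !sub_row_mx -/gh /=; congr row_mx; apply/rowP => j; rewrite !mxE; field.
all: by rewrite ?gt_eqF.
Qed.

Lemma method_S_run (u0 : U) (v0 : V) (G0 C : R) (N : nat) :
  Kv v0 -> dual_bound (- (su *: u0)) v0 G0 ->
  lyapunov (- (su *: u0)) v0 (dual_value (- (su *: u0)) v0 G0) <= C ->
  (0 < N)%N -> kap * ((1 - al / 2) ^+ N * C) <= tau ^+ 2 ->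
  exists w c, [/\ method_S gradh proxp proxq su sv Lb tau (- (su *: u0)) v0 w c,
     stationary_within w & within (N%:R * ((31 * M + 4) * a)) c].
Proof.
move=> Kv0 hG0 hC N0 hN.
pose Inv (j : nat) (o : outer_state R nu nv) := exists G,
  [/\ Kv (out_vf o), dual_bound (out_sf o) (out_vf o) G,
      lyapunov (out_s o) (out_v o) (dual_value (out_sf o) (out_vf o) G) <= (1 - al / 2) ^+ j * C &
      (j < N)%N].
have al1 := alpha_bar_le1; have al0 := alpha_bar_gt0.
have q0 : 0 <= 1 - al / 2 by lra.
have cost0 : 0 <= (31 * M + 4) * a.
  have a0 := within_ge0 round_within.
  rewrite mulr_ge0 // addr_ge0 // mulr_ge0 // addr_ge0 // divr_ge0 ?mulr_ge0 // ltW //.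
have kap0 : 0 <= kap.
  have dc0 : 0 <= dist_coef by rewrite /dist_coef le_max (ltW eta_v_gt0) orbT.
  by rewrite mulr_ge0 // mulr_ge0 ?sqr_ge0 // divr_ge0.
have [||w [c [h1 h2 h3]]] := @loop_within R _ _
   (outer_step gradh proxp proxq su sv Lb tau) Inv stationary_within (fun=> (31 * M + 4) * a) N
   (Outer (- (su *: u0)) v0 (- (su *: u0)) v0) (fun=> cost0).
- move=> j [s v sf vf] [G [/= Kvf hG hlyap jN]]; split=> //.
  have [r [c [h1 h2 h3]]] := outer_step_run s v Kvf hG.
  exists r, c; split=> //; case: r h1 h3 => // -[s' v' sf' vf'] _ [G' [k1 k2 k3 k4]].
  have k5 : lyapunov s' v' (dual_value sf' vf' G') <= (1 - al / 2) ^+ j.+1 * C.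
    by apply: le_trans k3 _; rewrite exprS -mulrA ler_wpM2l.
  exists G'; split=> //=.
  rewrite ltn_neqAle jN andbT; apply/eqP => jE.
  have : kap * lyapunov s' v' (dual_value sf' vf' G') <= tau ^+ 2.
    by apply: le_trans hN; rewrite ler_wpM2l // -jE.
  by rewrite leNgt k4.
- by exists G0; split=> //=; rewrite expr0 mul1r.
exists w, c; split=> //.
by move: h3; rewrite sumr_const card_ord -[_ *+ N]mulr_natl.
Qed.

End OuterLoop.

Definition lyapunov_start_bound (Du2 Dv2 lower upper : R) : R :=
  2 * su * Du2 + Num.max (2 * sv) (alpha_bar su sv * su / 4) * Dv2
  + 2 / alpha_bar su sv * (su / 2 * Du2 + upper - lower).

Definition residual_coef : R :=
  ((zeta_hat su sv Lb)^-1 + Lb) ^+ 2 * (49 / 9) * dist_coef.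

(** Here lower and upper enclose the value of the saddle problem against v0 and
    against ub; their difference, the diameters and the strong convexity bound
    the Lyapunov function at the start. *)
Lemma method_S_converges (u0 ub : U) (v0 : V) (Du2 Dv2 lower upper tau a : R) (N : nat) :
  within a round_calls -> 0 <= tau -> Kv v0 ->
  (forall u, Ku u -> dot (u - u0) (u - u0) <= Du2) ->
  (forall v, Kv v -> dot (v - v0) (v - v0) <= Dv2) ->
  (forall u, Ku u -> lower <= h u v0 + p u - q v0) ->
  Ku ub -> (forall v, Kv v -> h ub v + p ub - q v <= upper) ->
  (0 < N)%N ->
  residual_coef * ((1 - alpha_bar su sv / 2) ^+ N
    * lyapunov_start_bound Du2 Dv2 lower upper) <= tau ^+ 2 ->
  exists w c, [/\ method_S gradh proxp proxq su sv Lb tau (- (su *: u0)) v0 w c,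
     stationary_within tau w & within (N%:R * ((31 * (1 + 8 * Lb / su) + 4) * a)) c].
Proof.
move=> rw tau0 Kv0 hu hv hlo Kub hup N0 hN.
have [us [vs [us_sol vs_sol]]] := saddle_solution.
pose s0 := - (su *: u0).
pose P0 := su / 2 * Du2 - lower.
pose G0 := P0 - su^-1 / 2 * dot s0 s0 - sv / 2 * dot v0 v0.
have P0E : dual_value s0 v0 G0 = P0 by rewrite /dual_value /G0; ring.
apply: (method_S_run rw us_sol vs_sol tau0 (G0 := G0) Kv0 _ _ N0 hN).
  move=> u Kuu; rewrite /G0 /P0 /hat_h /s0.
  have e : su^-1 / 2 * dot (- (su *: u0)) (- (su *: u0)) = su / 2 * dot u0 u0.
    by rewrite !dotE; field; rewrite gt_eqF.
  have := hlo _ Kuu; have := ler_wpM2l (ltW su_gt0) (hu _ Kuu).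
  by rewrite e !dotE; dot_sym; lra.
rewrite -/s0 P0E /lyapunov /lyapunov_start_bound.
have e1 : (su / 2)^-1 * dot (s0 - - (su *: us)) (s0 - - (su *: us)) = 2 * su * dot (us - u0) (us - u0).
  by rewrite /s0 !dotE; dot_sym; field; rewrite gt_eqF.
have e2 : (eta_v su sv)^-1 <= Num.max (2 * sv) (alpha_bar su sv * su / 4).
  have a0 := alpha_bar_gt0.
  rewrite /eta_v; case: (lerP (1 / (2 * sv)) _) => _.
    by rewrite div1r invrK le_max lexx.
  by rewrite invf_div le_max lexx orbT.
have e3 : - Pstar us vs <= upper.
  have := hup _ vs_sol.1.
  have := us_sol.2 _ Kub; have := h_convex us_sol.1 Kub vs_sol.1.
  have := dot_ge0 (ub - us) => d0; have {}d0 := mulr_ge0 (ltW su_gt0) d0.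
  have e : su^-1 / 2 * dot (- (su *: us)) (- (su *: us)) = su / 2 * dot us us.
    by rewrite !dotE; field; rewrite gt_eqF.
  rewrite /Pstar /dual_value /Gstar /dual_at /hat_h e !dotE.
  by move: d0; rewrite !dotE; dot_sym; lra.
rewrite e1.
have c0 : 0 <= 2 / alpha_bar su sv by rewrite divr_ge0 // ltW // alpha_bar_gt0.
have h1 : 2 * su * dot (us - u0) (us - u0) <= 2 * su * Du2.
  by rewrite ler_pM2l ?mulr_gt0 //; exact: hu us_sol.1.
have h2 : (eta_v su sv)^-1 * dot (v0 - vs) (v0 - vs)
   <= Num.max (2 * sv) (alpha_bar su sv * su / 4) * Dv2.
  apply: ler_pM; rewrite ?dot_ge0 ?invr_ge0 ?(ltW eta_v_gt0) //.
  have -> : dot (v0 - vs) (v0 - vs) = dot (vs - v0) (vs - v0) by rewrite !dotE; dot_sym; ring.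
  exact: hv vs_sol.1.
have h3 : 2 / alpha_bar su sv * (P0 - Pstar us vs)
   <= 2 / alpha_bar su sv * (su / 2 * Du2 + upper - lower).
  by rewrite ler_wpM2l //= /P0; lra.
by do !apply: lerD.
Qed.

End SaddleMethod.

(** * The inexact proximal-point method for nonconvex--concave problems *)

Section Numbers.
Context (R : realType).

(** The quadratic regularisation shifts the two blocks of the field in opposite
    directions, so that the triangle inequality applies to both blocks at once.
    *)
Lemma lipschitz_shift k l (L c c1 c2 : R) (x dx : 'rV[R]_k) (y dy : 'rV[R]_l) :
  0 <= L -> 0 <= c1 <= c -> 0 <= c2 <= c ->
  dot x x + dot y y <= L ^+ 2 * (dot dx dx + dot dy dy) ->
  dot (x + c1 *: dx) (x + c1 *: dx) + dot (y - c2 *: dy) (y - c2 *: dy)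
  <= (L + c) ^+ 2 * (dot dx dx + dot dy dy).
Proof.
move=> L0 /andP[c10 c1c] /andP[c20 c2c] h.
pose d := enorm (row_mx dx dy).
have dE : d ^+ 2 = dot dx dx + dot dy dy by rewrite /d enorm_sqr dot_row_mx.
have c0 : 0 <= c by apply: le_trans c1c.
have d0 : 0 <= d by exact: enorm_ge0.
have hx : enorm (row_mx x y) <= L * d.
  by apply: enorm_le; rewrite ?mulr_ge0 // dot_row_mx exprMn dE.
have hc : enorm (row_mx (c1 *: dx) (- (c2 *: dy))) <= c * d.
  apply: enorm_le; rewrite ?mulr_ge0 // dot_row_mx exprMn dE.
  have -> : dot (- (c2 *: dy)) (- (c2 *: dy)) = c2 ^+ 2 * dot dy dy by rewrite !dotE; ring.
  rewrite dotZl dotZr mulrA -expr2 mulrDr.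
  by apply: lerD; apply: ler_wpM2r; rewrite ?dot_ge0 // lerXn2r ?nnegrE.
have := dot_le_sqr (le_trans (enormD _ _) (lerD hx hc)).
by rewrite add_row_mx dot_row_mx -mulrDl exprMn dE.
Qed.

(** For k >= 2 the term k^-2 is at most (k-1)^-1 - k^-1, and the sum
    telescopes. *)
Lemma sum_inv_sqr_le2 k : \sum_(i < k) ((i.+1)%:R : R) ^- 2 <= 2.
Proof.
have H j : \sum_(i < j.+1) ((i.+1)%:R : R) ^- 2 <= 2 - (j.+1)%:R^-1.
  elim: j => [|j ih]; first by rewrite big_ord1 /= expr1n invr1; lra.
  rewrite big_ord_recr /=; apply: le_trans (lerD ih (lexx _)) _.
  have p1 : 0 < (j.+1)%:R :> R by [].
  have -> : (j.+2)%:R = (j.+1)%:R + 1 :> R by rewrite natr1.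
  move: (j.+1)%:R p1 => x x0.
  have x10 : 0 < x + 1 by lra.
  have h : (x + 1) ^- 2 <= x^-1 - (x + 1)^-1.
    have -> : x^-1 - (x + 1)^-1 = (x * (x + 1))^-1 by field; rewrite !gt_eqF.
    by rewrite lef_pV2 ?posrE ?exprn_gt0 ?mulr_gt0 // expr2 ler_pM2r //; lra.
  by lra.
case: k => [|k]; first by rewrite big_ord0.
by apply: le_trans (H k) _; rewrite gerBl invr_ge0.
Qed.

(** Since 1 - al/2 <= exp (- al/2), the first integer above (2/al) ln x will do
    when x > 1, and one iteration when x <= 1. *)
Lemma geometric_iterations (al x : R) : 0 < al <= 1 ->
  exists N, [/\ (0 < N)%N, (1 - al / 2) ^+ N * x <= 1 &
    N%:R <= 2 / al * pos_part (ln x) + 1].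
Proof.
move=> /andP[al0 al1].
have q0 : 0 <= 1 - al / 2 by lra.
have c0 : 0 < 2 / al by rewrite divr_gt0.
have [x1|x1] := lerP x 1.
  exists 1%N; split=> //.
    rewrite expr1; apply: le_trans (_ : 1 * 1 <= _); last by rewrite mulr1.
    have [x0|x0] := lerP 0 x; first by apply: ler_pM => //; lra.
    by apply: le_trans (_ : 0 <= _); [rewrite mulr_ge0_le0 // ltW|rewrite mulr1].
  by rewrite lerDr mulr_ge0 ?(ltW c0) // /pos_part le_max lexx orbT.
have x0 : 0 < x by lra.
have lx : 0 < ln x by rewrite ln_gt0.
pose y := 2 / al * ln x.
have y0 : 0 <= y by rewrite mulr_ge0 // ltW.
have /andP[h1 h2] := truncn_itv y0.
exists (Num.truncn y).+1; split=> //; last first.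
  rewrite -natr1 lerD2r; apply: le_trans h1 _.
  by rewrite /y ler_pM2l // /pos_part le_max lexx.
have e1 : 1 - al / 2 <= expR (- (al / 2)) by have := expR_ge1Dx (- (al / 2)).
have e2 : (1 - al / 2) ^+ (Num.truncn y).+1 <= expR (- (al / 2)) ^+ (Num.truncn y).+1.
  by rewrite lerXn2r ?nnegrE // expR_ge0.
apply: le_trans (ler_wpM2r (ltW x0) e2) _.
rewrite -expRM_natl -[X in _ * X](lnK (x := x)) ?posrE // -expRD -[X in _ <= X]expR0 ler_expR.
have h3 : al / 2 * y <= al / 2 * (Num.truncn y).+1%:R by rewrite ler_wpM2l ?ltW // divr_gt0.
have h4 : al / 2 * y = ln x by rewrite /y; field; rewrite gt_eqF.
by move: h3; rewrite h4; lra.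
Qed.

End Numbers.

Section ProximalPointMethod.
Context (R : realType) (nu nv : nat).
Local Notation U := 'rV[R]_nu.
Local Notation V := 'rV[R]_nv.
Context (Ku : set U) (Kv : set V) (p : U -> R) (q : V -> R).
Context (gradh : U -> V -> prog (U * V)) (proxp : R -> U -> prog U) (proxq : R -> V -> prog V).
Context (Fg : U -> V -> U * V) (Pp : R -> U -> U) (Pq : R -> V -> V) (cg cp cq : calls).
Context (h : U -> V -> R) (L D eps eps0 a Du2 lower upper smoothed_lower H0 : R) (v0 : V) (ub : U).

Hypothesis gradhP : forall u v, gradh u v (Fg u v) cg.
Hypothesis proxpP : forall c u, proxp c u (Pp c u) cp.
Hypothesis proxqP : forall c v, proxq c v (Pq c v) cq.
Hypothesis Pp_sub : forall c u, 0 < c -> subgrad Ku p (Pp c u) (c^-1 *: (u - Pp c u)).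
Hypothesis Pq_sub : forall c v, 0 < c -> subgrad Kv q (Pq c v) (c^-1 *: (v - Pq c v)).
Hypothesis p_cc : closed_convex_on Ku p.
Hypothesis q_cc : closed_convex_on Kv q.
Hypothesis L_gt0 : 0 < L.
Hypothesis D_gt0 : 0 < D.
Hypothesis eps_gt0 : 0 < eps.
Hypothesis eps0_gt0 : 0 < eps0.
Hypothesis eps0_le : eps0 <= eps / 2.
Hypothesis h_weak_convex : forall u u' v, Ku u -> Ku u' -> Kv v ->
  h u v + dot (Fg u v).1 (u' - u) - L / 2 * dot (u' - u) (u' - u) <= h u' v.
Hypothesis h_concave : forall u v v', Ku u -> Kv v -> Kv v' ->
  h u v' <= h u v + dot (Fg u v).2 (v' - v).
Hypothesis Fg_lip : forall u v u' v',
  dot ((Fg u v).1 - (Fg u' v').1) ((Fg u v).1 - (Fg u' v').1)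
  + dot ((Fg u v).2 - (Fg u' v').2) ((Fg u v).2 - (Fg u' v').2)
  <= L ^+ 2 * (dot (u - u') (u - u') + dot (v - v') (v - v')).
Hypothesis round_within : within a (round_calls cg cp cq).
Hypothesis Ku_diam : forall u u', Ku u -> Ku u' -> dot (u - u') (u - u') <= Du2.
Hypothesis Kv_diam : forall v v', Kv v -> Kv v' -> dot (v - v') (v - v') <= D ^+ 2.
Hypothesis Kv0 : Kv v0.
Hypothesis saddle_low : forall u v, Ku u -> Kv v -> lower <= h u v + p u - q v.
Hypothesis Kub : Ku ub.
Hypothesis saddle_up : forall v, Kv v -> h ub v + p ub - q v <= upper.

Local Notation sv := (eps / (2 * D)).
Local Notation Lb := (3 * L + eps / (2 * D)).

Let sv_gt0 : 0 < sv. Proof. by rewrite divr_gt0 ?mulr_gt0. Qed.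
Let Lb_ge : 3 * L <= Lb. Proof. by rewrite lerDl ltW. Qed.
Let sv_le : sv <= Lb. Proof. by rewrite lerDr mulr_ge0 // ltW. Qed.

Section OneStep.
Context (uk : U) (Kuk : Ku uk).

Definition regularized (u : U) (v : V) : R :=
  h u v - sv / 2 * dot (v - v0) (v - v0) + L * dot (u - uk) (u - uk).

Definition regularized_grad (u : U) (v : V) : U * V :=
  ((Fg u v).1 + (2 * L) *: (u - uk), (Fg u v).2 - sv *: (v - v0)).

Lemma regularized_gradP u v :
  gradh_k gradh L D eps v0 uk u v (regularized_grad u v) cg.
Proof.
rewrite /gradh_k -[cg]add_calls0; apply: bind_intro (gradhP u v) _.
by split.
Qed.

Lemma regularized_convex u u' v : Ku u -> Ku u' -> Kv v ->
  regularized u v + dot (regularized_grad u v).1 (u' - u) + L / 2 * dot (u' - u) (u' - u)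
  <= regularized u' v.
Proof.
move=> Kuu Kuu' Kvv; rewrite /regularized /regularized_grad /=.
have := h_weak_convex Kuu Kuu' Kvv; rewrite !dotE; dot_sym; lra.
Qed.

Lemma regularized_concave u v v' : Ku u -> Kv v -> Kv v' ->
  regularized u v' <= regularized u v + dot (regularized_grad u v).2 (v' - v)
    - sv / 2 * dot (v' - v) (v' - v).
Proof.
move=> Kuu Kvv Kvv'; rewrite /regularized /regularized_grad /=.
have := h_concave Kuu Kvv Kvv'; move: (eps / (2 * D)) => s; rewrite !dotE; dot_sym; lra.
Qed.

Lemma regularized_lip u v u' v' :
  dot ((regularized_grad u v).1 - (regularized_grad u' v').1)
      ((regularized_grad u v).1 - (regularized_grad u' v').1)
  + dot ((regularized_grad u v).2 - (regularized_grad u' v').2)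
        ((regularized_grad u v).2 - (regularized_grad u' v').2)
  <= Lb ^+ 2 * (dot (u - u') (u - u') + dot (v - v') (v - v')).
Proof.
have -> : (regularized_grad u v).1 - (regularized_grad u' v').1
   = ((Fg u v).1 - (Fg u' v').1) + (2 * L) *: (u - u').
  by rewrite /=; apply/rowP => i; rewrite !mxE; ring.
have -> : (regularized_grad u v).2 - (regularized_grad u' v').2
   = ((Fg u v).2 - (Fg u' v').2) - sv *: (v - v').
  by rewrite /=; move: (eps / (2 * D)) => s; apply/rowP => i; rewrite !mxE; ring.
have -> : Lb = L + (2 * L + sv) by ring.
have s0 := sv_gt0; have l0 := L_gt0.
apply: lipschitz_shift (Fg_lip u v u' v'); rewrite ?(ltW L_gt0) //.
  by apply/andP; split; lra.
by apply/andP; split; lra.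
Qed.

Lemma regularized_shift_lip u v u' v' :
  dot ((regularized_grad u v).1 - (regularized_grad u' v').1 - (L / 2) *: (u - u'))
      ((regularized_grad u v).1 - (regularized_grad u' v').1 - (L / 2) *: (u - u'))
  + dot ((regularized_grad u v).2 - (regularized_grad u' v').2 - (L / 8) *: (v - v'))
        ((regularized_grad u v).2 - (regularized_grad u' v').2 - (L / 8) *: (v - v'))
  <= (Lb + L / 8) ^+ 2 * (dot (u - u') (u - u') + dot (v - v') (v - v')).
Proof.
have -> : (regularized_grad u v).1 - (regularized_grad u' v').1 - (L / 2) *: (u - u')
   = ((Fg u v).1 - (Fg u' v').1) + (3 / 2 * L) *: (u - u').
  by rewrite /=; apply/rowP => i; rewrite !mxE; field.
have -> : (regularized_grad u v).2 - (regularized_grad u' v').2 - (L / 8) *: (v - v')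
   = ((Fg u v).2 - (Fg u' v').2) - (sv + L / 8) *: (v - v').
  by rewrite /=; move: (eps / (2 * D)) => s; apply/rowP => i; rewrite !mxE; ring.
have -> : Lb + L / 8 = L + (2 * L + sv + L / 8) by ring.
have s0 := sv_gt0; have l0 := L_gt0.
apply: lipschitz_shift (Fg_lip u v u' v'); rewrite ?(ltW L_gt0) //.
  by apply/andP; split; lra.
by apply/andP; split; lra.
Qed.

Definition lyapunov_bound : R :=
  lyapunov_start_bound L sv Du2 (D ^+ 2) (lower - sv / 2 * D ^+ 2) (upper + L * Du2).

Lemma subproblem_run vk tau N : Kv vk -> 0 <= tau -> (0 < N)%N ->
  residual_coef L sv Lb * ((1 - alpha_bar L sv / 2) ^+ N * lyapunov_bound) <= tau ^+ 2 ->
  exists w c, [/\ method_S (gradh_k gradh L D eps v0 uk) proxp proxq L sv Lb tau (- (L *: uk)) vk w c,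
     stationary_within Ku Kv p q regularized_grad tau w &
     within (N%:R * ((31 * (1 + 8 * Lb / L) + 4) * a)) c].
Proof.
move=> Kvk tau0 N0 hN.
apply: (method_S_converges regularized_gradP proxpP proxqP Pp_sub Pq_sub p_cc q_cc
  L_gt0 sv_gt0 Lb_ge sv_le regularized_convex regularized_concave regularized_lip
  regularized_shift_lip round_within tau0 Kvk _ _ _ Kub _ N0 hN).
- by move=> u Kuu; exact: Ku_diam.
- by move=> v Kvv; exact: Kv_diam.
- move=> u Kuu; rewrite /regularized.
  have := saddle_low Kuu Kvk.
  have := mulr_ge0 (ltW L_gt0) (dot_ge0 (u - uk)).
  have := ler_wpM2l (ltW sv_gt0) (Kv_diam Kvk Kv0); lra.
- move=> v Kvv; rewrite /regularized.
  have := saddle_up Kvv.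
  have := mulr_ge0 (ltW sv_gt0) (dot_ge0 (v - v0)).
  have := ler_wpM2l (ltW L_gt0) (Ku_diam Kub Kuk); lra.
Qed.

Definition smoothed_value (u : U) (v : V) : R := h u v + p u - q v - sv / 2 * dot (v - v0) (v - v0).

(** Near-stationarity and strong convexity-concavity bound the regularised
    function at (w.1, v) by its value at (uk, w.2) plus the error tau^2 (1/(2L)
    + D/eps); the first-order error terms are absorbed by the quadratic ones.
    The value at (uk, w.2) is at most H, since the regularisation vanishes at
    uk. *)
Lemma subproblem_descent tau w (H : R) :
  0 <= tau ->
  stationary_within Ku Kv p q regularized_grad tau w ->
  (forall v, Kv v -> smoothed_value uk v <= H) ->
  forall v, Kv v -> smoothed_value w.1 v + L * dot (w.1 - uk) (w.1 - uk)
     <= H + tau ^+ 2 * (1 / (2 * L) + D / eps).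
Proof.
move=> tau0 [bu [bv [[Kw1 hu] [Kw2 hv] res]]] hH v Kvv.
set gu := (regularized_grad w.1 w.2).1 + bu in res.
set gv := (regularized_grad w.1 w.2).2 - bv in res.
have := dot_le_sqr res; rewrite dot_row_mx => {}res.
have c1 := regularized_convex Kw1 Kuk Kw2.
have c2 := regularized_concave Kw1 Kw2 Kvv.
have c3 := hu _ Kuk; have c4 := hv _ Kvv.
have c5 := hH _ Kw2.
have i1 : 0 <= L^-1 by rewrite invr_ge0 ltW.
have s1 : 0 <= sv^-1 by rewrite invr_ge0 ltW.
have d1 := mulr_ge0 i1 (dot_ge0 (gu + L *: (uk - w.1))).
have d2 := mulr_ge0 s1 (dot_ge0 (gv - sv *: (v - w.2))).
have e1 : L^-1 * dot (gu + L *: (uk - w.1)) (gu + L *: (uk - w.1))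
   = L^-1 * dot gu gu + 2 * dot gu (uk - w.1) + L * dot (uk - w.1) (uk - w.1).
  move: (uk - w.1) => d; rewrite !dotE; dot_sym; field; by rewrite gt_eqF.
have e2 : sv^-1 * dot (gv - sv *: (v - w.2)) (gv - sv *: (v - w.2))
   = sv^-1 * dot gv gv - 2 * dot gv (v - w.2) + sv * dot (v - w.2) (v - w.2).
  move: (v - w.2) => d; move: sv sv_gt0 => s s0; rewrite !dotE; dot_sym; field; by rewrite !gt_eqF.
rewrite e1 in d1; rewrite e2 in d2.
have t1 : L^-1 * dot gu gu <= L^-1 * tau ^+ 2.
  by rewrite ler_wpM2l //; have := dot_ge0 gv; lra.
have t2 : sv^-1 * dot gv gv <= sv^-1 * tau ^+ 2.
  by rewrite ler_wpM2l //; have := dot_ge0 gu; lra.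
have -> : tau ^+ 2 * (1 / (2 * L) + D / eps) = (L^-1 * tau ^+ 2 + sv^-1 * tau ^+ 2) / 2.
  by field; rewrite !gt_eqF.
have g1 : dot (regularized_grad w.1 w.2).1 (uk - w.1) = dot gu (uk - w.1) - dot bu (uk - w.1).
  by rewrite -dotNl -dotDl /gu addrK.
have g2 : dot (regularized_grad w.1 w.2).2 (v - w.2) = dot gv (v - w.2) + dot bv (v - w.2).
  by rewrite -dotDl /gv subrK.
rewrite g1 in c1; rewrite g2 in c2.
have sq : dot (uk - w.1) (uk - w.1) = dot (w.1 - uk) (w.1 - uk).
  by rewrite !dotE; dot_sym; ring.
move: c1 c2 c3 c4 c5 d1 d2 t1 t2; rewrite /smoothed_value /regularized subrr dot0l mulr0 addr0 sq.
lra.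
Qed.

End OneStep.

Context (u0 : U) (Ku0 : Ku u0) (K : nat) (costk : nat -> R).
Hypothesis value_start : forall v, Kv v -> smoothed_value u0 v <= H0.
Hypothesis value_low : forall u, Ku u -> exists2 v, Kv v & smoothed_lower <= smoothed_value u v.
Hypothesis K_bound : forall k : nat,
  k%:R * (eps ^+ 2 / (16 * L)) <= H0 - smoothed_lower + 2 * eps0 ^+ 2 * (1 / (2 * L) + D / eps) ->
  (k <= K)%N.
Hypothesis costk_ok : forall k : nat, exists N, [/\ (0 < N)%N,
  residual_coef L sv Lb * ((1 - alpha_bar L sv / 2) ^+ N * lyapunov_bound) <= (eps0 / k.+1%:R) ^+ 2 &
  N%:R * ((31 * (1 + 8 * Lb / L) + 4) * a) <= costk k].

Definition method_M_post (w : U * V) : Prop :=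
  exists bu bv, [/\ subgrad Ku p w.1 bu, subgrad Kv q w.2 bv,
    enorm ((Fg w.1 w.2).1 + bu) <= eps, enorm ((Fg w.1 w.2).2 - bv) <= eps &
    forall v, Kv v -> smoothed_value w.1 v <= H0 + 2 * eps0 ^+ 2 * (1 / (2 * L) + D / eps)].

(** Each displacement longer than eps/(4L) lowers the maximum over v of
    [smoothed_value] by eps^2/(16L), up to errors whose sum is at most 2 eps0^2
    (1/(2L) + D/eps); since that maximum is bounded from below, at most K
    displacements are long. After a short one, removing the regularisation from
    the stationarity condition costs eps/2 in each block, and the tolerance of
    the subproblem is at most the other half. *)
Lemma method_M_run : exists w c,
  [/\ method_M gradh proxp proxq L D eps eps0 v0 u0 w c, method_M_post w &
      within (\sum_(k < K.+1) costk k) c].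
Proof.
have a0 := within_ge0 round_within.
have M0 : 0 <= 31 * (1 + 8 * Lb / L) + 4.
  rewrite addr_ge0 // mulr_ge0 // addr_ge0 // divr_ge0 ?(ltW L_gt0) // mulr_ge0 //.
  by apply: le_trans Lb_ge; rewrite mulr_ge0 // ltW.
have cost0 k : 0 <= costk k.
  have [N [_ _ hN]] := costk_ok k; apply: le_trans hN.
  by rewrite !mulr_ge0.
pose S k : R := \sum_(i < k) ((i.+1)%:R : R) ^- 2.
pose c1 : R := 1 / (2 * L) + D / eps.
have c10 : 0 <= c1 by rewrite /c1 addr_ge0 // divr_ge0 ?mulr_ge0 // ltW.
have e20 : 0 <= eps0 ^+ 2 * c1 by rewrite mulr_ge0 ?sqr_ge0.
have S2 k : eps0 ^+ 2 * c1 * S k <= 2 * eps0 ^+ 2 * c1.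
  by have := ler_wpM2l e20 (sum_inv_sqr_le2 R k); rewrite -/(S k); lra.
pose Inv (k : nat) (w : nat * U * V) := [/\ w.1.1 = k, Ku w.1.2, Kv w.2 &
  forall v, Kv v -> smoothed_value w.1.2 v + k%:R * (eps ^+ 2 / (16 * L))
    <= H0 + eps0 ^+ 2 * c1 * S k].
apply: (loop_within (Inv := Inv) cost0); last first.
  split=> //= v Kvv; rewrite mul0r addr0 /S big_ord0 mulr0 addr0; exact: value_start.
move=> k [[k' uk] vk] [/= -> Kuk Kvk hvalue]; split.
  rewrite ltnS; apply: K_bound.
  have [v Kvv hv] := value_low Kuk.
  have := hvalue _ Kvv; have := S2 k; rewrite -/c1; lra.
have [N [N0 hN cN]] := costk_ok k.
have k0 : 0 < (k.+1)%:R :> R by [].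
have tau0 : 0 <= eps0 / k.+1%:R by rewrite divr_ge0 // ltW.
have [w [c [hS post wc]]] := subproblem_run Kuk Kvk tau0 N0 hN.
have wcost : within (costk k) (add_calls c no_calls) by rewrite add_calls0; exact: within_le cN.
have hvalue' v : Kv v ->
    smoothed_value uk v <= H0 + eps0 ^+ 2 * c1 * S k - k%:R * (eps ^+ 2 / (16 * L)).
  by move=> Kvv; have := hvalue _ Kvv; lra.
have desc := subproblem_descent Kuk tau0 post hvalue'.
rewrite -/c1 in desc.
have SS : (eps0 / k.+1%:R) ^+ 2 * c1 + eps0 ^+ 2 * c1 * S k = eps0 ^+ 2 * c1 * S k.+1.
  by rewrite /S big_ord_recr /= exprMn exprVn; ring.
have stepE (r : nat * U * V + U * V) :
  (if enorm (w.1 - uk) <= eps / (4 * L) then ret (inr w) else ret (inl (k.+1, w.1, w.2))) r no_calls ->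
  M_step gradh proxp proxq L D eps eps0 v0 (k, uk, vk) r (add_calls c no_calls).
  by move=> hr; apply: bind_intro hS _.
have [bu [bv [sbu sbv res]]] := post.
have el : 0 < eps / (4 * L) by rewrite divr_gt0 // mulr_gt0.
have [stop|nstop] := boolP (enorm (w.1 - uk) <= eps / (4 * L)); last first.
  exists (inl (k.+1, w.1, w.2)), (add_calls c no_calls); split=> //.
    by apply: stepE; rewrite (negbTE nstop).
  split=> //=; [exact: sbu.1|exact: sbv.1|].
  move=> v Kvv; have := desc _ Kvv.
  rewrite -ltNge in nstop.
  have : eps ^+ 2 / (16 * L) <= L * dot (w.1 - uk) (w.1 - uk).
    have -> : eps ^+ 2 / (16 * L) = L * (eps / (4 * L)) ^+ 2 by field; rewrite gt_eqF.
    rewrite ler_pM2l // -enorm_sqr lerXn2r ?nnegrE ?enorm_ge0 ?(ltW el) //; exact: ltW.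
  have -> : k.+1%:R * (eps ^+ 2 / (16 * L))
     = k%:R * (eps ^+ 2 / (16 * L)) + eps ^+ 2 / (16 * L) by rewrite -natr1 mulrDl mul1r.
  rewrite -SS; move: (eps ^+ 2 / (16 * L)) ((eps0 / _) ^+ 2 * c1) (_ * S k) (k%:R) => x1 x2 x3 x4; lra.
exists (inr w), (add_calls c no_calls); split=> //.
  by apply: stepE; rewrite stop.
have taule : eps0 / k.+1%:R <= eps / 2.
  apply: le_trans eps0_le; rewrite ler_pdivrMr // ler_peMr ?(ltW eps0_gt0) //.
  by rewrite ler1n.
have res1 : enorm ((regularized_grad uk w.1 w.2).1 + bu) <= eps / 2.
  apply: le_trans taule; apply: le_trans res.
  have := enorm_lsub (row_mx ((regularized_grad uk w.1 w.2).1 + bu)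
                             ((regularized_grad uk w.1 w.2).2 - bv)).
  by rewrite row_mxKl.
have res2 : enorm ((regularized_grad uk w.1 w.2).2 - bv) <= eps / 2.
  apply: le_trans taule; apply: le_trans res.
  have := enorm_rsub (row_mx ((regularized_grad uk w.1 w.2).1 + bu)
                             ((regularized_grad uk w.1 w.2).2 - bv)).
  by rewrite row_mxKr.
exists bu, bv; split=> //.
- have -> : (Fg w.1 w.2).1 + bu = ((regularized_grad uk w.1 w.2).1 + bu) - (2 * L) *: (w.1 - uk).
    by rewrite /=; apply/rowP => i; rewrite !mxE; ring.
  apply: le_trans (enormD _ _) _; rewrite enormN enormZ ?mulr_ge0 ?(ltW L_gt0) //.
  have : 2 * L * enorm (w.1 - uk) <= 2 * L * (eps / (4 * L)) by rewrite ler_pM2l ?mulr_gt0.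
  have -> : 2 * L * (eps / (4 * L)) = eps / 2 by field; rewrite gt_eqF.
  by move: res1; lra.
- have -> : (Fg w.1 w.2).2 - bv = ((regularized_grad uk w.1 w.2).2 - bv) + sv *: (w.2 - v0).
    by rewrite /=; move: (eps / (2 * D)) => s; apply/rowP => i; rewrite !mxE; ring.
  apply: le_trans (enormD _ _) _; rewrite (enormZ _ (ltW sv_gt0)).
  have dv : enorm (w.2 - v0) <= D by apply: enorm_le; [exact: ltW|exact: Kv_diam sbv.1 Kv0].
  have : sv * enorm (w.2 - v0) <= sv * D by rewrite ler_pM2l.
  have -> : sv * D = eps / 2 by field; rewrite gt_eqF.
  by move: res2; lra.
- move=> v Kvv; have := desc _ Kvv; rewrite -/c1.
  have := mulr_ge0 (ltW L_gt0) (dot_ge0 (w.1 - uk)).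
  have : 0 <= k%:R * (eps ^+ 2 / (16 * L)) by rewrite mulr_ge0 // divr_ge0 ?sqr_ge0 // mulr_ge0 // ltW.
  have := S2 k.+1; rewrite -SS.
  move: ((eps0 / _) ^+ 2 * c1) (_ * S k) (k%:R * _) (L * _) (2 * _ * c1) => x1 x2 x3 x4 x5; lra.
Qed.

End ProximalPointMethod.

(** * The penalty problem *)

Section Glue.
Context (R : realType).

Lemma compact_fine_bounded (T : ptopologicalType) (K : set T) (g : T -> \bar R) :
  K !=set0 -> compact K -> {within K, continuous g} ->
  (forall x, K x -> g x \is a fin_num) ->
  has_lbound [set fine (g x) | x in K] /\ has_ubound [set fine (g x) | x in K].
Proof.
move=> K0 cK /subspace_continuousP gK fin.
have lsc1 : lsc_on K (fine \o g).
  move=> x a Kx /= ax.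
  have agx : (a%:E < g x)%E by rewrite -[g x]fineK ?fin // lte_fin.
  have := gK x Kx _ (open_ereal_gt_ereal agx); rewrite /within /= => h.
  have {}h : \forall y \near x, K y -> (a%:E < g y)%E := h.
  apply: filterS h => y h Ky; have := h Ky.
  by rewrite -[g y]fineK ?fin // lte_fin.
have lsc2 : lsc_on K (fun x => - fine (g x)).
  move=> x a Kx /= ax.
  have agx : (g x < (- a)%:E)%E by rewrite -[g x]fineK ?fin // lte_fin ltrNr.
  have := gK x Kx _ (open_ereal_lt_ereal agx); rewrite /within /= => h.
  have {}h : \forall y \near x, K y -> (g y < (- a)%:E)%E := h.
  apply: filterS h => y h Ky; have := h Ky.
  by rewrite -[g y]fineK ?fin // lte_fin ltrNr.
have [x1 _ h1] := lsc_compact_min K0 cK lsc1.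
have [x2 _ h2] := lsc_compact_min K0 cK lsc2.
split; first by exists (fine (g x1)) => _ [x Kx <-]; exact: h1.
by exists (fine (g x2)) => _ [x Kx <-]; rewrite -lerN2; exact: h2.
Qed.

Lemma closed_convex_scale k (K : set 'rV[R]_k) phi c :
  0 < c -> closed_convex_on K phi -> closed_convex_on K (fun x => c * phi x).
Proof.
move=> c0 [K0 cK lphi vphi]; split=> //.
- move=> x a Kx ax; have : a / c < phi x by rewrite ltr_pdivrMr // mulrC.
  move=> /(lphi _ _ Kx); apply: filterS => y h Ky.
  by have := h Ky; rewrite ltr_pdivrMr // mulrC.
- move=> x y t Kx Ky t01; have [h1 h2] := vphi _ _ _ Kx Ky t01; split=> //.
  by rewrite -(ler_pM2l c0) in h2; lra.
Qed.

Lemma enorm_le_diam k (A : set 'rV[R]_k) x y :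
  compact A -> A x -> A y -> enorm (x - y) <= diam A.
Proof.
move=> cA Ax Ay; have [c hc] := compact_enorm_bounded cA.
apply: ub_le_sup; last by exists (x, y).
exists (c + c) => _ [[x' y'] [/= Ax' Ay'] <-].
by apply: le_trans (enormD _ _) _; rewrite enormN lerD ?hc.
Qed.

Lemma diam_gt0_witness k (A : set 'rV[R]_k) : 0 < diam A ->
  exists x y, [/\ A x, A y & 0 < enorm (x - y)].
Proof.
move=> d0.
have [[x0 Ax0]|A0] := pselect (A !=set0); last first.
  move: d0; rewrite /diam (_ : [set _ | _ in _] = set0) ?sup0 ?ltxx //.
  by apply/seteqP; split => // _ [[x y] [/= Ax _] _]; case: A0; exists x.
have [] := sup_gt _ d0; first by exists (enorm (x0 - x0)), (x0, x0).
by move=> _ [[x y] [/= Ax Ay] <-] h; exists x, y.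
Qed.

Lemma first_order_snd n m (g : 'rV[R]_n -> 'rV[R]_m -> R) x y s :
  first_order (joint g) (row_mx x y) s -> first_order (g x) y (rsubmx s).
Proof.
move=> fo e e0; have /nbhs_normP[r /= r0 hr] := fo e e0.
apply/nbhs_normP; exists r => // d /=; rewrite sub0r normrN => dr.
have nd : `|row_mx (0 : 'rV[R]_n) d| <= `|d|.
  apply: mx_norm_le => // i; rewrite -[i]splitK; case: (fintype.split i) => j /=.
    by rewrite row_mxEl mxE normr0.
  by rewrite row_mxEr mx_norm_entry.
have := hr (row_mx 0 d); rewrite /= sub0r normrN => /(_ (le_lt_trans nd dr)).
rewrite add_row_mx addr0 /joint !row_mxKl !row_mxKr -{1}[s]hsubmxK dot_row_mx dot0r add0r.
by move=> h; apply: le_trans h _; rewrite ler_pM2l.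
Qed.

Lemma lipschitz_ge0 k (L : R) (G : 'rV[R]_k -> 'rV[R]_k) (d : 'rV[R]_k) :
  lipschitz_map L setT G -> 0 < enorm d -> 0 <= L.
Proof.
move=> lip d0; have := lip d 0 I I; rewrite subr0 => h.
by rewrite -(pmulr_lge0 _ d0) (le_trans _ h) ?enorm_ge0.
Qed.

End Glue.

Section PenaltyProblem.
Context (R : realType) (n m : nat) (B : bilevel R n m) (L1 L2 eps : R).
Context (G1 G2 : 'rV[R]_(n + m) -> 'rV[R]_(n + m)).
Hypothesis f2_pcc : proper_closed_convex (f2 B).
Hypothesis ft2_pcc : proper_closed_convex (ft2 B).
Hypothesis ft1_convex : forall x, X B x -> convex_function setT (ft1 B x).
Hypothesis f1_smooth : smooth_on L1 (XY B) (joint (f1 B)).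
Hypothesis ft1_smooth : smooth_on L2 (XY B) (joint (ft1 B)).
Hypothesis X_compact : compact (X B).
Hypothesis Y_compact : compact (Y B).
Hypothesis G1_oracle : gradient_oracle L1 (XY B) (joint (f1 B)) G1.
Hypothesis G2_oracle : gradient_oracle L2 (XY B) (joint (ft1 B)) G2.
Hypothesis eps_gt0 : 0 < eps.
Hypothesis L1_ge0 : 0 <= L1.
Hypothesis L2_ge0 : 0 <= L2.

Local Notation U := 'rV[R]_(n + m).
Local Notation V := 'rV[R]_m.
Local Notation rh := (rho eps).
Local Notation L := (L_hat L1 L2 eps).

Lemma rho_gt0 : 0 < rh. Proof. by rewrite invr_gt0. Qed.

Definition f2_fine (x : 'rV[R]_n) : R := fine (f2 B x).
Definition ft2_fine (y : 'rV[R]_m) : R := fine (ft2 B y).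

Lemma f2E x : X B x -> f2 B x = (f2_fine x)%:E.
Proof.
move=> Xx; have [[pNy _] _ _] := f2_pcc.
by rewrite /f2_fine fineK // fin_numE gt_eqF // lt_eqF.
Qed.

Lemma f2N x : ~ X B x -> f2 B x = +oo%E.
Proof. by move=> nX; apply/eqP; rewrite -leye_eq leNgt; apply/negP. Qed.

Lemma ft2E y : Y B y -> ft2 B y = (ft2_fine y)%:E.
Proof.
move=> Yy; have [[pNy _] _ _] := ft2_pcc.
by rewrite /ft2_fine fineK // fin_numE gt_eqF // lt_eqF.
Qed.

Lemma ft2N y : ~ Y B y -> ft2 B y = +oo%E.
Proof. by move=> nY; apply/eqP; rewrite -leye_eq leNgt; apply/negP. Qed.

Definition pen_p_fine (u : U) : R := f2_fine (lsubmx u) + rh * ft2_fine (rsubmx u).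
Definition pen_q_fine (z : V) : R := rh * ft2_fine z.

Lemma pen_p_closed_convex : closed_convex_on (XY B) pen_p_fine.
Proof.
exact: (closed_convex_row_prod rho_gt0 (closed_convex_fine f2_pcc X_compact)
  (closed_convex_fine ft2_pcc Y_compact)).
Qed.

Lemma pen_q_closed_convex : closed_convex_on (Y B) pen_q_fine.
Proof. exact: (closed_convex_scale rho_gt0 (closed_convex_fine ft2_pcc Y_compact)). Qed.

Lemma pen_p_prox_subgrad c u : 0 < c ->
  subgrad (XY B) pen_p_fine (prox (fun u' => c%:E * pen_p B eps u')%E u)
    (c^-1 *: (u - prox (fun u' => c%:E * pen_p B eps u')%E u)).
Proof.
move=> c0; apply: prox_subgrad pen_p_closed_convex c0 _ _ => {}u; rewrite /pen_p.
  by move=> [Xu Yu]; rewrite f2E // ft2E // EFinD EFinM.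
move=> nXY; have r0 := rho_gt0.
have [Xu|nX] := pselect (X B (lsubmx u)).
  have nY : ~ Y B (rsubmx u) by move=> Yu; apply: nXY.
  by rewrite f2E // ft2N // gt0_muley // addey.
rewrite f2N // addye //.
have [[pNy _] _ _] := ft2_pcc.
have [Yu|nY] := pselect (Y B (rsubmx u)); first by rewrite ft2E // -EFinM.
by rewrite ft2N // gt0_muley.
Qed.

Lemma pen_q_prox_subgrad c z : 0 < c ->
  subgrad (Y B) pen_q_fine (prox (fun z' => c%:E * pen_q B eps z')%E z)
    (c^-1 *: (z - prox (fun z' => c%:E * pen_q B eps z')%E z)).
Proof.
move=> c0; apply: prox_subgrad pen_q_closed_convex c0 _ _ => {}z; rewrite /pen_q.
  by move=> Yz; rewrite ft2E // EFinM.
by move=> nY; rewrite ft2N // !gt0_muley // lte_fin rho_gt0.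
Qed.

Definition pen_h (u : U) (z : V) : R :=
  joint (f1 B) u + rh * joint (ft1 B) u - rh * ft1 B (lsubmx u) z.

Definition pen_gradient (u : U) (z : V) : U * V :=
  let c := G2 (row_mx (lsubmx u) z) in
  (G1 u + rh *: G2 u - rh *: row_mx (lsubmx c) 0, - (rh *: rsubmx c)).

Lemma pen_gradhP u z : pen_gradh eps G1 G2 u z (pen_gradient u z) (Calls 1 2 0 0).
Proof.
rewrite (_ : Calls 1 2 0 0 = add_calls (Calls 1 0 0 0) (add_calls (Calls 0 1 0 0)
   (add_calls (Calls 0 1 0 0) no_calls))) //.
do 3 (apply: bind_intro; first by split).
by split.
Qed.

Lemma segment_in u u' (t : R) : XY B u -> XY B u' -> 0 <= t <= 1 -> XY B (u + t *: (u' - u)).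
Proof.
move=> Ku Ku' t01; have [+ _] := cco_convex pen_p_closed_convex Ku' Ku t01.
by congr (XY B _); apply/rowP => i; rewrite !mxE; ring.
Qed.

(** The three terms f1, rho ft1 and - rho ft1(.,z) contribute L1, rho L2 and
    rho L2 to the constant; the last one is bounded through the upper quadratic
    bound of ft1 at (x,z). *)
Lemma pen_weak_convex u u' z : XY B u -> XY B u' -> Y B z ->
  pen_h u z + dot (pen_gradient u z).1 (u' - u) - L / 2 * dot (u' - u) (u' - u) <= pen_h u' z.
Proof.
move=> Ku Ku' Yz.
have K1 : XY B (row_mx (lsubmx u) z) by rewrite /XY /= row_mxKl row_mxKr; split=> //; exact: Ku.1.
have K2 : XY B (row_mx (lsubmx u') z) by rewrite /XY /= row_mxKl row_mxKr; split=> //; exact: Ku'.1.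
have b1 := smooth_quadratic_bound true f1_smooth (fun t => segment_in Ku Ku').
have b2 := smooth_quadratic_bound true ft1_smooth (fun t => segment_in Ku Ku').
have b3 := smooth_quadratic_bound false ft1_smooth (fun t => segment_in K1 K2).
rewrite expr1 in b1; rewrite expr1 in b2; rewrite expr0 in b3.
rewrite -(G1_oracle.1 _ Ku) in b1; rewrite -(G2_oracle.1 _ Ku) in b2.
rewrite -(G2_oracle.1 _ K1) in b3.
have jE x : joint (ft1 B) (row_mx (lsubmx x) z) = ft1 B (lsubmx x) z.
  by rewrite /joint row_mxKl row_mxKr.
rewrite !jE sub_row_mx subrr dot_row_mx dot0r addr0 in b3.
rewrite (dot_split _ (row_mx _ _)) row_mxKl row_mxKr dot0r addr0 in b3.
have lB : lsubmx u' - lsubmx u = lsubmx (u' - u) by rewrite linearB.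
rewrite lB in b3.
have dl : dot (lsubmx (u' - u)) (lsubmx (u' - u)) <= dot (u' - u) (u' - u).
  by rewrite (dot_split (u' - u)) lerDl dot_ge0.
have r0 := rho_gt0.
have {}b2 := ler_wpM2l (ltW r0) b2; have {}b3 := ler_wpM2l (ltW r0) b3.
have dl' := ler_wpM2l (mulr_ge0 (ltW r0) L2_ge0) dl.
rewrite /pen_h /pen_gradient /=; set c := G2 (row_mx _ _) in b3 *.
rewrite dotDl dotDl dotNl !dotZl (dot_split (row_mx _ _)) row_mxKl row_mxKr dot0l addr0.
have LE : L = L1 + 2 * rh * L2 by [].
rewrite LE; lra.
Qed.

Lemma pen_concave u z z' : XY B u -> Y B z -> Y B z' ->
  pen_h u z' <= pen_h u z + dot (pen_gradient u z).2 (z' - z).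
Proof.
move=> Ku Yz Yz'.
have K1 : XY B (row_mx (lsubmx u) z) by rewrite /XY /= row_mxKl row_mxKr; split=> //; exact: Ku.1.
have := convex_gradient_inequality (y := z) z' (ft1_convex Ku.1) (ft1_smooth.1 _ K1).
rewrite -(G2_oracle.1 _ K1) -(ler_pM2l rho_gt0) mulrDr.
by rewrite /pen_h /pen_gradient /= dotNl dotZl; lra.
Qed.

Lemma pen_lip u z u' z' :
  dot ((pen_gradient u z).1 - (pen_gradient u' z').1) ((pen_gradient u z).1 - (pen_gradient u' z').1)
  + dot ((pen_gradient u z).2 - (pen_gradient u' z').2) ((pen_gradient u z).2 - (pen_gradient u' z').2)
  <= L ^+ 2 * (dot (u - u') (u - u') + dot (z - z') (z - z')).
Proof.
have r0 := rho_gt0.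
pose d := enorm (row_mx (u - u') (z - z')).
have d0 : 0 <= d by exact: enorm_ge0.
have du : enorm (u - u') <= d.
  by have := enorm_lsub (row_mx (u - u') (z - z')); rewrite row_mxKl.
pose c := G2 (row_mx (lsubmx u) z); pose c' := G2 (row_mx (lsubmx u') z').
have dx : enorm (row_mx (lsubmx u) z - row_mx (lsubmx u') z') <= d.
  rewrite sub_row_mx; apply: enorm_le => //; rewrite /d enorm_sqr !dot_row_mx lerD2r.
  rewrite (dot_split (u - u')) lsubmxB.
  by rewrite lerDl dot_ge0.
have n1 : enorm (G1 u - G1 u') <= L1 * d.
  by apply: le_trans (G1_oracle.2 _ _ I I) _; rewrite ler_wpM2l.
have n2 : enorm (G2 u - G2 u') <= L2 * d.
  by apply: le_trans (G2_oracle.2 _ _ I I) _; rewrite ler_wpM2l.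
have n3 : enorm (c - c') <= L2 * d.
  by apply: le_trans (G2_oracle.2 _ _ I I) _; rewrite ler_wpM2l.
have E : row_mx ((pen_gradient u z).1 - (pen_gradient u' z').1)
                ((pen_gradient u z).2 - (pen_gradient u' z').2)
  = row_mx (G1 u - G1 u') 0 + rh *: row_mx (G2 u - G2 u') 0
    - rh *: row_mx (row_mx (lsubmx (c - c')) 0) (rsubmx (c - c')).
  rewrite !scale_row_mx !add_row_mx sub_row_mx /pen_gradient /= -/c -/c'; congr row_mx.
    rewrite lsubmxB.
    have -> : row_mx (rh *: (lsubmx c - lsubmx c')) (rh *: (0 : V))
       = rh *: (row_mx (lsubmx c) 0 - row_mx (lsubmx c') 0).
      by rewrite sub_row_mx subrr scale_row_mx.
    by move: (row_mx (lsubmx c) 0) (row_mx (lsubmx c') 0) => x x'; apply/rowP => i; rewrite !mxE; ring.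
  rewrite rsubmxB.
  by apply/rowP => i; rewrite !mxE; ring.
have bound : enorm (row_mx ((pen_gradient u z).1 - (pen_gradient u' z').1)
                           ((pen_gradient u z).2 - (pen_gradient u' z').2)) <= L * d.
  have LE : L = L1 + 2 * rh * L2 by [].
  rewrite E; apply: le_trans (enormD _ _) _; rewrite enormN (enormZ _ (ltW r0)).
  have := enormD (row_mx (G1 u - G1 u') (0 : V)) (rh *: row_mx (G2 u - G2 u') 0).
  rewrite (enormZ _ (ltW r0)) !enorm_row_mx0.
  have -> : enorm (row_mx (row_mx (lsubmx (c - c')) (0 : V)) (rsubmx (c - c'))) = enorm (c - c').
    by rewrite /enorm !dot_row_mx dot0l addr0 -dot_split.
  have := ler_wpM2l (ltW r0) n2; have := ler_wpM2l (ltW r0) n3.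
  by rewrite LE; lra.
by have := dot_le_sqr bound; rewrite dot_row_mx exprMn /d enorm_sqr dot_row_mx.
Qed.

Lemma pen_round_within :
  within (4 : R) (round_calls (Calls 1 2 0 0) (Calls 0 0 1 1) (Calls 0 0 0 1)).
Proof. by split; rewrite /= (ler_nat R _ 4). Qed.

Lemma XY_diam u u' : XY B u -> XY B u' ->
  dot (u - u') (u - u') <= D_x B ^+ 2 + D_y B ^+ 2.
Proof.
move=> [Xu Yu] [Xu' Yu']; rewrite dot_split.
rewrite lsubmxB.
rewrite rsubmxB.
by apply: lerD; apply: dot_le_sqr; exact: enorm_le_diam.
Qed.

Lemma Y_diam z z' : Y B z -> Y B z' -> dot (z - z') (z - z') <= D_y B ^+ 2.
Proof. by move=> Yz Yz'; apply: dot_le_sqr; exact: enorm_le_diam. Qed.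

Lemma joint_fE u : XY B u -> joint (f B) u = (joint (f1 B) u + f2_fine (lsubmx u))%:E.
Proof. by move=> [Xu Yu]; rewrite /joint /f f2E // EFinD. Qed.

Lemma joint_ftE u : XY B u -> joint (ft B) u = (joint (ft1 B) u + ft2_fine (rsubmx u))%:E.
Proof. by move=> [Xu Yu]; rewrite /joint /ft ft2E // EFinD. Qed.

Lemma pen_subdifferential_f u bu : subgrad (XY B) pen_p_fine u bu ->
  subdifferential (joint (f B)) u (G1 u + row_mx (lsubmx bu) 0).
Proof.
move=> [Ku hb]; rewrite (G1_oracle.1 _ Ku).
apply: (@subdifferential_sum _ _ (joint (f1 B)) (fun w => f2 B (lsubmx w))
   (fun w => X B (lsubmx w)) (fun w => f2_fine (lsubmx w))).
- exact: differentiable_first_order (f1_smooth.1 _ Ku).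
- by move=> w; exact: f2E.
- by move=> w; exact: f2N.
split; first exact: Ku.1.
move=> w Xw; have := hb (row_mx (lsubmx w) (rsubmx u)).
rewrite /XY /pen_p_fine /= row_mxKl row_mxKr => /(_ (conj Xw Ku.2)).
rewrite (dot_split bu) (dot_split (row_mx _ _)) row_mxKl row_mxKr dot0l addr0.
have E1 : lsubmx (row_mx (lsubmx w) (rsubmx u) - u) = lsubmx (w - u).
  by rewrite !linearB /= row_mxKl.
have E2 : rsubmx (row_mx (lsubmx w) (rsubmx u) - u) = 0.
  by rewrite !linearB /= row_mxKr subrr.
by rewrite E1 E2 dot0r addr0; lra.
Qed.

Lemma pen_subdifferential_ft u bu : subgrad (XY B) pen_p_fine u bu ->
  subdifferential (joint (ft B)) u (G2 u + row_mx 0 (rh^-1 *: rsubmx bu)).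
Proof.
move=> [Ku hb]; rewrite (G2_oracle.1 _ Ku).
apply: (@subdifferential_sum _ _ (joint (ft1 B)) (fun w => ft2 B (rsubmx w))
   (fun w => Y B (rsubmx w)) (fun w => ft2_fine (rsubmx w))).
- exact: differentiable_first_order (ft1_smooth.1 _ Ku).
- by move=> w; exact: ft2E.
- by move=> w; exact: ft2N.
split; first exact: Ku.2.
move=> w Yw; have := hb (row_mx (lsubmx u) (rsubmx w)).
rewrite /XY /pen_p_fine /= row_mxKl row_mxKr => /(_ (conj Ku.1 Yw)).
rewrite (dot_split bu) (dot_split (row_mx _ _)) row_mxKl row_mxKr dot0l add0r.
have E1 : lsubmx (row_mx (lsubmx u) (rsubmx w) - u) = 0.
  by rewrite !linearB /= row_mxKl subrr.
have E2 : rsubmx (row_mx (lsubmx u) (rsubmx w) - u) = rsubmx (w - u).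
  by rewrite !linearB /= row_mxKr.
rewrite E1 E2 dot0r add0r dotZl => h.
have r0 := rho_gt0.
rewrite -(ler_pM2l r0) mulrDr mulrA mulfV ?gt_eqF // mul1r; lra.
Qed.

Lemma pen_subdifferential_z x z bv : X B x -> subgrad (Y B) pen_q_fine z bv ->
  subdifferential (ft B x) z (rsubmx (G2 (row_mx x z)) + rh^-1 *: bv).
Proof.
move=> Xx [Yz hb].
have K1 : XY B (row_mx x z) by rewrite /XY /= row_mxKl row_mxKr.
rewrite (G2_oracle.1 _ K1).
apply: (@subdifferential_sum _ _ (ft1 B x) (ft2 B) (Y B) ft2_fine).
- exact: first_order_snd (differentiable_first_order (ft1_smooth.1 _ K1)).
- exact: ft2E.
- exact: ft2N.
split=> // w Yw; have := hb _ Yw; rewrite /pen_q_fine dotZl => h.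
have r0 := rho_gt0.
by rewrite -(ler_pM2l r0) mulrDr mulrA mulfV ?gt_eqF // mul1r.
Qed.

End PenaltyProblem.

(** * The complexity constants *)

Section Counting.
Context (R : realType).

Lemma sum_ln_le (K : nat) : \sum_(k < K.+1) ln ((k.+1)%:R : R) <= K%:R * ln ((K.+1)%:R : R).
Proof.
rewrite big_ord_recl /= ln1 add0r.
apply: (@le_trans _ _ (\sum_(i < K) ln ((K.+1)%:R : R))).
  apply: ler_sum => i _; rewrite ler_ln ?posrE //.
  by rewrite ler_nat /bump /= add1n ltnS ltn_ord.
by rewrite sumr_const card_ord mulr_natl.
Qed.

Lemma pos_part_ln_scale (x : R) (c j : R) : 0 < c -> 1 <= j ->
  pos_part (ln (c * x * j ^+ 2)) <= pos_part (ln x) + 2 * ln j + pos_part (c - 1).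
Proof.
move=> c0 j1.
have lj : 0 <= ln j by rewrite ln_ge0.
have pp (t : R) : 0 <= pos_part t by rewrite /pos_part le_max lexx orbT.
have tp (t : R) : t <= pos_part t by rewrite /pos_part le_max lexx.
rewrite {1}/pos_part ge_max; apply/andP; split; last by rewrite !addr_ge0 ?mulr_ge0.
have j0 : 0 < j by apply: lt_le_trans j1.
have [x0|x0] := lerP x 0.
  rewrite ln0; last by rewrite mulr_le0_ge0 ?sqr_ge0 // mulr_ge0_le0 // ltW.
  by rewrite !addr_ge0 ?mulr_ge0.
rewrite lnM ?posrE ?mulr_gt0 ?exprn_gt0 // lnM ?posrE // lnXn // -mulr_natl.
have : ln c <= c - 1.
  by have := @le_ln1Dx R (c - 1); rewrite [1 + (c - 1)]addrC subrK; apply; lra.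
have := tp (ln x); have := tp (c - 1); lra.
Qed.

Lemma powR_3half (e : R) : 0 < e -> (e `^ (3 / 2)) ^+ 2 = e ^+ 3.
Proof.
move=> e0; rewrite -powR_mulrn ?powR_ge0 // -powRrM.
by rewrite (_ : 3 / 2 * 2 = 3%:R) ?powR_mulrn ?ltW //; field.
Qed.

Lemma alpha_bar_inv (D L eps : R) : 0 < D -> 0 < L -> 0 < eps ->
  2 / alpha_bar L (eps / (2 * D)) = Num.max 2 (Num.sqrt (D * L * eps^-1)).
Proof.
move=> D0 L0 e0; rewrite /alpha_bar.
have xE : 8 * (eps / (2 * D)) / L = 4 * (D * L * eps^-1)^-1.
  by field; rewrite !gt_eqF.
have y0 : 0 < D * L * eps^-1 by rewrite !mulr_gt0 ?invr_gt0.
rewrite xE; move: (D * L * eps^-1) y0 => y y0.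
have s0 : 0 < Num.sqrt y by rewrite sqrtr_gt0.
have sE : Num.sqrt (4 * y^-1) = 2 / Num.sqrt y.
  rewrite sqrtrM // sqrtrV ?(ltW y0) //; congr (_ / _).
  by rewrite (_ : 4 = 2 ^+ 2 :> R) ?sqrtr_sqr ?ger0_norm //; ring.
rewrite sE.
have [h|h] := lerP 1 (2 / Num.sqrt y); have [h'|h'] := lerP 2 (Num.sqrt y).
- have E : Num.sqrt y = 2 by move: h; rewrite ler_pdivlMr // mul1r; lra.
  by rewrite E divr1.
- by rewrite divr1.
- by rewrite invf_div mulrC divfK.
- by move: h; rewrite ltr_pdivrMr // mul1r; lra.
Qed.

Lemma alpha_hatE (D L eps : R) : 0 < D -> 0 < L -> 0 < eps ->
  Num.min 1 (Num.sqrt (4 * eps / (D * L))) = alpha_bar L (eps / (2 * D)).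
Proof.
move=> D0 L0 e0; rewrite /alpha_bar; congr (Num.min _ (Num.sqrt _)).
by field; rewrite !gt_eqF.
Qed.

(** A step of the middle loop takes at most 31 M + 4 rounds, and each round
    four evaluations of the gradient of ft1, the largest of the four counts;
    the claim follows from 124 M + 16 <= 96 sqrt 2 M + 2. *)
Lemma round_cost_le (M : R) : 25 <= M ->
  (31 * M + 4) * 4 <= (Num.ceil (96 * Num.sqrt 2 * M))%:~R + 2.
Proof.
move=> M25; apply: (@le_trans _ _ (96 * Num.sqrt 2 * M + 2)); last by rewrite lerD2r ceil_ge.
have s2 : 14 / 10 <= Num.sqrt 2 :> R.
  by rewrite -(ler_pXn2r (n:=2)) ?nnegrE ?sqrtr_ge0 ?divr_ge0 // sqr_sqrtr //; lra.
have : 14 / 10 * M <= Num.sqrt 2 * M by rewrite ler_wpM2r //; lra.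
lra.
Qed.

End Counting.

Section PenaltyConstants.
Context (R : realType) (n m : nat) (B : bilevel R n m) (L1 L2 fstar eps : R).
Context (x0 : 'rV[R]_n) (y0 : 'rV[R]_m).
Hypothesis D_gt0 : 0 < D_y B.
Hypothesis L_gt0 : 0 < L_hat L1 L2 eps.
Hypothesis eps_gt0 : 0 < eps.

Local Notation D := (D_y B).
Local Notation L := (L_hat L1 L2 eps).
Local Notation sv := (eps / (2 * D)).
Local Notation Lb := (3 * L + eps / (2 * D)).
Local Notation rh := (rho eps).
Local Notation C := (C_hat B L1 L2 fstar eps).
Local Notation K := (K_hat B L1 L2 eps x0 y0).

Definition pen_lower : R := f_low B - rh * (ft_hi B - ft_low B).

(** Up to the factor 49/36 = (7/3)^2 / 2^2 between the bound of [residual_le]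
    and the one that underlies C_hat, the latter is the constant of the middle
    loop divided by the square eps^3 of the initial tolerance. *)
Lemma residual_coef_lyapunov :
  residual_coef L sv Lb * lyapunov_bound L D eps (D_x B ^+ 2 + D_y B ^+ 2) pen_lower fstar
  = 49 / 36 * C * eps ^+ 3.
Proof.
have sv0 : 0 < sv by rewrite divr_gt0 ?mulr_gt0.
have al0 : 0 < alpha_bar L sv by exact: alpha_bar_gt0.
rewrite /residual_coef /lyapunov_bound /lyapunov_start_bound /C_hat /delta_hat.
rewrite /dist_coef /zeta_hat /eta_v /pen_lower /rho.
rewrite /alpha_hat alpha_hatE //.
have min0 : 0 < Num.min L sv by rewrite lt_min L_gt0.
have e1 : 1 / (2 * sv) = D / eps by field; rewrite !gt_eqF.
have e2 : 2 * sv = eps / D by field; rewrite !gt_eqF.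
rewrite e1 e2.
have Lb0 : 0 < Lb by rewrite addr_gt0 // mulr_gt0.
have e3 : (Num.min L sv / Lb ^+ 2)^-1 + Lb = Lb ^+ 2 / Num.min L sv + 3 * L + sv.
  by rewrite invf_div addrA.
rewrite e3.
set Q := Lb ^+ 2 / Num.min L sv + 3 * L + sv.
have Q0 : 0 < Q by rewrite /Q -addrA addr_gt0 // divr_gt0 ?exprn_gt0.
move: al0; move: (alpha_bar L sv) => al al0.
move: (Num.max (1 / (2 * L)) _) => m1; move: (Num.max (eps / D) _) => m2.
move: Q Q0 => Q Q0.
by field; rewrite !gt_eqF.
Qed.

Definition round_bound : R :=
  (Num.ceil (96 * Num.sqrt 2 * (1 + (24 * L + 4 * eps / D) * L^-1)))%:~R + 2.

Definition step_cost (k : nat) : R :=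
  round_bound * (2 / alpha_bar L sv) * (pos_part (ln C) + 1 + 2 * ln (k.+1)%:R).

(** The excess factor 49/36 adds at most 13/36 < 1/2 to the logarithm, and
    rounding up adds one iteration, at most half of 2/alpha; the summand 1 in
    [step_cost] covers both. *)
Lemma step_cost_ok (k : nat) : exists N, [/\ (0 < N)%N,
  residual_coef L sv Lb * ((1 - alpha_bar L sv / 2) ^+ N
    * lyapunov_bound L D eps (D_x B ^+ 2 + D_y B ^+ 2) pen_lower fstar)
    <= (eps `^ (3 / 2) / k.+1%:R) ^+ 2 &
  N%:R * ((31 * (1 + 8 * Lb / L) + 4) * 4) <= step_cost k].
Proof.
have sv0 : 0 < sv by rewrite divr_gt0 ?mulr_gt0.
have al0 : 0 < alpha_bar L sv by exact: alpha_bar_gt0.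
have al1 : alpha_bar L sv <= 1 by exact: alpha_bar_le1.
pose j : R := (k.+1)%:R.
have j1 : 1 <= j by rewrite /j ler1n.
have j0 : 0 < j by apply: lt_le_trans j1.
have al01 : 0 < alpha_bar L sv <= 1 by rewrite al0.
have [N [N0 hN Nle]] := geometric_iterations (49 / 36 * C * j ^+ 2) al01.
have t0 : 0 < eps ^+ 3 / j ^+ 2 by rewrite divr_gt0 ?exprn_gt0.
exists N; split=> //.
  rewrite mulrCA residual_coef_lyapunov expr_div_n powR_3half // -/j.
  have -> : (1 - alpha_bar L sv / 2) ^+ N * (49 / 36 * C * eps ^+ 3)
    = (1 - alpha_bar L sv / 2) ^+ N * (49 / 36 * C * j ^+ 2) * (eps ^+ 3 / j ^+ 2).
    by field; rewrite gt_eqF.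
  by rewrite -[X in _ <= X]mul1r ler_wpM2r // ltW.
have ME : 1 + 8 * Lb / L = 1 + (24 * L + 4 * eps / D) * L^-1.
  by field; rewrite !gt_eqF.
have M25 : 25 <= 1 + (24 * L + 4 * eps / D) * L^-1.
  have : 24 <= (24 * L + 4 * eps / D) * L^-1.
    by rewrite ler_pdivlMr // lerDl divr_ge0 ?mulr_ge0 // ltW.
  lra.
have rb : (31 * (1 + 8 * Lb / L) + 4) * 4 <= round_bound.
  by rewrite ME; exact: round_cost_le M25.
have rb0 : 0 <= (31 * (1 + 8 * Lb / L) + 4) * 4.
  rewrite ME; lra.
have pl : pos_part (ln (49 / 36 * C * j ^+ 2)) <= pos_part (ln C) + 2 * ln j + 13 / 36.
  have c0 : 0 < 49 / 36 :> R by rewrite divr_gt0.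
  apply: le_trans (pos_part_ln_scale C c0 j1) _; rewrite lerD2l /pos_part ge_max.
  by apply/andP; split; lra.
have a2 : 2 <= 2 / alpha_bar L sv by rewrite ler_pdivlMr // ler_piMr.
have NN : N%:R <= 2 / alpha_bar L sv * (pos_part (ln C) + 1 + 2 * ln j).
  apply: le_trans Nle _.
  have := ler_wpM2l (le_trans (ler0n R 2) a2) pl; lra.
have -> : step_cost k
  = 2 / alpha_bar L sv * (pos_part (ln C) + 1 + 2 * ln j) * round_bound.
  by rewrite /step_cost; ring.
by apply: ler_pM.
Qed.

Lemma K_hat_nat : exists K0 : nat, K = K0%:R /\
  forall k : nat, k%:R <= 16 * (1 + fine (f B x0 y0) - f_low B + eps * D_y B / 4) * L * eps ^- 2
            + 32 * (1 + 4 * D_y B ^+ 2 * L ^+ 2 * eps ^- 2) * eps - 14 * eps -> (k <= K0)%N.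
Proof.
rewrite /K_hat /ceil_pos; set t := (X in Num.ceil X).
have z0 : (0 <= Num.max (Num.ceil t) 0)%R by rewrite le_max lexx orbT.
have zE : (absz (Num.max (Num.ceil t) 0))%:R = (Num.max (Num.ceil t) 0)%:~R :> R.
  by rewrite -[in RHS](gez0_abs z0) -pmulrn.
exists (absz (Num.max (Num.ceil t) 0)); split=> //.
move=> k hk; rewrite -ltnS -(ltr_nat R).
have h1 : t <= (Num.max (Num.ceil t) 0)%:~R.
  by apply: le_trans (ceil_ge _) _; rewrite ler_int le_max lexx.
rewrite -natr1 zE.
have e0 := eps_gt0.
by apply: le_lt_trans hk _; move: h1; rewrite /t; lra.
Qed.

Lemma total_cost (K0 : nat) : K = K0%:R ->
  \sum_(k < K0.+1) step_cost k <= N_hat B L1 L2 fstar eps x0 y0.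
Proof.
move=> KE; rewrite /N_hat KE -/round_bound -alpha_bar_inv //.
have sv0 : 0 < sv by rewrite divr_gt0 ?mulr_gt0.
have al0 : 0 < alpha_bar L sv by exact: alpha_bar_gt0.
have rb0 : 0 <= round_bound.
  have M25 : 25 <= 1 + (24 * L + 4 * eps / D) * L^-1.
    have : 24 <= (24 * L + 4 * eps / D) * L^-1.
      by rewrite ler_pdivlMr // lerDl divr_ge0 ?mulr_ge0 // ltW.
    lra.
  by apply: le_trans (round_cost_le M25); lra.
rewrite /step_cost -mulr_sumr ler_wpM2l ?mulr_ge0 ?invr_ge0 ?(ltW al0) //.
rewrite big_split /= -mulr_sumr sumr_const card_ord -[_ *+ _]mulr_natl.
have := sum_ln_le R K0; rewrite -natr1; lra.
Qed.

End PenaltyConstants.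

Theorem theorem3 (R : realType) (n m : nat) (B : bilevel R n m)
    (L1 L2 : R) (G1 G2 : 'rV[R]_(n + m) -> 'rV[R]_(n + m))
    (fstar eps : R) (x0 : 'rV[R]_n) (y0 : 'rV[R]_m)
    (f2_pcc : proper_closed_convex (f2 B))
    (ft2_pcc : proper_closed_convex (ft2 B))
    (f_cont : {within XY B, continuous (joint (f B))})
    (ft_cont : {within XY B, continuous (joint (ft B))})
    (ft1_convex : forall x, X B x -> convex_function setT (ft1 B x))
    (f1_smooth : smooth_on L1 (XY B) (joint (f1 B)))
    (ft1_smooth : smooth_on L2 (XY B) (joint (ft1 B)))
    (X_compact : compact (X B))
    (Y_compact : compact (Y B))
    (G1_oracle : gradient_oracle L1 (XY B) (joint (f1 B)) G1)
    (G2_oracle : gradient_oracle L2 (XY B) (joint (ft1 B)) G2)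
    (fstar_opt : optimal_value B fstar)
    (* the constants and the methods divide by D_y and L_hat *)
    (D_y_gt0 : 0 < D_y B)
    (L_hat_gt0 : 0 < L_hat L1 L2 eps)
    (eps_range : 0 < eps <= 1 / 4)
    (x0X : X B x0) (y0Y : Y B y0)
    (x0y0 : (ft B x0 y0 <= min_ft B x0 + eps%:E)%E) :
  exists (xe : 'rV[R]_n) (ye ze : 'rV[R]_m) (c : calls),
    penalty_method B L1 L2 eps x0 y0 G1 G2 (row_mx xe ye, ze) c /\
    [/\ (dist 0 [set (a + rho eps *: b
                      - row_mx (rho eps *: grad_x_ft B xe ze) 0)%R
                | a in subdifferential (joint (f B)) (row_mx xe ye)
                & b in subdifferential (joint (ft B)) (row_mx xe ye)]
           <= eps%:E)%E,
        (dist 0 [set (rho eps *: s)%R | s in subdifferential (ft B xe) ze]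
           <= eps%:E)%E,
        (ft B xe ye <= min_ft B xe
           + (eps * (1 + fine (f B x0 y0) - f_low B
                     + 2 * eps ^+ 3
                       * ((L_hat L1 L2 eps)^-1
                          + 4 * D_y B ^+ 2 * L_hat L1 L2 eps * eps ^- 2)
                     + D_y B * eps / 4))%R%:E)%E
      & [/\ (n_grad_f1 c)%:R <= N_hat B L1 L2 fstar eps x0 y0,
            (n_grad_ft1 c)%:R <= N_hat B L1 L2 fstar eps x0 y0,
            (n_prox_f2 c)%:R <= N_hat B L1 L2 fstar eps x0 y0
          & (n_prox_ft2 c)%:R <= N_hat B L1 L2 fstar eps x0 y0]].
Proof.
have /andP[eps_gt0 eps_le] := eps_range.
have [y1 [y2 [Y1 Y2 y12]]] := diam_gt0_witness D_y_gt0.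
(* A positive diameter provides two distinct points, so that the Lipschitz
   constants cannot be negative. *)
have d12 : 0 < enorm (row_mx (0 : 'rV[R]_n) (y1 - y2)) by rewrite enorm_row_0mx.
have L1_ge0 := lipschitz_ge0 G1_oracle.2 d12.
have L2_ge0 := lipschitz_ge0 G2_oracle.2 d12.
have rh0 : 0 < rho eps by exact: rho_gt0.
have rhE : rho eps * eps = 1 by rewrite /rho mulVf // gt_eqF.
set L := L_hat L1 L2 eps; set D := D_y B.
have pcc := pen_p_closed_convex f2_pcc ft2_pcc X_compact Y_compact eps_gt0.
have qcc := pen_q_closed_convex ft2_pcc Y_compact eps_gt0.
have KXY x y : X B x -> Y B y -> XY B (row_mx x y).
  by move=> Xx Yy; rewrite /XY /= row_mxKl row_mxKr.
have KuE u : XY B u -> XY B (row_mx (lsubmx u) (rsubmx u)) by rewrite hsubmxK.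
pose fv (u : 'rV[R]_(n + m)) := joint (f1 B) u + f2_fine B (lsubmx u).
pose ftv (u : 'rV[R]_(n + m)) := joint (ft1 B) u + ft2_fine B (rsubmx u).
have jf u : XY B u -> joint (f B) u = (fv u)%:E by exact: joint_fE.
have jft u : XY B u -> joint (ft B) u = (ftv u)%:E by exact: joint_ftE.
have ftE x y : X B x -> Y B y -> ft B x y = (ftv (row_mx x y))%:E.
  by move=> Xx Yy; rewrite -(jft _ (KXY _ _ Xx Yy)) /joint row_mxKl row_mxKr.
have fE x y : X B x -> Y B y -> f B x y = (fv (row_mx x y))%:E.
  by move=> Xx Yy; rewrite -(jf _ (KXY _ _ Xx Yy)) /joint row_mxKl row_mxKr.
have finf u : XY B u -> joint (f B) u \is a fin_num by move=> /jf ->.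
have finft u : XY B u -> joint (ft B) u \is a fin_num by move=> /jft ->.
have [lbf _] := compact_fine_bounded (cco_neq0 pcc) (cco_compact pcc) f_cont
  finf.
have [lbft ubft] := compact_fine_bounded (cco_neq0 pcc) (cco_compact pcc) ft_cont
  finft.
have f_lowP u : XY B u -> f_low B <= fv u.
  by move=> Ku; apply: ge_inf => //; exists u => //; rewrite jf.
have ft_lowP u : XY B u -> ft_low B <= ftv u.
  by move=> Ku; apply: ge_inf => //; exists u => //; rewrite jft.
have ft_hiP u : XY B u -> ftv u <= ft_hi B.
  by move=> Ku; apply: ub_le_sup => //; exists u => //; rewrite jft.
have penE u z : XY B u -> Y B z ->
  pen_h B eps u z + pen_p_fine B eps u - pen_q_fine B eps z
  = fv u + rho eps * (ftv u - ftv (row_mx (lsubmx u) z)).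
  move=> Ku Yz; rewrite /pen_h /pen_p_fine /pen_q_fine /fv /ftv /joint row_mxKl row_mxKr; ring.
have low u z : XY B u -> Y B z ->
    pen_lower B eps <= pen_h B eps u z + pen_p_fine B eps u - pen_q_fine B eps z.
  move=> Ku Yz; rewrite penE // /pen_lower.
  have K1 := KXY _ _ Ku.1 Yz.
  have : rho eps * (ft_low B - ft_hi B) <= rho eps * (ftv u - ftv (row_mx (lsubmx u) z)).
    by rewrite ler_pM2l //; have := ft_lowP _ Ku; have := ft_hiP _ K1; lra.
  by have := f_lowP _ Ku; lra.
have [[xs [ys [ams fs]]] _] := fstar_opt.
have Xxs : X B xs.
  apply: contrapT => nX; move: fs; rewrite /f (f2N nX) addey //.
have Yys : Y B ys.
  apply: contrapT => nY; have := ams y0.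
  by rewrite (ftE _ _ Xxs y0Y) /ft (ft2N nY) addey //.
(* At the bilevel optimum the penalty is at most 0 for every z. *)
have upper z : Y B z ->
    pen_h B eps (row_mx xs ys) z + pen_p_fine B eps (row_mx xs ys) - pen_q_fine B eps z
      <= fstar.
  move=> Yz; rewrite penE ?row_mxKl //; last exact: KXY.
  have e1 : fv (row_mx xs ys) = fstar by move: fs; rewrite (fE _ _ Xxs Yys) => -[].
  have := ams z; rewrite (ftE _ _ Xxs Yys) (ftE _ _ Xxs Yz) lee_fin => h.
  have : rho eps * (ftv (row_mx xs ys) - ftv (row_mx xs z)) <= rho eps * 0 by rewrite ler_pM2l //; lra.
  by rewrite e1; lra.
have fx0 : fine (f B x0 y0) = fv (row_mx x0 y0) by rewrite fE.
pose f0 := fine (f B x0 y0).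
pose eps0 := eps `^ (3 / 2).
have eps00 : 0 < eps0 by rewrite powR_gt0.
have eps0sq : eps0 ^+ 2 = eps ^+ 3 by exact: powR_3half.
have eps0_le : eps0 <= eps / 2.
  rewrite -(ler_pXn2r (n:=2)) ?nnegrE ?(ltW eps00) ?divr_ge0 ?(ltW eps_gt0) // eps0sq.
  have : eps ^+ 2 * eps <= eps ^+ 2 * (1 / 4) by rewrite ler_wpM2l ?sqr_ge0.
  by rewrite expr_div_n -exprSr; lra.
pose H0 := f0 + 1; pose smoothed_lower := f_low B - eps * D / 4.
have svD : eps / (2 * D) / 2 * D ^+ 2 = eps * D / 4 by field; rewrite gt_eqF.
have sv0 : 0 < eps / (2 * D) / 2 by rewrite !divr_gt0 // mulr_gt0.
have Yd z z' : Y B z -> Y B z' -> eps / (2 * D) / 2 * dot (z - z') (z - z') <= eps * D / 4.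
  by move=> Yz Yz'; rewrite -svD ler_pM2l //; exact: Y_diam.
(* The starting point is nearly optimal for the lower level, so the penalty
   there is at most 1. *)
have gs z : Y B z ->
    smoothed_value (pen_p_fine B eps) (pen_q_fine B eps) (pen_h B eps) D eps y0
      (row_mx x0 y0) z <= H0.
  move=> Yz; rewrite /smoothed_value penE ?row_mxKl //; last exact: KXY.
  have h1 : ftv (row_mx x0 y0) <= ftv (row_mx x0 z) + eps.
    have h : (min_ft B x0 <= ft B x0 z)%E by apply: ereal_inf_lbound; exists z.
    move: (le_trans x0y0 (leeD2r eps%:E h)).
    by rewrite (ftE _ _ x0X y0Y) (ftE _ _ x0X Yz) -EFinD lee_fin.
  have : rho eps * (ftv (row_mx x0 y0) - ftv (row_mx x0 z)) <= rho eps * eps by rewrite ler_pM2l //; lra.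
  have := mulr_ge0 (ltW sv0) (dot_ge0 (z - y0)).
  by rewrite rhE /H0 /f0 fx0; lra.
(* At z = y the penalty vanishes, and the value is f(x,y) up to the smoothing.
   *)
have gl u : XY B u -> exists2 z, Y B z & smoothed_lower
    <= smoothed_value (pen_p_fine B eps) (pen_q_fine B eps) (pen_h B eps) D eps y0 u z.
  move=> Ku; exists (rsubmx u); first exact: Ku.2.
  rewrite /smoothed_value penE //; last exact: Ku.2.
  rewrite hsubmxK subrr mulr0 addr0 /smoothed_lower.
  by have := f_lowP _ Ku; have := Yd _ _ Ku.2 y0Y; lra.
have [K0 [KE KP]] := K_hat_nat B L1 L2 x0 y0 eps_gt0.
pose c1 : R := 1 / (2 * L) + D / eps.
have Kb (k : nat) :
    k%:R * (eps ^+ 2 / (16 * L)) <= H0 - smoothed_lower + 2 * eps0 ^+ 2 * c1 ->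
    (k <= K0)%N.
  move=> hk; apply: KP.
  have e16 : 0 < 16 * L * eps ^- 2 by rewrite !mulr_gt0 // invr_gt0 exprn_gt0.
  have {}hk := ler_wpM2r (ltW e16) hk.
  have E1 : k%:R * (eps ^+ 2 / (16 * L)) * (16 * L * eps ^- 2) = k%:R.
    by field; rewrite !gt_eqF.
  rewrite E1 eps0sq in hk; apply: le_trans hk _; rewrite /H0 /smoothed_lower /c1 /f0.
  have E2 : (fine (f B x0 y0) + 1 - (f_low B - eps * D / 4) + 2 * eps ^+ 3 * (1 / (2 * L) + D / eps))
      * (16 * L * eps ^- 2)
    = 16 * (1 + fine (f B x0 y0) - f_low B + eps * D / 4) * L * eps ^- 2 + 16 * eps + 32 * (D * L).
    by field; rewrite !gt_eqF.
  rewrite E2 -addrA -[X in _ <= X]addrA lerD2l.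
  (* The bound needed for the loop is below the constant in K_hat by a multiple
     of a square plus 14 eps; these 14 eps make the comparison strict, as the
     rounding in K_hat requires. *)
  have E3 : 32 * (1 + 4 * D ^+ 2 * L ^+ 2 * eps ^- 2) * eps - 14 * eps - (16 * eps + 32 * (D * L))
    = 2 * eps * (1 - 8 * (D * L * eps^-1)) ^+ 2.
    by field; rewrite gt_eqF.
  by rewrite -subr_ge0 E3 mulr_ge0 ?sqr_ge0 // mulr_ge0 // ltW.
have [[ue ze] [c [hM [bu [bv [/= sbu sbv nu nv hvalue]]] wc]]] :=
  @method_M_run R (n + m) m (XY B) (Y B)
  (pen_p_fine B eps) (pen_q_fine B eps) (pen_gradh eps G1 G2) (pen_proxp B eps) (pen_proxq B eps)
  (pen_gradient eps G1 G2)
  (fun g u => prox (fun u' => g%:E * pen_p B eps u')%E u)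
  (fun g z => prox (fun z' => g%:E * pen_q B eps z')%E z)
  (Calls 1 2 0 0) (Calls 0 0 1 1) (Calls 0 0 0 1)
  (pen_h B eps) L D eps eps0 4 (D_x B ^+ 2 + D_y B ^+ 2) (pen_lower B eps) fstar
  smoothed_lower H0 y0 (row_mx xs ys)
  (pen_gradhP eps G1 G2) (fun _ _ => conj erefl erefl) (fun _ _ => conj erefl erefl)
  (fun g u g0 => pen_p_prox_subgrad f2_pcc ft2_pcc X_compact Y_compact eps_gt0 u g0)
  (fun g z g0 => pen_q_prox_subgrad ft2_pcc Y_compact eps_gt0 z g0)
  pcc qcc L_hat_gt0 D_y_gt0 eps_gt0 eps00 eps0_le
  (pen_weak_convex f2_pcc ft2_pcc f1_smooth ft1_smooth X_compact Y_compact G1_oracle G2_oracle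
     eps_gt0 L2_ge0)
  (pen_concave G1 ft1_convex ft1_smooth G2_oracle eps_gt0)
  (pen_lip G1_oracle G2_oracle eps_gt0 L1_ge0 L2_ge0)
  (pen_round_within R) (XY_diam X_compact Y_compact)
  (Y_diam Y_compact) y0Y low (KXY _ _ Xxs Yys) upper
  (row_mx x0 y0) (KXY _ _ x0X y0Y) K0 (step_cost B L1 L2 fstar eps)
  gs gl Kb (step_cost_ok fstar D_y_gt0 L_hat_gt0 eps_gt0).
pose xe := lsubmx ue; pose ye := rsubmx ue.
have ueE : row_mx xe ye = ue by rewrite hsubmxK.
have [Xe Ye] := sbu.1; have Yz := sbv.1.
have GK := G2_oracle.1 _ (KXY _ _ Xe Yz).
exists xe, ye, ze, c; split; first by rewrite ueE.
rewrite ueE; split.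
- apply: ge_ereal_inf.
  exists (enorm ((pen_gradient eps G1 G2 ue ze).1 + bu))%:E; last by rewrite lee_fin.
  exists ((pen_gradient eps G1 G2 ue ze).1 + bu); last by rewrite sub0r enormN.
  exists (G1 ue + row_mx (lsubmx bu) 0).
    exact: (pen_subdifferential_f f2_pcc f1_smooth G1_oracle sbu).
  exists (G2 ue + row_mx 0 ((rho eps)^-1 *: rsubmx bu)).
    exact: (pen_subdifferential_ft ft2_pcc ft1_smooth G2_oracle eps_gt0 sbu).
  rewrite /pen_gradient /= /grad_x_ft -GK -/xe.
  rewrite -[bu in RHS]hsubmxK scalerDr !scale_row_mx !scaler0 scalerA mulfV ?gt_eqF // scale1r.
  have -> : row_mx (lsubmx bu) (rsubmx bu) = row_mx (lsubmx bu) 0 + row_mx 0 (rsubmx bu).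
    by rewrite add_row_mx addr0 add0r.
  move: (row_mx (lsubmx bu) 0) (row_mx 0 (rsubmx bu)) (row_mx (_ *: _) 0) => a1 a2 a3.
  by apply/rowP => i; rewrite !mxE; ring.
- apply: ge_ereal_inf.
  exists (enorm ((pen_gradient eps G1 G2 ue ze).2 - bv))%:E; last by rewrite lee_fin.
  exists (- ((pen_gradient eps G1 G2 ue ze).2 - bv)); last by rewrite sub0r opprK.
  exists (rsubmx (G2 (row_mx xe ze)) + (rho eps)^-1 *: bv).
    exact: (pen_subdifferential_z ft2_pcc ft1_smooth G2_oracle eps_gt0 Xe sbv).
  by rewrite /pen_gradient /= -/xe scalerDr scalerA mulfV ?gt_eqF // scale1r opprD !opprK.
- set c2 := eps * _.
  rewrite -leeBlDr // ; apply: le_ereal_inf_tmp => _ [z _ <-].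
  have [Yzz|nY] := pselect (Y B z); last by rewrite /ft (ft2N nY) addey // leey.
  rewrite (ftE _ _ Xe Ye) (ftE _ _ Xe Yzz) -EFinB lee_fin ueE.
  have := hvalue _ Yzz; rewrite /smoothed_value penE // => hg.
  have h1 := Yd _ _ Yzz y0Y; have h2 := f_lowP _ sbu.1.
  have h3 : rho eps * (ftv ue - ftv (row_mx xe z)) <= H0 - f_low B + eps * D / 4 + 2 * eps ^+ 3 * c1.
    by move: hg; rewrite eps0sq -/c1 -/xe; lra.
  have {}h3 := ler_wpM2l (ltW eps_gt0) h3.
  rewrite mulrA (mulrC eps (rho eps)) rhE mul1r in h3.
  suff : eps * (H0 - f_low B + eps * D / 4 + 2 * eps ^+ 3 * c1) <= c2 by lra.
  rewrite /c2 ler_pM2l //.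
  have hc : c1 <= L^-1 + 4 * D ^+ 2 * L * eps ^- 2.
    rewrite -subr_ge0.
    (* With a = D L / eps the difference is (1/2 - a + 4 a^2) / L. *)
    have -> : L^-1 + 4 * D ^+ 2 * L * eps ^- 2 - c1
      = L^-1 * ((2 * (D * L * eps^-1) - 1 / 4) ^+ 2 + 7 / 16).
      by rewrite /c1; field; rewrite !gt_eqF.
    by rewrite mulr_ge0 ?invr_ge0 ?(ltW L_hat_gt0) // addr_ge0 ?sqr_ge0 // divr_ge0.
  have e3 : 0 <= 2 * eps ^+ 3 by rewrite mulr_ge0 // exprn_ge0 // ltW.
  have := ler_wpM2l e3 hc; rewrite /H0 /f0; lra.
- by have [] := within_le wc (total_cost fstar D_y_gt0 L_hat_gt0 eps_gt0 KE).
Qed.
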